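(* Let $\sigma\ge 1$. Let $(\omega,c)\in\mathbb{R}^2$ satisfy either $\omega>c^2/4$, or $\omega=c^2/4$ and $c>0$. Let $(\alpha,\beta)\in\mathbb{R}^2$ satisfy $2\alpha-\beta>0$, $2\alpha+\beta>0$, and moreover $\beta c\le 0$ when $\omega>c^2/4$, respectively $\beta<0$ when $\omega=c^2/4$ and $c>0$. Then $$\mathscr{M}_{\omega,c}^{\alpha,\beta}=\mathscr{G}_{\omega,c}=\{e^{i\theta_0}\phi_{\omega,c}(\cdot-x_0):\ \theta_0\in[0,2\pi),\ x_0\in\mathbb{R}\}.$$
   Context: Functions are complex-valued on $\mathbb{R}$. Function space: $X_{\omega,c}=H^1(\mathbb{R})$ if $\omega>c^2/4$, and $X_{\omega,c}=\dot H^1(\mathbb{R})\cap L^{2\sigma+2}(\mathbb{R})$ (functions $\psi\in L^{2\sigma+2}$ with $\partial_x\psi\in L^2$) if $\omega=c^2/4$ and $c>0$. Functionals: $N(\psi)=\mathrm{Re}\int_{\mathbb{R}} i|\psi|^{2\sigma}\overline{\psi}\,\partial_x\psi\,dx$. For $\psi\in X_{\omega,c}$, $$\widetilde S_{\omega,c}(\psi)=\tfrac12\|\partial_x\psi\|_{L^2}^2+\tfrac12\left(\omega-\tfrac{c^2}{4}\right)\|\psi\|_{L^2}^2+\tfrac{c}{2(2\sigma+2)}\|\psi\|_{L^{2\sigma+2}}^{2\sigma+2}-\tfrac{1}{2\sigma+2}N(\psi),$$ $$\widetilde K_{\omega,c}^{\alpha,\beta}(\psi)=\tfrac{2\alpha-\beta}{2}\|\partial_x\psi\|_{L^2}^2+\tfrac{2\alpha+\beta}{2}\left(\omega-\tfrac{c^2}{4}\right)\|\psi\|_{L^2}^2+\tfrac{\{(2\sigma+2)\alpha+\beta\}c}{2(2\sigma+2)}\|\psi\|_{L^{2\sigma+2}}^{2\sigma+2}-\alpha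 N(\psi),$$ where the $L^2$-norm term is absent when $\omega=c^2/4$. (One has $\widetilde K_{\omega,c}^{\alpha,\beta}(\psi)=\partial_\lambda \widetilde S_{\omega,c}(e^{\alpha\lambda}\psi(e^{-\beta\lambda}\cdot))|_{\lambda=0}$.) For $\varphi$ with $e^{-\frac c2 ix}\varphi\in X_{\omega,c}$ put $S_{\omega,c}(\varphi)=\widetilde S_{\omega,c}(e^{-\frac c2 ix}\varphi)$ and $K_{\omega,c}^{\alpha,\beta}(\varphi)=\widetilde K_{\omega,c}^{\alpha,\beta}(e^{-\frac c2 ix}\varphi)$. For $\varphi\in H^1(\mathbb{R})$, $S_{\omega,c}(\varphi)=E(\varphi)+\frac\omega2\|\varphi\|_{L^2}^2+\frac c2P(\varphi)$ with $E(\varphi)=\frac12\|\partial_x\varphi\|_{L^2}^2-\frac1{2\sigma+2}N(\varphi)$ and $P(\varphi)=\mathrm{Re}\int i\,\partial_x\varphi\,\overline\varphi\,dx$. Minimization problem: $$\mu_{\omega,c}^{\alpha,\beta}=\inf\{S_{\omega,c}(\varphi): e^{-\frac c2ix}\varphi\in X_{\omega,c}\setminus\{0\},\ K_{\omega,c}^{\alpha,\beta}(\varphi)=0\}.$$ Sets: $$\mathscr{M}_{\omega,c}^{\alpha,\beta}=\{\varphi: e^{-\frac c2ix}\varphi\in X_{\omega,c}\setminus\{0\},\ S_{\omega,c}(\varphi)=\mu_{\omega,c}^{\alpha,\beta},\ K_{\omega,c}^{\alpha,\beta}(\varphi)=0\},$$ $$\mathscr{G}_{\omega,c}=\{\varphi: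 e^{-\frac c2ix}\varphi\in X_{\omega,c}\setminus\{0\},\ S_{\omega,c}'(\varphi)=0\},$$ where $S_{\omega,c}'(\varphi)=0$ means $-\varphi''+\omega\varphi+ic\varphi'-i|\varphi|^{2\sigma}\varphi'=0$ on $\mathbb{R}$ in the sense of distributions. Solitary wave profile: $$\phi_{\omega,c}(x)=\Phi_{\omega,c}(x)\exp\left(i\tfrac c2x-\tfrac{i}{2\sigma+2}\int_0^x\Phi_{\omega,c}(y)^{2\sigma}dy\right),$$ with $\Phi_{\omega,c}(x)=\left\{\frac{(\sigma+1)(4\omega-c^2)}{2\sqrt\omega\cosh(\sigma\sqrt{4\omega-c^2}\,x)-c}\right\}^{\frac1{2\sigma}}$ if $\omega>c^2/4$, and $\Phi_{\omega,c}(x)=\left\{\frac{2(\sigma+1)c}{\sigma^2(cx)^2+1}\right\}^{\frac1{2\sigma}}$ if $\omega=c^2/4$ and $c>0$. *)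

(* Defs.v *)
From HB Require Import structures.
From mathcomp Require Import all_boot all_order all_algebra.
From mathcomp Require Import all_classical all_reals all_analysis.
From mathcomp Require Import complex.

Set Implicit Arguments.
Unset Strict Implicit.
Unset Printing Implicit Defensive.

Import Order.TTheory GRing.Theory Num.Theory.
Import numFieldNormedType.Exports.

Local Open Scope classical_set_scope.
Local Open Scope ring_scope.
Local Open Scope complex_scope.

(* Elements of the function spaces are represented by Borel measurable
   functions R -> R[i]; two representatives that agree almost everywhere stand
   for the same element.  All predicates and functionals below are invariant
   under almost everywhere equality of measurable representatives, so an
   equality of (saturated) sets of representatives is an equality of sets of
   classes. *)

Section LebesgueSobolev.
Context {R : realType}.
Implicit Types (u v g : R -> R[i]) (f : R -> R) (p : R).

Local Notation leb := (@lebesgue_measure R).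

Definition cabs (z : R[i]) : R := ComplexField.Normc.normc z.

Definition expi (t : R) : R[i] := cos t +i* sin t.

Definition cmeasurable u : Prop :=
  measurable_fun [set: R] (fun x => complex.Re (u x)) /\
  measurable_fun [set: R] (fun x => complex.Im (u x)).

Definition cloc_integrable u : Prop :=
  locally_integrable [set: R] (fun x => complex.Re (u x)) /\
  locally_integrable [set: R] (fun x => complex.Im (u x)).

Definition cintegral u : R[i] :=
  (\int[leb]_x complex.Re (u x)) +i* (\int[leb]_x complex.Im (u x)).

Definition ceq_ae u v : Prop := {ae leb, forall x, u x = v x}.

Definition in_Lp p u : Prop :=
  cmeasurable u /\ finite_norm leb p%:E (fun x => cabs (u x)).

Definition Lpnorm p u : R := fine ('N[leb]_(p%:E)[EFin \o (fun x => cabs (u x))])%E.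

Definition test_function f : Prop :=
  (forall n x, derivable (derive1n n f) x 1) /\
  compact (closure [set x | f x != 0]).

(* The action on test functions of the distribution defined by u; real-valued
   test functions determine a complex distribution by linearity. *)
Definition pairing u f : R[i] := cintegral (fun x => u x * (f x)%:C).

Definition is_weak_derivative u g : Prop :=
  cloc_integrable u /\ cloc_integrable g /\
  forall f, test_function f -> pairing u (derive1 f) = - pairing g f.

(* A representative of the weak derivative, which is unique up to almost
   everywhere equality; the value is irrelevant when there is none. *)
Definition weak_derivative u : R -> R[i] :=
  xget (fun=> 0) [set g | is_weak_derivative u g].

Definition weak_derivative_in_L2 u : Prop :=
  exists g, is_weak_derivative u g /\ in_Lp 2 g.

End LebesgueSobolev.

Section SolitaryWaves.
Context {R : realType}.
Variables sigma omega c : R.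
Implicit Types psi phi : R -> R[i].

Definition in_X psi : Prop :=
  if c ^+ 2 / 4 < omega then in_Lp 2 psi /\ weak_derivative_in_L2 psi
  else in_Lp (2 * sigma + 2) psi /\ weak_derivative_in_L2 psi.

Definition functional_N psi : R :=
  complex.Re (cintegral (fun x =>
    'i%C * (cabs (psi x) `^ (2 * sigma))%:C * ((psi x)^*)%C *
    weak_derivative psi x)).

(* When omega = c^2/4 the L^2 term has a zero coefficient, whatever the value
   of the (real-valued) L^2 norm: the term is absent. *)
Definition S_tilde psi : R :=
  1 / 2 * Lpnorm 2 (weak_derivative psi) ^+ 2
  + 1 / 2 * (omega - c ^+ 2 / 4) * Lpnorm 2 psi ^+ 2
  + c / (2 * (2 * sigma + 2))
    * Lpnorm (2 * sigma + 2) psi `^ (2 * sigma + 2)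
  - 1 / (2 * sigma + 2) * functional_N psi.

Definition K_tilde (alpha beta : R) psi : R :=
  (2 * alpha - beta) / 2 * Lpnorm 2 (weak_derivative psi) ^+ 2
  + (2 * alpha + beta) / 2 * (omega - c ^+ 2 / 4) * Lpnorm 2 psi ^+ 2
  + ((2 * sigma + 2) * alpha + beta) * c / (2 * (2 * sigma + 2))
    * Lpnorm (2 * sigma + 2) psi `^ (2 * sigma + 2)
  - alpha * functional_N psi.

Definition gauge phi : R -> R[i] := fun x => expi (- (c / 2 * x)) * phi x.

Definition action_S phi : R := S_tilde (gauge phi).

Definition functional_K (alpha beta : R) phi : R :=
  K_tilde alpha beta (gauge phi).

Definition admissible phi : Prop :=
  in_X (gauge phi) /\ ~ ceq_ae (gauge phi) (fun=> 0).

(* The infimum is taken in the extended reals, so that it is meaningful before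
   one knows that the constraint set is nonempty and S bounded below on it. *)
Definition mu_min (alpha beta : R) : \bar R :=
  ereal_inf [set (action_S phi)%:E | phi in
    [set phi | admissible phi /\ functional_K alpha beta phi = 0]].

Definition minimizers (alpha beta : R) : set (R -> R[i]) :=
  [set phi | admissible phi /\ (action_S phi)%:E = mu_min alpha beta /\
             functional_K alpha beta phi = 0].

(* - phi'' + omega phi + i c phi' - i |phi|^(2 sigma) phi' = 0 as an equality
   of distributions. *)
Definition critical_point phi : Prop :=
  forall f : R -> R, test_function f ->
    - pairing phi (derive1n 2 f)
    + omega%:C * pairing phi f
    + 'i%C * c%:C * pairing (weak_derivative phi) f
    - 'i%C * pairing (fun x => (cabs (phi x) `^ (2 * sigma))%:C *
                             weak_derivative phi x) f = 0.

Definition critical_points : set (R -> R[i]) :=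
  [set phi | admissible phi /\ critical_point phi].

Definition cosh (x : R) : R := (expR x + expR (- x)) / 2.

Definition profile_modulus (x : R) : R :=
  (if c ^+ 2 / 4 < omega then
     (sigma + 1) * (4 * omega - c ^+ 2) /
     (2 * Num.sqrt omega * cosh (sigma * Num.sqrt (4 * omega - c ^+ 2) * x) - c)
   else
     2 * (sigma + 1) * c / (sigma ^+ 2 * (c * x) ^+ 2 + 1))
  `^ (1 / (2 * sigma)).

Definition integral_from0 (h : R -> R) (x : R) : R :=
  if 0 <= x then \int[@lebesgue_measure R]_(y in `[0, x]) h y
  else - \int[@lebesgue_measure R]_(y in `[x, 0]) h y.

Definition solitary_wave (x : R) : R[i] :=
  (profile_modulus x)%:C *
  expi (c / 2 * x - 1 / (2 * sigma + 2) *
        integral_from0 (fun y => profile_modulus y `^ (2 * sigma)) x).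

Definition solitary_wave_orbit : set (R -> R[i]) :=
  [set phi | cmeasurable phi /\
     exists theta0 x0 : R, 0 <= theta0 < 2 * pi /\
       ceq_ae phi (fun x => expi theta0 * solitary_wave (x - x0))].

End SolitaryWaves.

(* Main.v *)
(* Write psi = e^(-icx/2) phi, q = |psi|^2, kappa = omega - c^2/4,
   g = q^sigma / (2 sigma + 2) and w = kappa + c g - g^2.  The density of the
   action is |psi'|^2/2 + kappa q/2 + c g q/2 + g Im(conj(psi) psi').  If q has
   maximum qt, the positive zero of w, and eps = 1 before the maximum point and
   eps = -1 after it, completing the square gives
     action = d + (1/2) int |psi' - (eps sqrt(w(q)) - i g(q)) psi|^2
   with an explicit constant d.  On the constraint K = 0 the action is maximal
   along the scaling psi |-> e^(alpha l) psi(e^(-beta l) x), because the powers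
   of e^l which occur compare with their tangents by Bernoulli's inequality; a
   suitable l makes the maximum of q equal to qt, so that action >= d.  Equality
   forces psi' = (eps sqrt(w(q)) - i g(q)) psi.  Such a psi may stay for some
   time on the plateau q = qt, but K = 0 excludes this: off the plateau the
   density of K is the exact derivative of alpha q'/2, and on it it is negative.
   A critical point is C^2; its two first integrals vanish at infinity and give
   Im(conj(psi) psi') = -g q and |psi'|^2 = kappa q + c g q, hence
   psi' = (h - i g(q)) psi with h^2 = w(q).  In both cases q^(-sigma) solves
   y'' = 4 sigma^2 kappa y + sigma^2 c / (sigma + 1), so q is the explicit
   profile up to translation, and the phase follows by integrating g(q).  No
   compactness argument is needed. *)

Require Import Defs.
From mathcomp Require Import all_boot all_order all_algebra.
From mathcomp Require Import all_classical all_reals all_analysis.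
From mathcomp Require Import measurable_realfun complex ring lra.

Set Implicit Arguments.
Unset Strict Implicit.
Unset Printing Implicit Defensive.

Import Order.TTheory GRing.Theory Num.Theory.
Import numFieldNormedType.Exports.

Local Open Scope classical_set_scope.
Local Open Scope ring_scope.

(** * Absolutely continuous functions *)

(** The constant is [d = Gam qtop - Gam 0] with [Gam] a primitive of [sqrt w]: the cross term of the
    expanded square is, up to a factor, the derivative of [Gam (q)], and switching [eps] at the
    maximum makes the two halves add up instead of cancelling. This needs [q] to peak exactly at
    [qtop]: above it [w] is negative, below it the increment of [Gam] is too small. Hence the
    scaling, for which [beta c <= 0] places each power on the right side of its tangent. The density
    of the constraint becomes an exact derivative because [|psi'|^2 = kappa q + c g q] along the
    first-order equation, which cancels every term in [beta]. The obstacle is that [sqrt w] is not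
    Lipschitz at [qtop], so the first-order equation for [q] has many solutions through the maximum.
    The linear equation for [q^(-sigma)] restores uniqueness as soon as [q < qtop], and the
    constraint removes the plateau. A second obstacle is regularity: elements of the space only have
    an L^2 weak derivative, so the arguments use locally absolutely continuous representatives until
    the equations themselves yield continuous derivatives. *)

Section RealDerivatives.
Context {R : realType}.
Implicit Types (f g : R -> R) (x a b k : R).

(** The derivative rules below are stated on lambda terms, so that a derivative is assembled as a
    term with whatever value comes out; [der_eq] then replaces that value by the intended one,
    usually through [ring] or [field]. *)
Lemma der_eq f x a b : is_derive x 1 f a -> a = b -> is_derive x 1 f b.
Proof. by move=> fa <-. Qed.

Lemma der_id x : is_derive x 1 (fun t : R => t) 1.
Proof. exact: is_derive_id. Qed.

Lemma der_cst x k : is_derive x 1 (fun=> k) 0.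
Proof. exact: is_derive_cst. Qed.

Lemma derD f g x a b : is_derive x 1 f a -> is_derive x 1 g b ->
  is_derive x 1 (fun t => f t + g t) (a + b).
Proof. by move=> fa gb; exact: is_deriveD. Qed.

Lemma derN f x a : is_derive x 1 f a -> is_derive x 1 (fun t => - f t) (- a).
Proof. by move=> fa; exact: is_deriveN. Qed.

Lemma derB f g x a b : is_derive x 1 f a -> is_derive x 1 g b ->
  is_derive x 1 (fun t => f t - g t) (a - b).
Proof. by move=> fa gb; exact: is_deriveB. Qed.

Lemma derM f g x a b : is_derive x 1 f a -> is_derive x 1 g b ->
  is_derive x 1 (fun t => f t * g t) (f x * b + g x * a).
Proof. by move=> fa gb; exact: is_deriveM. Qed.

Lemma derZ f x a k : is_derive x 1 f a ->
  is_derive x 1 (fun t => k * f t) (k * a).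
Proof. by move=> fa; exact: is_deriveZ. Qed.

Lemma der_sqr f x a : is_derive x 1 f a ->
  is_derive x 1 (fun t => f t ^+ 2) (2 * f x * a).
Proof.
move=> fa; under eq_fun do rewrite expr2.
by apply: der_eq (derM fa fa) _; ring.
Qed.

Lemma derX f x a n : is_derive x 1 f a ->
  is_derive x 1 (fun t => f t ^+ n) (n%:R * f x ^+ n.-1 * a).
Proof.
move=> fa; elim: n => [|n IH].
  under eq_fun do rewrite expr0.
  by apply: der_eq (der_cst x 1) _; rewrite !mul0r.
under eq_fun do rewrite exprS.
apply: der_eq (derM fa IH) _; case: n {IH} => [|n]; first by rewrite /=; ring.
by rewrite /= (exprS (f x) n) -[in RHS](natr1 n.+1); ring.
Qed.

Lemma derV f x a : f x != 0 -> is_derive x 1 f a ->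
  is_derive x 1 (fun t => (f t)^-1) (- (a / f x ^+ 2)).
Proof.
move=> fx0 fa; apply: der_eq (is_deriveV fx0 fa) _.
by rewrite /GRing.scale/= -exprVn; ring.
Qed.

Lemma der_comp f g x a b : is_derive x 1 f a -> is_derive (f x) 1 g b ->
  is_derive x 1 (fun t => g (f t)) (b * a).
Proof. by move=> fa gb; exact: (is_derive1_comp gb fa). Qed.

Lemma der_near f g x a : is_derive x 1 f a -> (\near x, f x = g x) ->
  is_derive x 1 g a.
Proof. by move=> fa fg; exact: near_eq_is_derive fg fa. Qed.

End RealDerivatives.

Section RealContinuity.
Context {R : realType}.
Implicit Types (f g : R -> R).

Lemma contD f g : continuous f -> continuous g -> continuous (fun x => f x + g x).
Proof. by move=> cf cg x; apply: cvgD; [exact: cf|exact: cg]. Qed.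

Lemma contB f g : continuous f -> continuous g -> continuous (fun x => f x - g x).
Proof. by move=> cf cg x; apply: cvgB; [exact: cf|exact: cg]. Qed.

Lemma contM f g : continuous f -> continuous g -> continuous (fun x => f x * g x).
Proof. by move=> cf cg x; apply: cvgM; [exact: cf|exact: cg]. Qed.

Lemma contZ (k : R) f : continuous f -> continuous (fun x => k * f x).
Proof. by move=> cf x; apply: cvgM; [exact: cvg_cst|exact: cf]. Qed.

Lemma cont_comp f g : continuous f -> continuous g -> continuous (fun x => g (f x)).
Proof. by move=> cf cg x; apply: (@continuous_comp _ _ _ f g); [exact: cf|exact: cg]. Qed.

Lemma cont_shift f (c : R) : continuous f -> continuous (fun x => f (x - c)).
Proof.
apply: cont_comp => x; apply: cvgB; [exact: cvg_id|exact: cvg_cst].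
Qed.

Lemma cont_rescale f (x e : R) : continuous f ->
  continuous (fun y => e^-1 * f ((y - x) / e)).
Proof.
move=> cf; apply: contZ; apply: (cont_shift (f := fun y => f (y / e))).
by apply: cont_comp cf => y; apply: cvgM; [exact: cvg_id|exact: cvg_cst].
Qed.

End RealContinuity.

Section AbsolutelyContinuous.
Context {R : realType}.
Implicit Types (f g h F G : R -> R) (a b x y : R).

Local Notation mu := (@lebesgue_measure R).
Local Notation intble A f := (mu.-integrable A (EFin \o f)).

Lemma locint_itv f a b : locally_integrable [set: R] f -> intble `[a, b] f.
Proof.
move=> [mf _ fi]; apply/integrableP; split.
  by apply/measurable_EFinP; apply: measurable_funS mf.
by apply: fi => //; exact: segment_compact.
Qed.

Lemma continuous_locint f : continuous f -> locally_integrable [set: R] f.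
Proof.
move=> cf; split; [exact: continuous_measurable_fun|exact: openT|].
move=> K _ cK.
have /integrableP[_] : intble K f.
  by apply: continuous_compact_integrable => //; apply: continuous_subspaceT.
by [].
Qed.

Lemma integrable_locint f : intble setT f -> locally_integrable [set: R] f.
Proof. by move=> fi; apply: open_integrable_locally => //; exact: openT. Qed.

Lemma locintM f h : continuous h -> locally_integrable [set: R] f ->
  locally_integrable [set: R] (fun x => h x * f x).
Proof.
move=> ch [mf _ fi]; split; [|exact: openT|].
  by apply: measurable_funM => //; exact: continuous_measurable_fun.
move=> K _ cK.
have mK : measurable K by exact: compact_measurable.
have if_ : intble K f.
  apply/integrableP; split; last exact: fi.
  by apply/measurable_EFinP; apply: measurable_funS mf.
have /integrableP[_] // : mu.-integrable K ((EFin \o h) \* (EFin \o f))%E.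
apply: integrableMr => //.
  by apply: measurable_funS (continuous_measurable_fun ch).
have : compact (h @` K).
  by apply: continuous_compact => //; exact: continuous_subspaceT.
move/compact_bounded => [M [Mr HM]]; exists M; split => // M' MM' x Kx /=.
by apply: HM => //; exists x.
Qed.

Lemma locintZ f k : locally_integrable [set: R] f ->
  locally_integrable [set: R] (fun x => k * f x).
Proof. by apply: locintM => x; exact: cvg_cst. Qed.

Lemma locint_norm f : locally_integrable [set: R] f ->
  locally_integrable [set: R] (fun x => `|f x|).
Proof.
move=> [mf o fi]; split => //; first exact: measurableT_comp.
by move=> K _ cK; under eq_integral do rewrite normr_id; exact: fi.
Qed.

Lemma Rintegral_split f a b x : locally_integrable [set: R] f ->
  a <= x -> x <= b ->
  \int[mu]_(t in `[a, b]) f t = \int[mu]_(t in `[a, x]) f t + \int[mu]_(t in `[x, b]) f t.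
Proof.
move=> lf ax xb.
have lfab := locint_itv a b lf.
rewrite -(@Rintegral_itv_obnd_cbnd _ x); last first.
  by apply: integrableS (locint_itv x b lf) => //; apply: subset_itvr; rewrite bnd_simp.
by rewrite -(Rintegral_itvB lfab) ?bnd_simp// addrC subrK.
Qed.

Lemma Rintegral_norm_bound f a b : locally_integrable [set: R] f ->
  `|\int[mu]_(t in `[a, b]) f t| <= \int[mu]_(t in `[a, b]) `|f t|.
Proof. by move=> lf; apply: le_normr_Rintegral => //; exact: locint_itv. Qed.

Lemma aeS (P Q : R -> Prop) : (forall x, P x -> Q x) ->
  {ae mu, forall x, P x} -> {ae mu, forall x, Q x}.
Proof. by move=> PQ; apply: filterS; [exact: (ae_filter_ringOfSetsType mu)|]. Qed.

Lemma aeI (P Q : R -> Prop) : {ae mu, forall x, P x} -> {ae mu, forall x, Q x} ->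
  {ae mu, forall x, P x /\ Q x}.
Proof.
by move=> aP aQ; apply: (filterI (F := almost_everywhere mu)) => //;
  exact: (ae_filter_ringOfSetsType mu).
Qed.

(* [F] is locally absolutely continuous with almost everywhere derivative [f]. *)
Definition ac_on F f := locally_integrable [set: R] f /\
  forall a b, a <= b -> F b - F a = \int[mu]_(t in `[a, b]) f t.

Lemma is_derive1_continuous F x l : is_derive x 1 F l -> {for x, continuous F}.
Proof. by move=> [dF _]; apply: differentiable_continuous; exact/derivable1_diffP. Qed.

Lemma is_derive1_continuousT F f : (forall x, is_derive x 1 F (f x)) -> continuous F.
Proof. by move=> dF x; exact: is_derive1_continuous (dF x). Qed.

Lemma ac_on_FTC F f : continuous f -> (forall x, is_derive x 1 F (f x)) ->
  ac_on F f.
Proof.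
move=> cf dF; split; first exact: continuous_locint.
move=> a b; rewrite le_eqVlt => /predU1P[<-|ab].
  by rewrite subrr set_itv1 Rintegral_set1.
rewrite /Rintegral (@continuous_FTC2 _ f F) //=.
- exact: continuous_subspaceT.
- split=> [x _||].
  + by case: (dF x).
  + by apply: cvg_at_right_filter; exact: is_derive1_continuous.
  + by apply: cvg_at_left_filter; exact: is_derive1_continuous.
- by move=> x _; rewrite derive1E; case: (dF x).
Qed.

Lemma ac_on_exists f : locally_integrable [set: R] f -> exists F, ac_on F f.
Proof.
move=> lf.
exists (fun x => if 0 <= x then \int[mu]_(t in `[0, x]) f t
                 else - \int[mu]_(t in `[x, 0]) f t); split=> // a b ab.
have [a0|a0] := leP 0 a.
  rewrite (le_trans a0 ab) (Rintegral_split lf a0 ab); ring.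
have [b0|b0] := leP 0 b.
  by rewrite (Rintegral_split lf (ltW a0) b0); ring.
rewrite (Rintegral_split lf ab (ltW b0)); ring.
Qed.

Lemma Rintegral_abs_cvg f a b : a < b -> locally_integrable [set: R] f ->
  {within `[a, b], continuous (fun x => \int[mu]_(t in `[a, x]) f t)}.
Proof.
move=> ab lf.
exact: (parameterized_integral_continuous (ltW ab) (locint_itv a b lf)).
Qed.

Lemma ac_on_continuous F f : ac_on F f -> continuous F.
Proof.
move=> [lf FE] x.
have ab : x - 1 < x + 1 by lra.
have cI := Rintegral_abs_cvg ab lf.
have /(_ x) cI' := within_continuous_continuous ab cI.
have xab : x \in `]x - 1, x + 1[ by rewrite in_itv/=; apply/andP; split; lra.
have {}cI' := cI' xab.
have cI2 : {for x, continuous (fun y => F (x - 1) + \int[mu]_(t in `[x - 1, y]) f t)}.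
  by apply: cvgD => //; exact: cvg_cst.
have E : \forall y \near x, F (x - 1) + \int[mu]_(t in `[x - 1, y]) f t = F y.
  near=> y; rewrite -FE; first by ring.
  by apply: ltW; near: y; apply: lt_nbhsr; lra.
rewrite /continuous_at -(nbhs_singleton E).
exact: cvg_trans (near_eq_cvg E) cI2.
Unshelve. all: end_near. Qed.

Lemma ac_on_is_derive F f x : ac_on F f -> lebesgue_pt f x ->
  is_derive x 1 F (f x).
Proof.
move=> [lf FE] lx.
have xu : x < x + 1 by lra.
have [] := @FTC1_lebesgue_pt _ f (BLeft (x - 1)) x (x + 1) xu _ _ lx.
- exact: locint_itv.
- by rewrite (@lte_fin R); lra.
move=> dI Ix.
apply: (@near_eq_is_derive _ _ _
  (fun y => F (x - 1) + \int[mu]_(t in `[x - 1, y]) f t)).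
  near=> y; rewrite -FE; first by ring.
  by apply: ltW; near: y; apply: lt_nbhsr; lra.
have dI' : is_derive x 1 (fun y => \int[mu]_(t in `[x - 1, y]) f t) (f x).
  by apply: DeriveDef; [exact: dI|rewrite -derive1E; exact: Ix].
by rewrite -[f x]add0r; apply: is_deriveD.
Unshelve. all: end_near. Qed.

Lemma ac_on_is_derive_continuous F f x : ac_on F f -> {for x, continuous f} ->
  is_derive x 1 F (f x).
Proof.
move=> aF cf; apply: ac_on_is_derive => //.
apply: (@continuous_lebesgue_pt _ f x setT) => //.
  by split; [exact: openT|].
by case: aF => -[].
Qed.

Lemma ac_on_ae F f g : locally_integrable [set: R] g ->
  {ae mu, forall x, f x = g x} -> ac_on F f -> ac_on F g.
Proof.
move=> lg fg [lf FE]; split=> // a b ab; rewrite FE//.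
congr fine; apply: ae_eq_integral => //.
- by apply/measurable_EFinP; apply: measurable_funS (let: And3 h _ _ := lf in h).
- by apply/measurable_EFinP; apply: measurable_funS (let: And3 h _ _ := lg in h).
by apply: aeS fg => x /= -> _.
Qed.

(** The zero function is a primitive of [f - g]; at every Lebesgue point its derivative is both 0
    and [f - g]. *)
Lemma ac_on_ae_unique F f g : ac_on F f -> ac_on F g ->
  {ae mu, forall x, f x = g x}.
Proof.
move=> [lf Ff] [lg Fg].
have lfg := locally_integrableB lf lg.
have ac0 : ac_on (cst 0) (f \- g)%R.
  split=> // a b ab; rewrite subrr RintegralB//; try exact: locint_itv.
  by rewrite -Ff// -Fg// subrr.
apply: aeS (lebesgue_differentiation lfg) => x /(ac_on_is_derive ac0)[_].
by rewrite derive_cst => /esym/eqP; rewrite subr_eq0 => /eqP.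
Qed.

Lemma ac_onD F f G g : ac_on F f -> ac_on G g ->
  ac_on (fun x => F x + G x) (fun x => f x + g x).
Proof.
move=> [lf Ff] [lg Gg]; split; first exact: locally_integrableD.
move=> a b ab; rewrite RintegralD//; try exact: locint_itv.
by rewrite -Ff// -Gg//; ring.
Qed.

Lemma ac_onZ F f k : ac_on F f -> ac_on (fun x => k * F x) (fun x => k * f x).
Proof.
move=> [lf Ff]; split; first exact: locintZ.
move=> a b ab; rewrite RintegralZl//; last exact: locint_itv.
by rewrite -Ff//; ring.
Qed.

Lemma ac_onN F f : ac_on F f -> ac_on (fun x => - F x) (fun x => - f x).
Proof.
move=> /(ac_onZ (-1)).
under eq_fun do rewrite mulN1r.
by under [in X in _ X]eq_fun do rewrite mulN1r.
Qed.

Lemma ac_on_cst k : ac_on (fun=> k) (fun=> 0).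
Proof.
split; first by apply: continuous_locint => x; exact: cvg_cst.
by move=> a b ab; rewrite subrr /Rintegral integral0.
Qed.

(** Real induction: the supremum of the points up to which [H] stays above [H a] belongs to that set
    and, by the condition at this point, cannot lie before [b]. Each point is compared only with its
    own neighbours, so no uniformity is required. *)
Lemma locally_monotone_le H a b :
  (forall x, \forall y \near x, 0 <= (y - x) * (H y - H x)) ->
  a <= b -> H a <= H b.
Proof.
move=> loc ab.
pose S := [set x | a <= x <= b /\ forall t, a <= t <= x -> H a <= H t].
have Sa : S a.
  split; first by rewrite lexx.
  by move=> t /andP[at_ ta]; rewrite (le_anti (introT andP (conj at_ ta))).
have ubS : has_ubound S by exists b => x [/andP[]].
have supS : has_sup S by split; [exists a|].
set s := sup S.
have as_ : a <= s by exact: ub_le_sup.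
have sb : s <= b by apply: ge_sup; [exists a|move=> x [/andP[]]].
have [e /= e0 He] := loc s.
have [t St] := sup_adherent e0 supS.
rewrite -/s => set_.
have ts : t <= s by exact: ub_le_sup.
have [/andP[at_ tb] Ht] := St.
have HsHa : H a <= H s.
  have := ts; rewrite le_eqVlt => /predU1P[<-|ts'].
    by apply: Ht; rewrite at_ lexx.
  have /He : ball s e t by rewrite /ball/= ger0_norm; lra.
  have Hat : H a <= H t by apply: Ht; rewrite at_ lexx.
  move=> h; apply: (le_trans Hat); rewrite -subr_le0.
  by rewrite -(@nmulr_rge0 _ (t - s))// subr_lt0.
have Hup y : s <= y -> y < s + e -> H a <= H y.
  rewrite le_eqVlt => /predU1P[<-//|sy] ye.
  have /He : ball s e y by rewrite /ball/= ltr0_norm; lra.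
  rewrite pmulr_rge0 ?subr_gt0// subr_ge0; exact: le_trans.
have Hall y : a <= y -> y < s + e -> H a <= H y.
  move=> ay ye; have [sy|ys] := leP s y; first exact: Hup.
  have [yt|ty] := leP y t; first by apply: Ht; rewrite ay.
  have d0 : 0 < s - y by lra.
  have [t' St' yt'] := sup_adherent d0 supS.
  by case: St' => _; apply; rewrite ay/=; move: yt'; rewrite -/s; lra.
have [se|bs|sbE] := ltgtP s b; [|by move: sb; rewrite leNgt bs|by rewrite -sbE].
pose m := Num.min b (s + e / 2).
have Sm : S m.
  split; first by rewrite /m; case: (leP b (s + e / 2)); lra.
  move=> y /andP[ay ym]; apply: Hall => //.
  by move: ym; rewrite /m; case: (leP b (s + e / 2)); lra.
have ms : m <= s by exact: ub_le_sup.
exfalso; move: ms; rewrite /m; case: (leP b (s + e / 2)); lra.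
Qed.

(* For every [e > 0] the difference of [G \o F] and of the primitive of
   [(g \o F) * f] has, near every point, oscillation at most [e] times that of
   the primitive of [|f|]; hence it is constant. *)
Lemma ac_on_chain F f (G g : R -> R) : ac_on F f -> continuous g ->
  (forall z : R, is_derive z 1 G (g z)) ->
  ac_on (fun x => G (F x)) (fun x => g (F x) * f x).
Proof.
move=> aF cg dG; have cF := ac_on_continuous aF.
have [lf FE] := aF.
have cgF : continuous (fun x => g (F x)).
  exact: cont_comp.
have lgf : locally_integrable [set: R] (fun x => g (F x) * f x) by exact: locintM.
have lnf := locint_norm lf.
split=> // a b ab.
have [Phi [_ PhiE]] := ac_on_exists lgf.
have [M [_ ME]] := ac_on_exists lnf.
rewrite -PhiE//; apply/eqP; rewrite -subr_eq0; apply/eqP.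
have key (e : R) : 0 < e -> forall x, \forall y \near x,
    `|(G (F y) - Phi y) - (G (F x) - Phi x)| <= e * `|M y - M x|.
  move=> e0 x.
  have e20 : 0 < e / 2 by rewrite divr_gt0.
  have /cvgrPdist_le/(_ _ e20)[d /= d0 Hd] := cg (F x).
  have /cvgrPdist_lt/(_ _ d0)[r /= r0 Hr] := cF x.
  have main (u v : R) : u <= v -> `|x - u| < r -> `|x - v| < r -> (u <= x <= v) ->
     `|(G (F v) - Phi v) - (G (F u) - Phi u)| <= e * (M v - M u).
    move=> uv xu xv uxv.
    have inside (t : R) : u <= t <= v -> `|g (F x) - g (F t)| <= e / 2.
      move=> utv; apply: Hd; apply: Hr => /=.
      by move: xu xv; rewrite !ltr_norml => *; apply/andP; split; lra.
    have Fdiff : `|F v - F u| <= M v - M u.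
      by rewrite FE// ME//; exact: Rintegral_norm_bound.
    have MVTb : `|G (F v) - G (F u) - g (F x) * (F v - F u)| <= e / 2 * `|F v - F u|.
      have seg (z w : R) : z <= w -> d > `|F x - z| -> d > `|F x - w| ->
          `|G w - G z - g (F x) * (w - z)| <= e / 2 * `|w - z|.
        move=> zw dz dw.
        have [c cin ->] := @MVT_segment _ G g z w zw (fun y _ => dG y)
           (continuous_subspaceT (is_derive1_continuousT dG)).
        rewrite -mulrBl normrM ler_wpM2r// distrC; apply: Hd => /=.
        move: cin dz dw; rewrite in_itv/= => /andP[? ?]; rewrite !ltr_norml => /andP[? ?] /andP[? ?].
        by apply/andP; split; lra.
      have du : `|F x - F u| < d by exact: Hr.
      have dv : `|F x - F v| < d by exact: Hr.
      have [le|/ltW le] := leP (F u) (F v); first exact: seg.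
      have -> : G (F v) - G (F u) - g (F x) * (F v - F u) =
        - (G (F u) - G (F v) - g (F x) * (F u - F v)) by ring.
      by rewrite normrN [X in _ <= _ * X]distrC; exact: seg.
    have Idiff : `|(Phi v - Phi u) - g (F x) * (F v - F u)| <= e / 2 * (M v - M u).
      rewrite PhiE// FE// ME//.
      rewrite -[X in _ - X]RintegralZl//; last exact: locint_itv.
      rewrite -RintegralB//; [|exact: locint_itv|exact/locint_itv/locintZ].
      rewrite -[leRHS]RintegralZl//; last exact: locint_itv.
      have lB : locally_integrable [set: R] (fun t => g (F t) * f t - g (F x) * f t).
        by apply: locally_integrableB => //; exact: locintZ.
      apply: (le_trans (Rintegral_norm_bound u v lB)).
      apply: le_Rintegral => //; [exact/locint_itv/locint_norm|exact/locint_itv/locintZ|].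
      move=> t /=; rewrite in_itv/= => /inside; rewrite distrC => h.
      by rewrite -mulrBl normrM ler_wpM2r.
    have -> : G (F v) - Phi v - (G (F u) - Phi u) =
       (G (F v) - G (F u) - g (F x) * (F v - F u)) -
       ((Phi v - Phi u) - g (F x) * (F v - F u)) by ring.
    apply: (le_trans (ler_normB _ _)).
    have -> : e * (M v - M u) = e / 2 * (M v - M u) + e / 2 * (M v - M u) by field.
    apply: lerD Idiff; apply: (le_trans MVTb).
    by rewrite ler_wpM2l// ltW.
  exists r => //= y xy.
  have Mpos (u v : R) : u <= v -> 0 <= M v - M u.
    by move=> uv; rewrite ME//; exact: Rintegral_ge0.
  have [le|/ltW le] := leP x y.
    rewrite [X in _ * X]ger0_norm ?Mpos//; apply: main => //; first by rewrite subrr normr0.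
    by rewrite lexx.
  rewrite distrC [X in _ * X]distrC [X in _ * X]ger0_norm ?Mpos//; apply: main => //.
    by rewrite subrr normr0.
  by rewrite le/=.
have bound (e : R) : 0 < e -> `|(G (F b) - Phi b) - (G (F a) - Phi a)| <= e * (M b - M a).
  move=> e0.
  (* For [k = 1] and [k = -1] the function [e M + k (G (F) - Phi)] is locally nondecreasing;
     monotonicity of both gives the two-sided bound. *)
  have mono (k : R) : `|k| = 1 -> forall x, \forall y \near x,
     0 <= (y - x) * ((e * M y + k * (G (F y) - Phi y)) - (e * M x + k * (G (F x) - Phi x))).
    move=> k1 x; have := key e e0 x; apply: filterS => y.
    set D := _ - _ - (_ - _) => H.
    have -> : e * M y + k * (G (F y) - Phi y) - (e * M x + k * (G (F x) - Phi x)) =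
      e * (M y - M x) + k * D by rewrite /D; ring.
    have H' : `|k * D| <= e * `|M y - M x| by rewrite normrM k1 mul1r.
    have [le|/ltW le] := leP x y.
      have Mp : 0 <= M y - M x by rewrite ME//; exact: Rintegral_ge0.
      rewrite mulr_ge0 ?subr_ge0//; move: H'; rewrite (ger0_norm Mp) ler_norml => /andP[]; lra.
    have Mp : M y - M x <= 0 by rewrite -oppr_ge0 opprB ME//; exact: Rintegral_ge0.
    rewrite mulr_le0 ?subr_le0//; move: H'; rewrite (ler0_norm Mp) ler_norml => /andP[]; lra.
  have m1 := locally_monotone_le (mono 1 (normr1 _)) ab.
  have m2 := locally_monotone_le (mono (-1) (normrN1 _)) ab.
  rewrite ler_norml; apply/andP; split; lra.
have Mab : 0 <= M b - M a by rewrite ME//; exact: Rintegral_ge0.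
have -> : G (F b) - G (F a) - (Phi b - Phi a) = (G (F b) - Phi b) - (G (F a) - Phi a).
  by ring.
apply/normr0_eq0/le_anti; rewrite normr_ge0 andbT.
apply/ler_addgt0Pl => e e0; rewrite addr0.
have d0 : 0 < e / (M b - M a + 1) by rewrite divr_gt0//; lra.
apply: (le_trans (bound _ d0)).
rewrite -mulrA ler_piMr ?(ltW e0)// mulrC ler_pdivrMr; lra.
Qed.

(** Polarization: [2 F G = (F + G)^2 - F^2 - G^2], so the chain rule for the square is enough. *)
Lemma ac_onM F f G g : ac_on F f -> ac_on G g ->
  ac_on (fun x => F x * G x) (fun x => F x * g x + G x * f x).
Proof.
move=> aF aG.
have sq H h : ac_on H h -> ac_on (fun x => H x ^+ 2) (fun x => 2 * H x * h x).
  move=> aH; apply: (ac_on_chain (G := fun z => z ^+ 2) (g := fun z => 2 * z)) => //.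
    by move=> z; apply: cvgM; [exact: cvg_cst|exact: cvg_id].
  move=> z; apply: is_derive_eq (der_sqr (der_id z)) _.
  by rewrite mulr1.
have := ac_onZ (1 / 2) (ac_onD (sq _ _ (ac_onD aF aG))
  (ac_onN (ac_onD (sq _ _ aF) (sq _ _ aG)))).
congr ac_on; apply/funext => x; by field.
Qed.

End AbsolutelyContinuous.

(** * Weak derivatives *)

Section BumpFunction.
Context {R : realType}.
Implicit Types (p : {poly R}) (x y : R).

(** The functions [p(x) (1 - x^2)^(-k) exp(-1 / (1 - x^2))], extended by 0, form a family closed
    under differentiation; smoothness of the standard bump thus reduces to a recursion on
    [(p, k)]. *)
Definition bump p k x : R :=
  if -1 < x < 1 then p.[x] * (1 - x ^+ 2)^-1 ^+ k * expR (- (1 - x ^+ 2)^-1)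
  else 0.

(* Chosen so that [bump (bump_next p k) k.+2] is the derivative of [bump p k]. *)
Definition bump_next p k : {poly R} :=
  p^`() * (1 - 'X ^+ 2) ^+ 2 + (2 * k%:R)%:P * 'X * (1 - 'X ^+ 2) * p
  - 2%:P * 'X * p.

Lemma bump_nextE p k x : (bump_next p k).[x] =
  p^`().[x] * (1 - x ^+ 2) ^+ 2 + 2 * k%:R * x * (1 - x ^+ 2) * p.[x]
  - 2 * x * p.[x].
Proof. by rewrite /bump_next !hornerE; ring. Qed.

(** With [r = 1 / (1 - x^2)], the bound [r^(k+2) <= (k+2)! e^r] absorbs the pole and leaves two
    spare powers of [1 - x^2]. The square is what yields a zero derivative at the endpoints. *)
Lemma bump_le_sqr p k : exists2 C, 0 <= C &
  forall x, `|bump p k x| <= C * (1 - x ^+ 2) ^+ 2.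
Proof.
have cp : continuous (fun x : R => `|p.[x]|).
  move=> x; apply: cvg_norm.
  exact: (is_derive1_continuous (is_derive_poly p x)).
have [|c _ cmax] := @EVT_max R (fun x => `|p.[x]|) (-1) 1 _ (continuous_subspaceT cp).
  by lra.
exists (`|p.[c]| * k.+2`!%:R); first by rewrite mulr_ge0.
move=> x; rewrite /bump; case: ifPn => [/andP[x1 x2]|_]; last first.
  by rewrite normr0 mulr_ge0 ?sqr_ge0// mulr_ge0.
set r := (1 - x ^+ 2)^-1.
have d0 : 0 < 1 - x ^+ 2 by nra.
have r0 : 0 < r by rewrite invr_gt0.
rewrite !normrM normrX (gtr0_norm r0) [`|expR _|]gtr0_norm ?expR_gt0//.
rewrite -mulrA -[leRHS]mulrA ler_pM ?mulr_ge0 ?exprn_ge0 ?(ltW r0) ?expR_ge0//.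
  by apply: cmax; rewrite in_itv/=; apply/andP; split; lra.
have -> : (1 - x ^+ 2) ^+ 2 = r ^- 2 by rewrite /r exprVn invrK.
rewrite expRN ler_pdivrMr ?expR_gt0// mulrAC ler_pdivlMr ?exprn_gt0//.
rewrite -exprD addn2 mulrC -ler_pdivrMr ?ltr0n ?fact_gt0//.
by apply: le_trans (expR_ge1Dxn k.+1 (ltW r0)); rewrite lerDr.
Qed.

Lemma der_quadratic (f : R -> R) x C : (forall y, `|f y| <= C * (y - x) ^+ 2) ->
  is_derive x 1 f 0.
Proof.
move=> fC; have fx : f x = 0.
  by apply/normr0_eq0/le_anti; rewrite normr_ge0 andbT (le_trans (fC x))// subrr expr0n mulr0.
apply/is_derive1_caratheodory; exists (fun z => f z / (z - x)); split.
- move=> z; rewrite fx subr0; have [->|zx] := eqVneq z x.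
    by rewrite subrr invr0 !mulr0 fx.
  by rewrite divfK// subr_eq0.
- rewrite /prop_for /continuous_at /= subrr invr0 mulr0.
  have C1 : 0 < C + 1.
    suff : 0 <= C by lra.
    by move: (le_trans (normr_ge0 _) (fC (x + 1))); rewrite addrC addKr expr1n mulr1.
  apply/cvgr0Pnorm_le => e e0; near=> z.
  have [->|zx] := eqVneq z x; first by rewrite subrr invr0 mulr0 normr0 ltW.
  have nz : 0 < `|z - x| by rewrite normr_gt0 subr_eq0.
  rewrite normrM normfV ler_pdivrMr// (le_trans (fC z))//.
  rewrite -[(z - x) ^+ 2]ger0_norm ?sqr_ge0// normrX expr2 mulrA.
  rewrite ler_wpM2r// ?ltW//.
  have C0 : 0 <= C.
    by move: (le_trans (normr_ge0 _) (fC z)); rewrite pmulr_lge0// exprn_even_gt0//= subr_eq0.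
  have /ltW h : `|z - x| < e / (C + 1).
    by rewrite distrC; near: z; apply: cvgr_dist_lt; [exact: cvg_id|rewrite divr_gt0].
  apply: (le_lt_trans (ler_wpM2l C0 h)).
  by rewrite mulrA ltr_pdivrMr//; nra.
- by rewrite subrr invr0 mulr0.
Unshelve. all: end_near. Qed.

Lemma bump_derive p k x : is_derive x 1 (bump p k) (bump (bump_next p k) k.+2 x).
Proof.
have [xin|] := boolP (-1 < x < 1).
  have [x1 x2] := andP xin.
  have d0 : 1 - x ^+ 2 != 0 by apply: lt0r_neq0; nra.
  pose F t := p.[t] * (1 - t ^+ 2)^-1 ^+ k * expR (- (1 - t ^+ 2)^-1).
  have dr : is_derive x 1 (fun t : R => (1 - t ^+ 2)^-1) (2 * x * (1 - x ^+ 2)^-1 ^+ 2).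
    apply: der_eq (derV (f := fun t => 1 - t ^+ 2) d0
      (derB (der_cst x 1) (der_sqr (der_id x)))) _.
    by field.
  have drk : is_derive x 1 (fun t : R => (1 - t ^+ 2)^-1 ^+ k)
      (k%:R * (1 - x ^+ 2)^-1 ^+ k * (2 * x * (1 - x ^+ 2)^-1)).
    apply: der_eq (derX k dr) _.
    case: k {F} => [|k]; first by rewrite !mul0r.
    by rewrite [in RHS]exprS /=; ring.
  have dF : is_derive x 1 F (bump (bump_next p k) k.+2 x).
    apply: der_eq (derM (derM (is_derive_poly p x) drk)
      (der_comp (derN dr) (is_derive_expR _))) _.
    rewrite /bump xin bump_nextE -(addn2 k) exprD.
    move: (expR (- (1 - x ^+ 2)^-1)) ((1 - x ^+ 2)^-1 ^+ k) => A B.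
    by field.
  apply: der_near dF _.
  near=> t; rewrite /bump ifT//; apply/andP; split.
    by near: t; apply: lt_nbhsr.
  by near: t; apply: lt_nbhsl.
rewrite negb_and -!leNgt => xout.
have b0 q j : bump q j x = 0.
  by rewrite /bump ifF//; apply/negbTE; rewrite negb_and -!leNgt.
rewrite b0.
have [C C0 HC] := bump_le_sqr p k.
(* The factor 4 comes from [1 - y^2 <= 2 |y - x|] for [y] inside the interval and [x] outside. *)
apply: (@der_quadratic _ _ (C * 4)) => y.
have [/andP[y1 y2]|yout] := boolP (-1 < y < 1); last first.
  by rewrite /bump (negbTE yout) normr0 mulr_ge0 ?sqr_ge0// mulr_ge0.
apply: (le_trans (HC y)); rewrite -mulrA ler_wpM2l//.
have -> : 4 * (y - x) ^+ 2 = (2 * (y - x)) ^+ 2 by ring.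
case/orP: xout => xo; last rewrite -[leRHS]sqrrN.
  by apply: lerXn2r; rewrite ?nnegrE; nra.
by apply: lerXn2r; rewrite ?nnegrE; nra.
Unshelve. all: end_near. Qed.

Fixpoint bump_coef n : {poly R} :=
  if n is m.+1 then bump_next (bump_coef m) m.*2 else 1.

(** [D 0] is a smooth step rising from 0 to [Z], and [D n] is its [n]-th derivative. Differences of
    rescaled translates of the step are test functions whose derivatives are differences of
    mollifiers: these are what a weak derivative is tested against. *)
Lemma smooth_step_exists : exists (D : nat -> R -> R) (Z C : R),
  [/\ 0 < Z,
      (forall n x, is_derive x 1 (D n) (D n.+1 x)),
      (forall x, x <= -1 -> D 0%N x = 0) /\ (forall x, 1 <= x -> D 0%N x = Z),
      (forall x, 1 <= `|x| -> D 1%N x = 0) &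
      (forall x, 0 <= D 1%N x <= C)].
Proof.
pose B n := bump (bump_coef n) n.*2.
have dB n x : is_derive x 1 (B n) (B n.+1 x) by exact: bump_derive.
have cB n : continuous (B n) by apply: is_derive1_continuousT (dB n).
have B0out x : 1 <= `|x| -> B 0%N x = 0.
  by rewrite /B /bump => x1; rewrite ifF//; apply/negbTE; rewrite -ltr_norml -leNgt.
have B0ge x : 0 <= B 0%N x.
  by rewrite /B /bump; case: ifP => // _; rewrite /= hornerC expr0 !mul1r expR_ge0.
have B00 : 0 < B 0%N 0.
  by rewrite /B /bump ifT ?ltrN10 ?ltr01//= hornerC expr0 !mul1r expR_gt0.
have [H0 aH0] := ac_on_exists (continuous_locint (cB 0%N)).
pose H x := H0 x - H0 (-1).
have dH x : is_derive x 1 H (B 0%N x).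
  apply: der_eq (derB (ac_on_is_derive_continuous aH0 (cB 0%N x)) (der_cst x _)) _.
  by rewrite subr0.
have incH x y : x <= y -> H x <= H y.
  move=> xy; rewrite -subr_ge0 /H opprB addrA subrK (aH0.2 _ _ xy).
  exact: Rintegral_ge0.
have cstH x y : x <= y -> (forall t, x <= t <= y -> B 0%N t = 0) -> H y = H x.
  move=> xy Hz; apply/eqP; rewrite -subr_eq0 /H opprB addrA subrK (aH0.2 _ _ xy).
  apply/eqP; rewrite (@eq_Rintegral _ _ _ _ _ (cst 0)) /Rintegral ?integral0//.
  by move=> t; rewrite inE/= in_itv/= => /Hz.
have HN1 : H (-1) = 0 by rewrite /H subrr.
have HN x : x <= -1 -> H x = 0.
  move=> x1; rewrite -HN1; apply/esym/cstH => // t /andP[_ t1].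
  by apply: B0out; rewrite ler0_norm; lra.
have H1 x : 1 <= x -> H x = H 1.
  move=> x1; apply: cstH => // t /andP[t1 _].
  by apply: B0out; rewrite ger0_norm; lra.
have [|c _ cmax] := @EVT_max R (B 0%N) (-1) 1 _ (continuous_subspaceT (cB 0%N)).
  by lra.
exists (fun n => if n is m.+1 then B m else H), (H 1), (B 0%N c); split => //.
- rewrite lt_neqAle; apply/andP; split; last by rewrite -HN1; apply: incH; lra.
  (* If the total mass were 0, the monotone [H] would vanish on [[-1, 1]], against its positive
     derivative at 0. *)
  apply/eqP => Z0.
  have : is_derive (0:R) 1 (cst (0:R)) (B 0%N 0).
    apply: der_near (dH 0) _.
    near=> t.
    have t1 : -1 <= t by apply: ltW; near: t; apply: lt_nbhsr; lra.
    have t2 : t <= 1 by apply: ltW; near: t; apply: lt_nbhsl; lra.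
    by apply/le_anti; rewrite {1}Z0 -[X in X <= H t]HN1 !incH.
  case=> _; rewrite derive_cst => E; by move: B00; rewrite -E ltxx.
- by case=> [|n] x; [exact: dH|exact: dB].
- move=> x; rewrite B0ge/=; have [x1|x1] := leP 1 `|x|.
    by rewrite B0out// B0ge.
  by apply: cmax; rewrite in_itv/= -ler_norml ltW.
Unshelve. all: end_near. Qed.

End BumpFunction.

Section TestFunctions.
Context {R : realType}.
Implicit Types (f u g : R -> R) (a b x y : R).
Local Notation mu := (@lebesgue_measure R).

Lemma derive1nE_family (D : nat -> R -> R) :
  (forall n x, is_derive x 1 (D n) (D n.+1 x)) ->
  forall n, derive1n n (D 0%N) = D n.
Proof.
move=> dD; elim=> [//|n IH]; rewrite derive1nS IH; apply/funext => x.
by rewrite derive1E; case: (dD n x).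
Qed.

(** An explicit sequence of derivatives spares any computation with the iterated [derive1n]. *)
Lemma test_function_family (D : nat -> R -> R) M :
  (forall n x, is_derive x 1 (D n) (D n.+1 x)) ->
  (forall x, M <= `|x| -> D 0%N x = 0) -> test_function (D 0%N).
Proof.
move=> dD D0; split.
  by move=> n x; rewrite derive1nE_family//; case: (dD n x).
apply: (@subclosed_compact _ _ `[- M, M]); first exact: closed_closure.
  exact: segment_compact.
rewrite [X in _ `<=` X](closure_id _).1; last exact: itv_closed.
apply: closure_subset => x /=; rewrite in_itv/= -ler_norml => /eqP Dx.
by rewrite leNgt; apply/negP => /ltW/D0.
Qed.

Lemma test_function_der f x : test_function f -> is_derive x 1 f (derive1 f x).
Proof. by move=> [df _]; apply: DeriveDef; [exact: (df 0%N)|rewrite derive1E]. Qed.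

Lemma test_function_supp f : test_function f ->
  exists2 M, 0 < M & forall x, M <= `|x| -> f x = 0 /\ derive1 f x = 0.
Proof.
move=> tf; have [df cf] := tf.
have [M [Mr HM]] := compact_bounded cf.
pose M1 := `|M| + 1.
have f0 x : M1 < `|x| -> f x = 0.
  move=> Mx; apply: contrapT => /eqP fx0.
  have : `|x| <= M1.
    apply: HM; last by apply: subset_closure.
    by rewrite /M1 (le_lt_trans (ler_norm M))// ltrDl.
  by rewrite leNgt Mx.
exists (M1 + 1); first by rewrite /M1; have := normr_ge0 M; lra.
move=> x Mx; have Mx' : M1 < `|x| by lra.
split; first exact: f0.
suff : is_derive x 1 f 0 by case=> _ <-; rewrite derive1E.
apply: der_near (der_cst x 0) _.
near=> t; rewrite f0//.
by near: t; apply: (cvgr_gt `|x|) => //; apply: cvg_norm; exact: cvg_id.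
Unshelve. all: end_near. Qed.

Lemma test_function_derive f : test_function f -> test_function (derive1 f).
Proof.
move=> tf; have [df cf] := tf.
have [M M0 HM] := test_function_supp tf.
have dD n x : is_derive x 1 (derive1n n.+1 f) (derive1n n.+2 f x).
  by apply: DeriveDef; [exact: df|rewrite (derive1nS _ n.+1) derive1E].
apply: (@test_function_family (fun n => derive1n n.+1 f) M) => // x Mx.
by have [] := HM x Mx.
Qed.

Lemma test_function_continuous f : test_function f -> continuous f.
Proof. by move=> tf x; exact: is_derive1_continuous (test_function_der x tf). Qed.

End TestFunctions.

Section WeakDerivatives.
Context {R : realType}.
Implicit Types (f u g F : R -> R) (a b x y : R).
Local Notation mu := (@lebesgue_measure R).
Local Notation intble A f := (mu.-integrable A (EFin \o f)).

Definition real_weak_derivative u g := locally_integrable [set: R] u /\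
  locally_integrable [set: R] g /\
  forall f, test_function f ->
    \int[mu]_x (u x * derive1 f x) = - \int[mu]_x (g x * f x).

Lemma ae_exists (P : R -> Prop) : {ae mu, forall x, P x} -> exists x, P x.
Proof.
move=> [A [mA A0 HA]]; apply: contrapT => /forallNP nP.
have sub : (`[0, 1]%classic : set R) `<=` A by move=> x _; apply: HA; exact: nP.
have : mu (`[0, 1]%classic : set R) = 0%E.
  by apply: (subset_measure0 _ mA sub A0).
by rewrite lebesgue_measure_itv/= lte_fin ltr01 sube0 => /eqP; rewrite eqe oner_eq0.
Qed.

Lemma Rintegral_supp f A B : (forall x, x < A \/ B < x -> f x = 0) ->
  \int[mu]_x f x = \int[mu]_(x in `[A, B]) f x.
Proof.
move=> f0; rewrite [RHS]Rintegral_mkcond; apply: eq_Rintegral => x _.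
rewrite patchE; case: ifPn => //; rewrite notin_setE/= in_itv/= => /negP.
by rewrite negb_and -!ltNge => /orP xAB; exact: f0.
Qed.

Lemma integrable_supp f A B : locally_integrable [set: R] f ->
  (forall x, x < A \/ B < x -> f x = 0) -> intble setT f.
Proof.
move=> lf f0.
have : intble setT (f \_ `[A, B]).
  rewrite -restrict_EFin.
  apply: (iffLR (@integrable_mkcond _ _ _ mu _ (EFin \o f) (measurable_itv `[A, B]))).
  exact: locint_itv.
congr (_ .-integrable _ _); apply/funext => x /=; congr EFin.
rewrite patchE; case: ifPn => //; rewrite notin_setE/= in_itv/= => /negP.
by rewrite negb_and -!ltNge => /orP xAB; rewrite f0.
Qed.

(** Integration by parts: the product with the test function is absolutely continuous and vanishes
    at both ends of an interval carrying the support. *)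
Lemma ac_on_weak_derivative F f : ac_on F f -> real_weak_derivative F f.
Proof.
move=> aF; have [lf FE] := aF; split.
  by apply: continuous_locint; exact: ac_on_continuous aF.
split=> // t tt.
have [M M0 HM] := test_function_supp tt.
have ct' := test_function_continuous (test_function_derive tt).
have at_ : ac_on t (derive1 t).
  by apply: ac_on_FTC => // x; exact: test_function_der.
have [lFt FtE] := ac_onM aF at_.
have MM : - M <= M by lra.
have out x : x < - M \/ M < x -> M <= `|x|.
  by rewrite ler_normr => -[h|h]; apply/orP; [right|left]; lra.
rewrite (@Rintegral_supp _ (- M) M); last first.
  by move=> x /out/HM[_ ->]; rewrite mulr0.
rewrite [in RHS](@Rintegral_supp _ (- M) M); last first.
  by move=> x /out/HM[-> _]; rewrite mulr0.
have l1 : locally_integrable [set: R] (fun x => F x * derive1 t x).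
  by apply: locintM; [exact: ac_on_continuous aF|exact: continuous_locint].
have l2 : locally_integrable [set: R] (fun x => f x * t x).
  under eq_fun do rewrite mulrC.
  by apply: locintM => //; exact: test_function_continuous.
apply/eqP; rewrite -subr_eq0 opprK; apply/eqP.
rewrite -RintegralD//; [|exact: locint_itv..].
transitivity (F M * t M - F (- M) * t (- M)).
  by rewrite FtE//; apply: eq_Rintegral => x _; rewrite [f x * _]mulrC.
have -> : t M = 0 by apply: (HM _ _).1; rewrite ger0_norm ?(ltW M0).
have -> : t (- M) = 0 by apply: (HM _ _).1; rewrite normrN ger0_norm ?(ltW M0).
by rewrite !mulr0 subrr.
Qed.

(** The kernel is at most [C / e] on the ball of radius [e] and 0 outside, so the error is at most
    [2 C] times the mean oscillation of [u] on that ball, which tends to 0 at a Lebesgue point. *)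
Lemma mollifier_cvg u (h : R -> R) (C Z : R) x :
  locally_integrable [set: R] u -> lebesgue_pt u x ->
  continuous h -> (forall y, 1 <= `|y| -> h y = 0) ->
  (forall y, 0 <= h y <= C) ->
  (forall e : R, 0 < e -> \int[mu]_y (e^-1 * h ((y - x) / e)) = Z) ->
  (\int[mu]_y (u y * (e^-1 * h ((y - x) / e)))) @[e --> (0:R)^'+] --> u x * Z.
Proof.
move=> lu Lx ch hout hC hZ.
have C0 : 0 <= C by case/andP: (hC 0); exact: le_trans.
pose he e y := e^-1 * h ((y - x) / e).
have che e : continuous (he e) by exact: cont_rescale.
have heout (e : R) y : 0 < e -> y < x - e \/ x + e < y -> he e y = 0.
  move=> e0 yout; rewrite /he hout ?mulr0// normrM normfV (gtr0_norm e0).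
  by rewrite ler_pdivlMr// mul1r ler_normr; case: yout => yy; apply/orP; [right|left]; lra.
have lhe e : locally_integrable [set: R] (he e) by exact: continuous_locint.
have luhe e : locally_integrable [set: R] (fun y => u y * he e y).
  by under eq_fun do rewrite mulrC; exact: locintM.
have lc : locally_integrable [set: R] (fun y => u y - u x).
  by apply: locally_integrableB => //; apply: continuous_locint => y; exact: cvg_cst.
have davgE (e : R) : 0 < e ->
   davg u x e = ((2 * e)^-1 * \int[mu]_(y in ball x e) `|u y - u x|)%:E.
  move=> e0; rewrite /davg /iavg lebesgue_measure_ball ?(ltW e0)//.
  rewrite EFinM; congr (_ * _)%E.
    by rewrite inver mulr_natl mulrn_eq0/= gt_eqF.
  rewrite /Rintegral fineK//=.
  apply: integrable_fin_num => //; first exact: measurable_ball.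
  rewrite ball_itv; apply: integrableS (locint_itv (x - e) (x + e) (locint_norm lc)) => //.
  by apply: subset_itvW.
have bound (e : R) : 0 < e -> `|\int[mu]_y (u y * he e y) - u x * Z| <=
    2 * C * ((2 * e)^-1 * \int[mu]_(y in ball x e) `|u y - u x|).
  move=> e0.
  rewrite -(hZ e e0) -RintegralZl//; last first.
    exact: (integrable_supp (lhe e) (heout e ^~ e0)).
  rewrite -RintegralB//; last first.
  - apply: (@integrable_supp _ (x - e) (x + e)); first exact: (locintZ (u x) (lhe e)).
    by move=> y /(heout _ _ e0); rewrite /he => ->; rewrite mulr0.
  - apply: (@integrable_supp _ (x - e) (x + e)); first exact: luhe.
    by move=> y /(heout _ _ e0) ->; rewrite mulr0.
  rewrite (@Rintegral_supp _ (x - e) (x + e)); last first.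
    by move=> y /(heout _ _ e0); rewrite /he => ->; rewrite !mulr0 subrr.
  have lB : locally_integrable [set: R] (fun y => u y * he e y - u x * (e^-1 * h ((y - x) / e))).
    by apply: locally_integrableB; [exact: luhe|exact: (locintZ (u x) (lhe e))].
  apply: le_trans (Rintegral_norm_bound _ _ lB) _.
  apply: (@le_trans _ _ (\int[mu]_(y in `[x - e, x + e]) ((C / e) * `|u y - u x|))).
    apply: le_Rintegral => //.
    - exact/locint_itv/locint_norm.
    - exact/locint_itv/locintZ/locint_norm.
    move=> y _; rewrite -mulrBl normrM [leRHS]mulrC ler_wpM2l//.
    have /andP[h0 hC'] := hC ((y - x) / e).
    by rewrite /he ger0_norm ?mulr_ge0 ?invr_ge0 ?(ltW e0)// mulrC ler_wpM2r// invr_ge0 ltW.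
  rewrite RintegralZl//; last exact/locint_itv/locint_norm.
  rewrite ball_itv.
  have -> : \int[mu]_(y in `](x - e), (x + e)[) `|u y - u x| =
            \int[mu]_(y in `[x - e, x + e]) `|u y - u x|.
    rewrite Rintegral_itv_bndo_bndc; last first.
      apply: integrableS (locint_itv (x - e) (x + e) (locint_norm lc)) => //.
      exact: subset_itvW.
    rewrite Rintegral_itv_obnd_cbnd//.
    apply: integrableS (locint_itv (x - e) (x + e) (locint_norm lc)) => //.
    by move=> t /=; rewrite !in_itv/= => /andP[/ltW -> ->].
  rewrite le_eqVlt; apply/orP; left; apply/eqP.
  by move: (\int[mu]_(y in _) _) => I; field; rewrite gt_eqF.
have Lx' : ((2 * e)^-1 * \int[mu]_(y in ball x e) `|u y - u x|) @[e --> (0:R)^'+] --> (0:R).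
  have : fine (davg u x e) @[e --> (0:R)^'+] --> (0:R).
    by apply: fine_cvg; exact: Lx.
  apply: cvg_trans; apply: near_eq_cvg; near=> e.
  by rewrite davgE//=; near: e; exact: nbhs_right_gt.
apply/cvgrPdist_le => eps eps0.
have d0 : 0 < eps / (2 * C + 1) by rewrite divr_gt0//; lra.
move/cvgr0Pnorm_le/(_ _ d0) : Lx' => Lx2.
near=> e; rewrite distrC; apply: le_trans (bound e _) _.
  by near: e; exact: nbhs_right_gt.
have C20 : 0 <= 2 * C by lra.
apply: (@le_trans _ _ (2 * C * (eps / (2 * C + 1)))).
  rewrite ler_wpM2l//; apply: le_trans (ler_norm _) _; near: e; exact: Lx2.
by rewrite mulrA ler_pdivrMr; nra.
Unshelve. all: end_near. Qed.

(** Lemma of du Bois-Reymond. If [G] is a primitive of [g], then [U = u - G] has weak derivative 0.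
    Testing with the difference of two smooth steps shows that the mollifications of [U] at two
    points agree; in the limit [U] takes the same value at any two Lebesgue points. *)
Lemma weak_derivative_ac_on u g : real_weak_derivative u g ->
  exists2 F, ac_on F g & {ae mu, forall x, u x = F x}.
Proof.
move=> [lu [lg ug]].
have [G aG] := ac_on_exists lg.
have [lG [_ GG]] := ac_on_weak_derivative aG.
have cG := ac_on_continuous aG.
pose U x := u x - G x.
have lU : locally_integrable [set: R] U by exact: locally_integrableB.
have U0 f : test_function f -> \int[mu]_x (U x * derive1 f x) = 0.
  move=> tf; have [M M0 HM] := test_function_supp tf.
  have ct' := test_function_continuous (test_function_derive tf).
  have out x : x < - M \/ M < x -> M <= `|x|.
    by rewrite ler_normr => -[h|h]; apply/orP; [right|left]; lra.
  have sup (v : R -> R) : locally_integrable [set: R] v -> intble setT (fun x => v x * derive1 f x).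
    move=> lv; apply: (@integrable_supp _ (- M) M).
      by under eq_fun do rewrite mulrC; exact: locintM.
    by move=> x /out/HM[_ ->]; rewrite mulr0.
  transitivity (\int[mu]_x (u x * derive1 f x - G x * derive1 f x)).
    by apply: eq_Rintegral => x _; rewrite /U mulrBl.
  by rewrite RintegralB//; [rewrite ug// GG// subrr|exact: sup..].
have [D [Z [C [Z0 dD [DN D1] D1out D1b]]]] := @smooth_step_exists R.
have cD1 : continuous (D 1%N) by apply: is_derive1_continuousT (dD 1%N).
have scaled x (e : R) n y : e != 0 -> is_derive y 1 (fun t => e^-1 ^+ n * D n ((t - x) / e))
    (e^-1 ^+ n.+1 * D n.+1 ((y - x) / e)).
  move=> e0.
  have dl : is_derive y 1 (fun t : R => (t - x) / e) e^-1.
    apply: der_eq (derM (derB (der_id y) (der_cst y x)) (der_cst y e^-1)) _.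
    by rewrite mulr0 add0r subr0 mulr1.
  apply: der_eq (derZ (e^-1 ^+ n) (der_comp dl (dD n _))) _.
  by rewrite exprSr; ring.
have D0out x (e : R) y : 0 < e -> (y <= x - e -> D 0%N ((y - x) / e) = 0) /\
    (x + e <= y -> D 0%N ((y - x) / e) = Z).
  move=> e0; split=> h; [apply: DN|apply: D1].
    by rewrite ler_pdivrMr//; lra.
  by rewrite ler_pdivlMr//; lra.
have tf a b (e : R) : 0 < e -> test_function (fun y => D 0%N ((y - a) / e) - D 0%N ((y - b) / e)) /\
    forall y, derive1 (fun y => D 0%N ((y - a) / e) - D 0%N ((y - b) / e)) y =
      e^-1 * D 1%N ((y - a) / e) - e^-1 * D 1%N ((y - b) / e).
  move=> e0; have en0 : e != 0 by rewrite gt_eqF.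
  pose E n y := e^-1 ^+ n * D n ((y - a) / e) - e^-1 ^+ n * D n ((y - b) / e).
  have dE n y : is_derive y 1 (E n) (E n.+1 y) by apply: derB; exact: scaled.
  have E0 : E 0%N = (fun y => D 0%N ((y - a) / e) - D 0%N ((y - b) / e)).
    by apply/funext => y; rewrite /E expr0 !mul1r.
  rewrite -E0; split; last first.
    by move=> y; rewrite derive1E; case: (dE 0%N y) => _ ->; rewrite /E !expr1.
  apply: (@test_function_family _ E (`|a| + `|b| + e)) => // x xM; rewrite E0.
  have [x0|x0] := leP 0 x.
    rewrite (D0out a e x e0).2 ?(D0out b e x e0).2 ?subrr//.
      by move: xM; rewrite (ger0_norm x0); have := (ler_norm a, ler_norm b, normr_ge0 a, normr_ge0 b) => -[[[]]]; lra.
    by move: xM; rewrite (ger0_norm x0); have := (ler_norm a, ler_norm b, normr_ge0 a, normr_ge0 b) => -[[[]]]; lra.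
  rewrite (D0out a e x e0).1 ?(D0out b e x e0).1 ?subrr//.
    by move: xM; rewrite (ltr0_norm x0); have := (ler_norm (- a), ler_norm (- b), normr_ge0 a, normr_ge0 b) => -[[[]]]; rewrite !normrN; lra.
  by move: xM; rewrite (ltr0_norm x0); have := (ler_norm (- a), ler_norm (- b), normr_ge0 a, normr_ge0 b) => -[[[]]]; rewrite !normrN; lra.
have moll x : lebesgue_pt U x ->
   (\int[mu]_y (U y * (e^-1 * D 1%N ((y - x) / e)))) @[e --> (0:R)^'+] --> U x * Z.
  move=> Lx; apply: (mollifier_cvg lU Lx cD1 D1out D1b) => e e0.
  have en0 : e != 0 by rewrite gt_eqF.
  rewrite (@Rintegral_supp _ (x - e) (x + e)); last first.
    move=> y yout; rewrite D1out ?mulr0// normrM normfV (gtr0_norm e0).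
    by rewrite ler_pdivlMr// mul1r ler_normr; case: yout => yy; apply/orP; [right|left]; lra.
  have aD : ac_on (fun y => D 0%N ((y - x) / e)) (fun y => e^-1 * D 1%N ((y - x) / e)).
    apply: ac_on_FTC; first exact: cont_rescale.
    by move=> y; have := scaled x e 0%N y en0; under eq_fun do rewrite expr0 mul1r; rewrite expr1.
  rewrite -(aD.2 (x - e) (x + e)); last by lra.
  by rewrite (D0out x e (x - e) e0).1// (D0out x e (x + e) e0).2// subr0.
have Uconst a b : lebesgue_pt U a -> lebesgue_pt U b -> U a = U b.
  move=> La Lb.
  have E : \forall e \near (0:R)^'+, \int[mu]_y (U y * (e^-1 * D 1%N ((y - a) / e))) =
     \int[mu]_y (U y * (e^-1 * D 1%N ((y - b) / e))).
    near=> e.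
    have e0 : 0 < e by near: e; exact: nbhs_right_gt.
    have [te teE] := tf a b e e0.
    have intx x : intble setT (fun y => U y * (e^-1 * D 1%N ((y - x) / e))).
      apply: (@integrable_supp _ (x - e) (x + e)).
        under eq_fun do rewrite mulrC; apply: locintM => //.
        exact: cont_rescale.
      move=> y yout; rewrite D1out ?mulr0// normrM normfV (gtr0_norm e0).
      by rewrite ler_pdivlMr// mul1r ler_normr; case: yout => yy; apply/orP; [right|left]; lra.
    apply/eqP; rewrite -subr_eq0 -RintegralB//; apply/eqP.
    rewrite -(U0 _ te); apply: eq_Rintegral => y _.
    by rewrite teE mulrBr.
  have Ma := moll a La.
  have Mb : (\int[mu]_y (U y * (e^-1 * D 1%N ((y - b) / e)))) @[e --> (0:R)^'+] --> U a * Z.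
    by apply: cvg_trans Ma; exact: near_eq_cvg.
  apply: (@mulIf _ Z); first by rewrite gt_eqF.
  exact: (cvg_unique (@Rhausdorff R) Mb (moll b Lb)).
have [x0 Lx0] := ae_exists (lebesgue_differentiation lU).
exists (fun x => G x + U x0).
  have := ac_onD aG (ac_on_cst (U x0)).
  by congr ac_on; apply/funext => x; rewrite addr0.
apply: aeS (lebesgue_differentiation lU) => x Lx.
by rewrite (Uconst x0 x Lx0 Lx) /U addrC subrK.
Unshelve. all: end_near. Qed.

End WeakDerivatives.

(** * Integrals over the whole line and decay at infinity *)

Section GlobalIntegrals.
Context {R : realType}.
Implicit Types (f g u F G : R -> R) (a b x y : R).
Local Notation mu := (@lebesgue_measure R).
Local Notation intble A f := (mu.-integrable A (EFin \o f)).

Lemma integrable_le f g : measurable_fun [set: R] f ->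
  (forall x, `|f x| <= g x) -> intble setT g -> intble setT f.
Proof.
move=> mf fg; apply: le_integrable => //; first exact/measurable_EFinP.
by move=> x _ /=; rewrite lee_fin (le_trans (fg x))// ler_norm.
Qed.

Lemma continuous_integrable_le f g : continuous f ->
  (forall x, `|f x| <= g x) -> intble setT g -> intble setT f.
Proof. by move=> cf; apply: integrable_le; exact: continuous_measurable_fun. Qed.

Lemma integrable_funD f g : intble setT f -> intble setT g ->
  intble setT (fun x => f x + g x).
Proof. by move=> fi gi; exact: (integrableD measurableT fi gi). Qed.

Lemma integrable_funZ f (k : R) : intble setT f -> intble setT (fun x => k * f x).
Proof. by move=> fi; exact: (integrableZl measurableT k fi). Qed.

Let sym_itv_bigcup : \bigcup_n (`[(- n%:R : R), n%:R]%classic) = [set: R].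
Proof.
apply/seteqP; split=> // x _.
exists (Num.truncn `|x|).+1 => //=; rewrite in_itv/= -ler_norml.
by rewrite ltW// truncnS_gt.
Qed.

Let sym_itv_nd : nondecreasing_seq (fun n : nat => `[(- n%:R : R), n%:R]%classic).
Proof.
move=> m n mn; apply/subsetPset => x /=; rewrite !in_itv/= => /andP[x1 x2].
have : m%:R <= n%:R :> R by rewrite ler_nat.
by move=> h; apply/andP; split; lra.
Qed.

Lemma integrable_cvg_ge0 f : (forall x, 0 <= f x) -> measurable_fun [set: R] f ->
  (\int[mu]_(x in `[(- n%:R)%R : R, n%:R%R]) (f x)%:E)%E @[n --> \oo] -->
  (\int[mu]_x (f x)%:E)%E.
Proof.
move=> f0 mf; rewrite -sym_itv_bigcup.
apply: ge0_nondecreasing_set_cvg_integral => //.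
- move=> i; apply/measurable_EFinP; exact: measurable_funS mf.
- by move=> i x _; rewrite lee_fin.
Qed.

Lemma Rintegral_cvg_ge0 f : (forall x, 0 <= f x) -> intble setT f ->
  \int[mu]_(x in `[(- n%:R : R), n%:R]) f x @[n --> \oo] --> \int[mu]_x f x.
Proof.
move=> f0 fi; apply: fine_cvg; rewrite fineK; last exact: integrable_fin_num.
apply: integrable_cvg_ge0 => //.
by have /integrableP[/measurable_EFinP] := fi.
Qed.

Lemma Rintegral_cvg f : intble setT f ->
  \int[mu]_(x in `[(- n%:R : R), n%:R]) f x @[n --> \oo] --> \int[mu]_x f x.
Proof.
move=> fi.
have ni : intble setT (fun x => `|f x|) by exact: integrable_norm.
have pi : intble setT (fun x => f x + `|f x|) by exact: integrable_funD.
have sub (h : R -> R) n : intble setT h -> intble `[(- n%:R : R), n%:R] h.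
  by move=> hi; apply: integrableS hi.
have -> : (fun n => \int[mu]_(x in `[(- n%:R : R), n%:R]) f x) =
   (fun n => \int[mu]_(x in `[(- n%:R : R), n%:R]) (f x + `|f x|) -
             \int[mu]_(x in `[(- n%:R : R), n%:R]) `|f x|).
  apply/funext => n; rewrite -RintegralB//; [|exact: sub..].
  by apply: eq_Rintegral => x _; rewrite addrK.
have -> : \int[mu]_x f x = \int[mu]_x (f x + `|f x|) - \int[mu]_x `|f x|.
  by rewrite -RintegralB//; apply: eq_Rintegral => x _; rewrite addrK.
apply: cvgB; apply: Rintegral_cvg_ge0 => // x.
by have := ler_norm (- f x); rewrite normrN; lra.
Qed.

Lemma ac_on_Rintegral F f (l r : R) : ac_on F f -> intble setT f ->
  (forall e : R, 0 < e -> exists M, forall x, M <= x -> `|F x - r| <= e) ->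
  (forall e : R, 0 < e -> exists M, forall x, x <= M -> `|F x - l| <= e) ->
  \int[mu]_x f x = r - l.
Proof.
move=> [lf FE] fi Fr Fl.
have near_nat (M : R) : \forall n \near \oo, M <= (n%:R : R).
  exists (Num.truncn `|M|).+1 => // n /= Mn.
  rewrite (le_trans (ler_norm M))// (le_trans (ltW (truncnS_gt _)))//.
  by rewrite ler_nat.
have c1 : F n%:R - F (- n%:R) @[n --> \oo] --> r - l.
  apply: cvgB; apply/cvgrPdist_le => e e0.
    have [M HM] := Fr e e0.
    near=> n; rewrite distrC; apply: HM; near: n; exact: near_nat.
  have [M HM] := Fl e e0.
  near=> n; rewrite distrC; apply: HM.
  suff : - M <= n%:R by lra.
  by near: n; exact: near_nat.
apply: (cvg_unique (@Rhausdorff R) (Rintegral_cvg fi)).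
suff -> : (fun n => \int[mu]_(x in `[(- n%:R : R), n%:R]) f x) =
  (fun n => F n%:R - F (- n%:R)) by exact: c1.
apply/funext => n; rewrite FE//.
by have : 0 <= n%:R :> R by []; lra.
Unshelve. all: end_near. Qed.

(** Monotone convergence over the intervals [[-n, n]], whose integrals are at most [2 C]. This gives
    integrability without any decay estimate. *)
Lemma integrable_bounded_primitive F f (C : R) : ac_on F f -> (forall x, 0 <= f x) ->
  (forall x, `|F x| <= C) -> intble setT f.
Proof.
move=> [lf FE] f0 FC.
have mf : measurable_fun [set: R] f by case: lf.
apply/integrableP; split; first exact/measurable_EFinP.
under eq_integral do rewrite /= ger0_norm//.
have H := integrable_cvg_ge0 f0 mf.
apply: (@le_lt_trans _ _ (2 * C)%:E); last by rewrite ltry.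
rewrite -(cvg_lim _ H)//; apply: lime_le; first by apply/cvg_ex; exists (\int[mu]_x (f x)%:E)%E.
apply: nearW => n.
have n0 : 0 <= n%:R :> R by [].
have nn : - n%:R <= n%:R :> R by lra.
have fin : (\int[mu]_(x in `[(- n%:R)%R : R, n%:R%R]) (f x)%:E)%E \is a fin_num.
  by apply: integrable_fin_num => //; exact: locint_itv.
rewrite -(fineK fin) lee_fin -[leLHS]/(\int[mu]_(x in `[(- n%:R : R), n%:R]) f x) -FE//.
rewrite (le_trans (ler_norm _))// (le_trans (ler_normB _ _))//.
by rewrite [2 * C]mulr_natl mulr2n lerD.
Qed.

Lemma ac_on_glue F f G g c : ac_on F f -> ac_on G g -> F c = G c ->
  ac_on (fun x => if x < c then F x else G x) (fun x => if x < c then f x else g x).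
Proof.
move=> aF aG Fc; have [lf FE] := aF; have [lg GE] := aG.
pose k x := if x < c then f x else g x.
have kE : k = (fun x => f x * \1_(`]-oo, c[) x + g x * \1_(`[c, +oo[) x).
  apply/funext => x; rewrite /k !indicE !mem_setE !in_itv/= andbT.
  by case: ltP => _; rewrite !(mulr0, mulr1, addr0, add0r).
have lk : locally_integrable [set: R] k.
  split; [|exact: openT|].
    have [mf _ _] := lf; have [mg _ _] := lg.
    by rewrite kE; apply: measurable_funD; apply: measurable_funM.
  move=> K KT cK; have mK : measurable K by exact: compact_measurable.
  have [ms _ /(_ K KT cK)] := locally_integrableD (locint_norm lf) (locint_norm lg).
  apply: le_lt_trans; apply: ge0_le_integral => //.
  - apply/measurable_EFinP; apply: measurableT_comp => //.
    have : measurable_fun [set: R] k.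
      by case: lf lg => [mf _ _] [mg _ _]; rewrite kE; apply: measurable_funD; apply: measurable_funM.
    exact: measurable_funS.
  - by apply/measurable_EFinP; apply: measurableT_comp => //; exact: measurable_funS ms.
  - move=> x _ /=; rewrite lee_fin [leRHS]ger0_norm ?addr_ge0// /k.
    by case: ifP => _; [rewrite lerDl|rewrite lerDr].
split=> // a b ab.
have left (u v : R) : u <= v -> v <= c -> \int[mu]_(t in `[u, v]) k t = F v - F u.
  move=> uv vc; rewrite FE//.
  rewrite -!Rintegral_itv_bndo_bndc.
  - apply: eq_Rintegral => x; rewrite inE/= in_itv/= => /andP[_ xv].
    by rewrite /k (lt_le_trans xv vc).
  - by apply: integrableS (locint_itv u v lf) => //; apply: subset_itvl; rewrite bnd_simp.
  - by apply: integrableS (locint_itv u v lk) => //; apply: subset_itvl; rewrite bnd_simp.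
have right (u v : R) : u <= v -> c <= u -> \int[mu]_(t in `[u, v]) k t = G v - G u.
  move=> uv cu; rewrite GE//; apply: eq_Rintegral => x.
  by rewrite inE/= in_itv/= => /andP[ux _]; rewrite /k ltNge (le_trans cu ux).
have [ac|ca] := ltP a c; have [bc|cb] := ltP b c.
- by rewrite left// ltW.
- by rewrite -/k (Rintegral_split lk (ltW ac) cb) left// ?right// ?(ltW ac)// Fc; ring.
- by move: (le_lt_trans ca (le_lt_trans ab bc)); rewrite ltxx.
- by rewrite right.
Qed.

Lemma integrable_tail f (e : R) : intble setT f -> 0 < e ->
  exists2 M, 0 <= M & forall x y, x <= y -> M <= x \/ y <= - M ->
    \int[mu]_(t in `[x, y]) `|f t| <= e.
Proof.
move=> fi e0.
have ni : intble setT (fun x => `|f x|) by exact: integrable_norm.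
have lni := integrable_locint ni.
have := @Rintegral_cvg_ge0 (fun x => `|f x|) (fun x => normr_ge0 (f x)) ni.
move/cvgrPdist_le => /(_ _ e0)[N _ HN].
set I := \int[mu]_x `|f x| in HN *.
exists N%:R => // x y xy side.
have total (i : interval R) : [set` i] `<=` ~` `[- N%:R, N%:R] ->
    \int[mu]_(t in [set` i]) `|f t| <= I - \int[mu]_(t in `[- N%:R, N%:R]) `|f t|.
  move=> AN.
  have iU : intble ([set` i] `|` `[- N%:R, N%:R]) (fun t => `|f t|).
    by apply: integrableS ni => //; exact: measurableU.
  rewrite lerBrDr -Rintegral_setU//.
  - rewrite /I /Rintegral fine_le//.
    + by apply: integrable_fin_num => //; exact: measurableU.
    + exact: integrable_fin_num.
    + by apply: ge0_subset_integral => //; [exact: measurableU|have /integrableP[] := ni].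
  - by rewrite disj_set2E; apply/eqP/seteqP; split=> t [] // /AN.
have bnd : I - \int[mu]_(t in `[- N%:R, N%:R]) `|f t| <= e.
  by apply: le_trans (ler_norm _) _; exact: (HN N (leqnn N)).
case: side => h.
  rewrite -Rintegral_itv_obnd_cbnd; last first.
    by apply: integrableS (locint_itv x y lni) => //; apply: subset_itvr; rewrite bnd_simp.
  apply: le_trans (total _ _) bnd => t /=.
  by rewrite !in_itv/= => /andP[xt _] /andP[_]; rewrite leNgt (le_lt_trans h xt).
rewrite -Rintegral_itv_bndo_bndc; last first.
  by apply: integrableS (locint_itv x y lni) => //; apply: subset_itvl; rewrite bnd_simp.
apply: le_trans (total _ _) bnd => t /=.
by rewrite !in_itv/= => /andP[_ ty] /andP[]; rewrite leNgt (lt_le_trans ty h).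
Qed.

(** Far out, a unit interval carries an integral of at most [e / 2], so [f] cannot exceed [e] on all
    of it. *)
Lemma integrable_small f (M e : R) : (forall x, 0 <= f x) -> intble setT f -> 0 < e ->
  (exists2 x, M <= x & f x <= e) /\ (exists2 x, x <= M & f x <= e).
Proof.
move=> f0 fi e0.
have e20 : 0 < e / 2 by rewrite divr_gt0.
have [M' M'0 HM] := integrable_tail fi e20.
have small x : (forall t, x <= t <= x + 1 -> e < f t) ->
    e <= \int[mu]_(t in `[x, x + 1]) `|f t|.
  move=> h.
  have -> : e = \int[mu]_(t in `[x, x + 1]) e.
    have m1 : mu (`[x, x + 1]%classic : set R) = 1%:E.
      by rewrite lebesgue_measure_itv/= lte_fin ltrDl ltr01 -EFinD addrAC subrr add0r.
    by rewrite Rintegral_cst//; rewrite [X in fine X]m1/= mulr1.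
  apply: le_Rintegral => //.
  - by apply: locint_itv; apply: continuous_locint => z; exact: cvg_cst.
  - by apply: locint_itv; apply: locint_norm; exact: integrable_locint.
  move=> t /=; rewrite in_itv/= => /h/ltW; rewrite ger0_norm//.
split; apply: contrapT => /forall2NP nP.
  have [z mM mM'] : exists2 z, M <= z & M' <= z.
    by exists (Num.max M M'); rewrite le_max lexx ?orbT.
  have zz : z <= z + 1 by lra.
  have h1 := HM z (z + 1) zz (or_introl mM').
  have : e <= e / 2.
    apply: le_trans (small z _) h1 => t /andP[zt _].
    by have [|/negP] := nP t; [rewrite (le_trans mM zt)|rewrite -ltNge].
  by lra.
have [z mM mM'] : exists2 z, z <= M & z <= - M'.
  by exists (Num.min M (- M')); rewrite ge_min lexx ?orbT.
have zz : z - 1 <= z by lra.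
have h1 := HM (z - 1) z zz (or_intror mM').
have : e <= e / 2.
  apply: le_trans h1; rewrite -[X in `[_, X]](subrK 1 z).
  apply: small => t; rewrite subrK => /andP[_ zt].
  by have [|/negP] := nP t; [rewrite (le_trans zt mM)|rewrite -ltNge].
by lra.
Qed.

Definition vanishing f := forall e : R, 0 < e -> exists2 M, 0 <= M &
  forall x, M <= `|x| -> `|f x| <= e.

(** Integrability of [v] makes the oscillation of [V] beyond a large radius small, and arbitrarily
    far points with small [V] fix the limit to be 0. *)
Lemma ac_on_vanishing V v : ac_on V v -> intble setT v ->
  (forall M e : R, 0 < e -> (exists2 x, M <= x & `|V x| <= e) /\
     (exists2 x, x <= M & `|V x| <= e)) ->
  vanishing V.
Proof.
move=> [lv VE] vi small e e0.
have e20 : 0 < e / 2 by rewrite divr_gt0.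
have [M M0 HM] := integrable_tail vi e20.
exists M => // x; rewrite ler_normr => /orP[Mx|Mx].
  have [[y xy Vy] _] := small x _ e20.
  have -> : V x = V y - (V y - V x) by ring.
  rewrite (le_trans (ler_normB _ _))// VE// [e]splitr lerD//.
  by apply: le_trans (Rintegral_norm_bound _ _ lv) _; apply: HM => //; left.
have [_ [y xy Vy]] := small x _ e20.
have -> : V x = V y + (V x - V y) by ring.
rewrite (le_trans (ler_normD _ _))// VE// [e]splitr lerD//.
apply: le_trans (Rintegral_norm_bound _ _ lv) _; apply: HM => //; right; lra.
Qed.

End GlobalIntegrals.

(** * The potential *)

Section AbsolutePower.
Context {R : realType}.
Implicit Types (r s t x : R).

(** The absolute value extends the power to negative arguments so that [t |t|^s] is differentiable
    on the whole line, as [ac_on_chain] asks; on densities it is the ordinary power. *)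
Definition apow s t : R := `|t| `^ s.

Lemma apow_ge0 s t : 0 <= apow s t. Proof. exact: powR_ge0. Qed.

Lemma apow_eq s t : 0 <= t -> apow s t = t `^ s.
Proof. by move=> t0; rewrite /apow ger0_norm. Qed.

Lemma apow0r s : s != 0 -> apow s 0 = 0.
Proof. by move=> s0; rewrite /apow normr0 powR0. Qed.

Lemma apowD r s t : 0 <= r -> 0 <= s -> apow (r + s) t = apow r t * apow s t.
Proof.
move=> r0 s0; rewrite /apow; have [t0|t0] := eqVneq `|t| 0; last first.
  by rewrite powRD// t0 implybT.
rewrite t0; have [->|rn] := eqVneq r 0; first by rewrite add0r powRr0 mul1r.
by rewrite (powR0 rn) mul0r powR0// gt_eqF// ltr_pwDl// lt_neqAle eq_sym rn.
Qed.

Lemma apow1 t : apow 1 t = `|t|. Proof. by rewrite /apow powRr1. Qed.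

Lemma le_apow s t x : 0 <= s -> 0 <= t -> t <= x -> apow s t <= apow s x.
Proof.
move=> s0 t0 tx; rewrite !apow_eq ?(le_trans t0 tx)//.
by apply: ge0_ler_powR => //; rewrite nnegrE ?(le_trans t0 tx).
Qed.

Lemma apow_continuous s : 0 < s -> continuous (apow s).
Proof.
move=> s0 t; have [->|t0] := eqVneq t 0.
  rewrite /continuous_at apow0r ?gt_eqF//; apply/cvgr0Pnorm_le => e e0.
  have d0 : 0 < e `^ s^-1 by rewrite powR_gt0.
  near=> x.
  have hx : `|x| <= e `^ s^-1.
    near: x; exists (e `^ s^-1) => //= z.
    by rewrite /ball_/= sub0r normrN => /ltW.
  rewrite ger0_norm ?apow_ge0// /apow.
  rewrite -[e](powRr1 (ltW e0)) -(mulVf (lt0r_neq0 s0)) powRrM.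
  apply: ge0_ler_powR; rewrite ?nnegrE ?powR_ge0 ?(ltW s0)//.
have nt : 0 < `|t| by rewrite normr_gt0.
have c1 : {for `|t|, continuous (fun x : R => x `^ s)}.
  by apply: (is_derive1_continuous (is_derive1_powR s nt)).
by apply: (@continuous_comp _ _ _ (fun x : R => `|x|) (fun x : R => x `^ s)) => //; exact: norm_continuous.
Unshelve. all: end_near. Qed.

Lemma der_apow s t : 0 <= s ->
  is_derive t 1 (fun x => x * apow s x) ((s + 1) * apow s t).
Proof.
rewrite le_eqVlt => /predU1P[<-|s0].
  rewrite add0r mul1r; under eq_fun do rewrite /apow powRr0 mulr1.
  by rewrite /apow powRr0; exact: der_id.
have [t0|t0|<-] := ltgtP 0 t.
- have := is_derive1_powR (s + 1) t0; rewrite addrK => d.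
  rewrite apow_eq ?(ltW t0)//; apply: der_near d _; near=> x.
  have x0 : 0 < x by near: x; exact: lt_nbhsr.
  have s1 : 0 < s + 1 by rewrite addr_gt0.
  by rewrite apow_eq ?(ltW x0)// -(mulr_powRB1 (ltW x0) s1) addrK.
- have t0' : 0 < - t by rewrite oppr_gt0.
  have := is_derive1_powR (s + 1) t0'; rewrite addrK => d.
  have := derN (der_comp (derN (der_id t)) d); rewrite mulrN1 opprK.
  rewrite /apow ltr0_norm// => d'; apply: der_near d' _; near=> x.
  have x0 : x < 0 by near: x; exact: lt_nbhsl.
  have s1 : 0 < s + 1 by rewrite addr_gt0.
  have nx : 0 <= - x by rewrite oppr_ge0 ltW.
  by rewrite ltr0_norm// -(mulr_powRB1 nx s1) addrK mulNr opprK.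
- rewrite apow0r ?gt_eqF// mulr0; apply/is_derive1_caratheodory.
  exists (apow s); split.
  + by move=> z; rewrite mul0r !subr0 mulrC.
  + exact: apow_continuous.
  + by rewrite apow0r// gt_eqF.
Unshelve. all: end_near. Qed.

End AbsolutePower.

Section Bernoulli.
Context {R : realType}.
Implicit Types (r x t : R).

(** After division by [x^r] the claim reads [1 < (1 - r) x^(-r) + r x^(1-r)]. Applying [1 + y < e^y]
    to both exponentials, the terms linear in [ln x] cancel. *)
Lemma powR_bernoulli_lt r x : 0 < r < 1 -> 0 < x -> x != 1 ->
  x `^ r < 1 + r * (x - 1).
Proof.
move=> /andP[r0 r1] x0 x1.
have lx : ln x != 0.
  apply: contra x1 => /eqP lx0; apply/eqP; apply: ln_inj => //; rewrite ?posrE//.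
  by rewrite lx0 ln1.
rewrite -[X in X < _]mulr1 -ltr_pdivlMl ?powR_gt0//.
have xr : (x `^ r)^-1 = expR (- (r * ln x)).
  by rewrite -powRN /powR gt_eqF// mulNr.
have xx : x = expR (ln x) by rewrite lnK ?posrE.
have e1 : (x `^ r)^-1 * x = expR ((1 - r) * ln x).
  by rewrite xr {2}xx -expRD; congr expR; ring.
have -> : (x `^ r)^-1 * (1 + r * (x - 1)) =
   (1 - r) * (x `^ r)^-1 + r * ((x `^ r)^-1 * x) by ring.
rewrite e1 xr.
have h1 : 1 + - (r * ln x) < expR (- (r * ln x)).
  by apply: expR_gt1Dx; rewrite oppr_eq0 mulf_neq0// gt_eqF.
have h2 : 1 + (1 - r) * ln x < expR ((1 - r) * ln x).
  by apply: expR_gt1Dx; rewrite mulf_neq0// subr_eq0 gt_eqF.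
have h1' : (1 - r) * (1 + - (r * ln x)) < (1 - r) * expR (- (r * ln x)).
  by rewrite ltr_pM2l ?subr_gt0.
have h2' : r * (1 + (1 - r) * ln x) < r * expR ((1 - r) * ln x).
  by rewrite ltr_pM2l.
by apply: le_lt_trans (ltrD h1' h2'); rewrite le_eqVlt; apply/orP; left; apply/eqP; ring.
Qed.

Lemma powR_bernoulli_le r x : 0 < r <= 1 -> 0 < x -> x `^ r <= 1 + r * (x - 1).
Proof.
move=> /andP[r0]; rewrite le_eqVlt => /predU1P[->|r1] x0.
  by rewrite powRr1 ?(ltW x0)//; lra.
have [->|x1] := eqVneq x 1; first by rewrite powR1; lra.
by apply/ltW/powR_bernoulli_lt; rewrite ?r0.
Qed.

Lemma powR_bernoulli_ge r x : 1 <= r -> 0 < x -> 1 + r * (x - 1) <= x `^ r.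
Proof.
move=> r1 x0; have r0 : 0 < r by lra.
have h : 0 < r^-1 <= 1 by rewrite invr_gt0 r0 invf_le1.
have := powR_bernoulli_le h (powR_gt0 r x0).
rewrite -powRrM mulfV ?gt_eqF// powRr1 ?(ltW x0)// => H.
have : r * x <= r * (1 + r^-1 * (x `^ r - 1)) by rewrite ler_pM2l.
by rewrite mulrDr mulrA mulfV ?gt_eqF//; lra.
Qed.

(* Along the scaling [t], the action is [A t^a1 + B t^a2 + C t^a3 - D t^a4]; in
   the variable [x = t^a4] it lies below its tangent at [x = 1], which is
   horizontal when the constraint holds. *)
Lemma scaling_max (s c alpha beta A B C D t : R) :
  1 <= s -> 0 < 2 * alpha - beta -> 0 < 2 * alpha + beta -> beta * c <= 0 ->
  0 < A -> 0 <= B -> 0 <= C ->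
  (2 * alpha - beta) * A + (2 * alpha + beta) * B +
    ((2 * s + 2) * alpha + beta) * (c * C) - (2 * s + 2) * alpha * D = 0 ->
  0 < t ->
  A * t `^ (2 * alpha - beta) + B * t `^ (2 * alpha + beta) +
    c * C * t `^ ((2 * s + 2) * alpha + beta) - D * t `^ ((2 * s + 2) * alpha)
    <= A + B + c * C - D ?= iff (t == 1).
Proof.
move=> s1 h1 h2 bc A0 B0 C0 K0 t0.
have al : 0 < alpha by lra.
have a40 : 0 < (2 * s + 2) * alpha by rewrite mulr_gt0//; lra.
have sal : alpha <= s * alpha by rewrite ler_peMl// ltW.
have a30 : 0 < (2 * s + 2) * alpha + beta by nra.
set a4 := (2 * s + 2) * alpha in a40 a30 K0 *.
set a3 := a4 + beta in a30 K0 *.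
set a2 := 2 * alpha + beta in h2 K0 *.
set a1 := 2 * alpha - beta in h1 K0 *.
pose x := t `^ a4.
have x0 : 0 < x by exact: powR_gt0.
have pow a : t `^ a = x `^ (a / a4).
  by rewrite /x -powRrM mulrCA mulfV ?gt_eqF// mulr1.
have DE : D = (a1 / a4) * A + (a2 / a4) * B + (a3 / a4) * (c * C).
  apply: (mulfI (lt0r_neq0 a40)).
  transitivity (a1 * A + a2 * B + a3 * (c * C)); first by lra.
  by field; rewrite gt_eqF.
rewrite (pow a1) (pow a2) (pow a3) -/x.
have r1 : 0 < a1 / a4 < 1.
  by rewrite divr_gt0//= ltr_pdivrMr// mul1r; move: h1 h2; rewrite /a1 /a2 /a4; nra.
have r2 : 0 < a2 / a4 <= 1.
  by rewrite divr_gt0//= ler_pdivrMr// mul1r; move: h1 h2; rewrite /a1 /a2 /a4; nra.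
have b2 : B * (x `^ (a2 / a4)) <= B * (1 + a2 / a4 * (x - 1)).
  by rewrite ler_wpM2l//; exact: powR_bernoulli_le.
(* If [c > 0] then [beta <= 0] and the exponent [a3 / a4] is at most 1; if [c < 0] then [beta >= 0],
   the exponent is at least 1, and the reversed Bernoulli bound is multiplied by a negative
   coefficient. Both signs give an upper bound. *)
have b3 : c * C * x `^ (a3 / a4) <= c * C * (1 + a3 / a4 * (x - 1)).
  have [c0|c0|<-] := ltgtP 0 c; last by rewrite !mul0r.
    have be0 : beta <= 0 by rewrite -(pmulr_lle0 _ c0).
    rewrite ler_wpM2l ?mulr_ge0 ?(ltW c0)//; apply: powR_bernoulli_le => //.
    by rewrite divr_gt0//= ler_pdivrMr// mul1r /a3; lra.
  have be0 : 0 <= beta by rewrite -(nmulr_lle0 _ c0).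
  rewrite ler_wnM2l ?mulr_le0_ge0 ?(ltW c0)//; apply: powR_bernoulli_ge => //.
  by rewrite ler_pdivlMr// mul1r /a3; lra.
have tx : (t == 1) = (x == 1).
  apply/eqP/eqP => [t1|]; first by rewrite /x t1 powR1.
  rewrite /x /powR gt_eqF// => /(congr1 (@ln R)); rewrite expRK ln1 => /eqP.
  by rewrite mulf_eq0 gt_eqF//= => /eqP lt; apply: ln_inj; rewrite ?posrE// ln1.
rewrite tx; have [xE|x1] := eqVneq x 1; first rewrite xE.
  by split; [rewrite !powR1 !mulr1|rewrite !powR1 !mulr1 eqxx].
(* The kinetic term, with [A > 0] and exponent strictly between 0 and 1, supplies the strictness
   behind the equality case. *)
have b1 : A * (x `^ (a1 / a4)) < A * (1 + a1 / a4 * (x - 1)).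
  by rewrite ltr_pM2l//; exact: powR_bernoulli_lt.
have lt : A * x `^ (a1 / a4) + B * x `^ (a2 / a4) + c * C * x `^ (a3 / a4) - D * x
    < A + B + c * C - D.
  rewrite {1 2}DE.
  set X1 := A * x `^ _ in b1 *; set X2 := B * x `^ _ in b2 *; set X3 := c * C * x `^ _ in b3 *.
  move: X1 X2 X3 b1 b2 b3 => X1 X2 X3.
  move: (a1 / a4) (a2 / a4) (a3 / a4) => r_1 r_2 r_3; nra.
by split; [exact: ltW|rewrite lt_eqF].
Qed.

End Bernoulli.

Section Potential.
Context {R : realType}.
Variables (s kappa c : R).
Hypotheses (s1 : 1 <= s) (k0 : 0 <= kappa)
  (hkc : 0 < kappa \/ (kappa = 0 /\ 0 < c)).
Implicit Types (q x : R).

(* With [q = |psi|^2], a wave [psi = e^(-i c x / 2) phi] solves the first-order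
   equation [psi' = (h - i gfun q) psi] with [h^2 = wfun q]; [gtop] is the
   positive root of [kappa + c g - g^2] and [qtop] the maximum of [q]. *)
Definition gfun q : R := apow s q / (2 * s + 2).
Definition wfun q : R := kappa + c * gfun q - gfun q ^+ 2.
Definition swfun q : R := Num.sqrt (wfun q).
Definition gtop : R := (c + Num.sqrt (c ^+ 2 + 4 * kappa)) / 2.
Definition qtop : R := ((2 * s + 2) * gtop) `^ s^-1.

Let s0 : 0 < s. Proof. exact: lt_le_trans ltr01 s1. Qed.
Let s2 : 0 < 2 * s + 2. Proof. by rewrite addr_gt0 ?mulr_gt0. Qed.

Lemma gfun_ge0 q : 0 <= gfun q.
Proof. by rewrite divr_ge0 ?apow_ge0 ?ltW. Qed.

Lemma gfun_gt0 q : 0 < q -> 0 < gfun q.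
Proof. by move=> q0; rewrite divr_gt0// /apow powR_gt0// normr_gt0 gt_eqF. Qed.

Lemma le_gfun q x : 0 <= q -> q <= x -> gfun q <= gfun x.
Proof. by move=> q0 qx; rewrite ler_wpM2r ?invr_ge0 ?(ltW s2)// le_apow// ltW. Qed.

Lemma gfun_continuous : continuous gfun.
Proof. by move=> x; apply: cvgM; [exact: apow_continuous|exact: cvg_cst]. Qed.

Lemma wfun_continuous : continuous wfun.
Proof.
have cg := gfun_continuous.
apply: contB; last exact: contM.
by apply: contD; [move=> x; exact: cvg_cst|exact: contZ].
Qed.

Lemma swfun_continuous : continuous swfun.
Proof. by apply: cont_comp; [exact: wfun_continuous|exact: sqrt_continuous]. Qed.

Lemma gtop_gt0 : 0 < gtop.
Proof.
rewrite divr_gt0//; case: hkc => [k|[-> c0]]; last first.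
  by rewrite mulr0 addr0 sqrtr_sqr gtr0_norm//; lra.
have : `|c| < Num.sqrt (c ^+ 2 + 4 * kappa).
  by rewrite -sqrtr_sqr ltr_sqrt; [lra|have := sqr_ge0 c; lra].
by have := ler_norm (- c); rewrite normrN; lra.
Qed.

Lemma gtop_sqr : gtop ^+ 2 = c * gtop + kappa.
Proof.
have h : Num.sqrt (c ^+ 2 + 4 * kappa) ^+ 2 = c ^+ 2 + 4 * kappa.
  by rewrite sqr_sqrtr// addr_ge0 ?sqr_ge0// mulr_ge0.
by rewrite /gtop; move: (Num.sqrt _) h => S h; nra.
Qed.

(** The roots of [kappa + c g - g^2] have product [- kappa], so the other root is [- kappa / gtop],
    which is not positive. *)
Lemma wfunE q : wfun q = (gtop - gfun q) * (gfun q + kappa / gtop).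
Proof.
have h := gtop_sqr; have h0 := gtop_gt0; rewrite /wfun.
have kE : kappa = gtop ^+ 2 - c * gtop by lra.
by rewrite [X in kappa / X]lock kE -lock; field; rewrite gt_eqF.
Qed.

Lemma qtop_gt0 : 0 < qtop.
Proof. by rewrite powR_gt0// mulr_gt0// gtop_gt0. Qed.

Lemma gfun_qtop : gfun qtop = gtop.
Proof.
rewrite /gfun apow_eq ?(ltW qtop_gt0)// /qtop -powRrM mulVf ?gt_eqF// powRr1.
  by rewrite mulrC mulKf// gt_eqF.
by rewrite mulr_ge0 ?(ltW s2)// ltW// gtop_gt0.
Qed.

Lemma wfun_qtop : wfun qtop = 0.
Proof. by rewrite wfunE gfun_qtop subrr mul0r. Qed.

Lemma swfun_qtop : swfun qtop = 0.
Proof. by rewrite /swfun wfun_qtop sqrtr0. Qed.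

Lemma wfun_ge0 q : 0 <= q -> q <= qtop -> 0 <= wfun q.
Proof.
move=> q0 qt; rewrite wfunE mulr_ge0//.
  by rewrite subr_ge0 -gfun_qtop le_gfun.
by rewrite addr_ge0 ?gfun_ge0// divr_ge0// ltW// gtop_gt0.
Qed.

Lemma lt_gfun q x : 0 <= q -> q < x -> gfun q < gfun x.
Proof.
move=> q0 qx; rewrite ltr_pM2r ?invr_gt0// !apow_eq ?(ltW (le_lt_trans q0 qx))//.
by apply: gt0_ltr_powR; rewrite ?nnegrE// ltW// (le_lt_trans q0 qx).
Qed.

Lemma wfun_gt0 q : 0 < q -> q < qtop -> 0 < wfun q.
Proof.
move=> q0 qt; rewrite wfunE mulr_gt0//.
  by rewrite subr_gt0 -gfun_qtop lt_gfun// ltW.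
by rewrite ltr_pwDl ?gfun_gt0// divr_ge0// ltW// gtop_gt0.
Qed.

Lemma sqr_swfun q : 0 <= q -> q <= qtop -> swfun q ^+ 2 = wfun q.
Proof. by move=> q0 qt; rewrite sqr_sqrtr// wfun_ge0. Qed.

Lemma qtop_wfun q : 0 < q -> wfun q = 0 -> q = qtop.
Proof.
move=> q0 /eqP; rewrite wfunE mulf_eq0 => /orP[|]; last first.
  have := gfun_gt0 q0; have : 0 <= kappa / gtop by rewrite divr_ge0// ltW// gtop_gt0.
  by move=> ? ? /eqP; lra.
rewrite subr_eq0 -gfun_qtop => /eqP E; apply/eqP.
have [h|h|//] := ltgtP q qtop.
  by have := lt_gfun (ltW q0) h; rewrite E ltxx.
by have := lt_gfun (ltW qtop_gt0) h; rewrite E ltxx.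
Qed.

End Potential.

(** * Energy space and Bogomolny identity *)

Section EnergySpace.
Context {R : realType}.
Implicit Types (a b x y : R).
Local Notation mu := (@lebesgue_measure R).
Local Notation intble A f := (mu.-integrable A (EFin \o f)).

(* The space [X_{omega,c}] for [psi = u + i v] and [kappa = omega - c^2/4]: the
   exponent of [|psi|^2] is [1] for [H^1] and [s + 1] for the space
   [L^(2s+2)] of the borderline case. *)
Definition energy_space (s kappa : R) (u v u1 v1 : R -> R) :=
  [/\ ac_on u u1, ac_on v v1, intble setT (fun x => u1 x ^+ 2 + v1 x ^+ 2) &
    intble setT (fun x => apow (if 0 < kappa then 1 else s + 1)
                               (u x ^+ 2 + v x ^+ 2))].

Lemma integrable_lin4 (k1 k2 k3 k4 : R) (f1 f2 f3 f4 : R -> R) :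
  intble setT f1 -> intble setT f2 -> intble setT f3 -> intble setT f4 ->
  intble setT (fun x => k1 * f1 x + k2 * f2 x + k3 * f3 x + k4 * f4 x).
Proof.
move=> i1 i2 i3 i4; apply: integrable_funD; last exact: integrable_funZ.
apply: integrable_funD; last exact: integrable_funZ.
by apply: integrable_funD; exact: integrable_funZ.
Qed.

Lemma Rintegral_lin4 (k1 k2 k3 k4 : R) (f1 f2 f3 f4 : R -> R) :
  intble setT f1 -> intble setT f2 -> intble setT f3 -> intble setT f4 ->
  \int[mu]_x (k1 * f1 x + k2 * f2 x + k3 * f3 x + k4 * f4 x) =
  k1 * (\int[mu]_x f1 x) + k2 * (\int[mu]_x f2 x) + k3 * (\int[mu]_x f3 x) +
  k4 * (\int[mu]_x f4 x).
Proof.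
move=> i1 i2 i3 i4; rewrite RintegralD//; last 2 first.
- apply: integrable_funD; last exact: integrable_funZ.
  by apply: integrable_funD; exact: integrable_funZ.
- exact: integrable_funZ.
rewrite RintegralD//; last 2 first.
- by apply: integrable_funD; exact: integrable_funZ.
- exact: integrable_funZ.
by rewrite RintegralD//; [rewrite !RintegralZl|exact: integrable_funZ..].
Qed.

Lemma continuous_primitive (f : R -> R) : continuous f ->
  exists F : R -> R, forall x, is_derive x 1 F (f x).
Proof.
move=> cf; have [F aF] := ac_on_exists (continuous_locint cf).
by exists F => x; exact: ac_on_is_derive_continuous aF (cf x).
Qed.

Lemma ac_on_sqr_modulus (u v u1 v1 : R -> R) : ac_on u u1 -> ac_on v v1 ->
  ac_on (fun x => u x ^+ 2 + v x ^+ 2) (fun x => 2 * (u x * u1 x + v x * v1 x)).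
Proof.
move=> au av; have := ac_onD (ac_onM au au) (ac_onM av av).
by congr ac_on; apply/funext => x; ring.
Qed.

Lemma vanishing_max (f : R -> R) : continuous f -> (forall x, 0 <= f x) ->
  vanishing f -> exists x0, forall x, f x <= f x0.
Proof.
move=> cf f0 vf; have [[x1 fx1]|/forallNP nf] := pselect (exists x, f x != 0); last first.
  by exists 0 => x; have /negP/negPn/eqP -> := nf x.
have p1 : 0 < f x1 by rewrite lt_neqAle eq_sym fx1 f0.
have p2 : 0 < f x1 / 2 by rewrite divr_gt0.
have [M M0 HM] := vf _ p2.
have MM : - M <= M by lra.
have [x0 _ H0] := EVT_max MM (continuous_subspaceT cf).
have x1M : `|x1| < M.
  by rewrite ltNge; apply/negP => /HM; rewrite ger0_norm//; lra.
exists x0 => x; have [xM|xM] := leP M `|x|; last first.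
  by apply: H0; rewrite in_itv/= -ler_norml ltW.
apply: (@le_trans _ _ (f x1)); last by apply: H0; rewrite in_itv/= -ler_norml ltW.
by have := HM x xM; rewrite ger0_norm//; lra.
Qed.

(** The exponent [r = (m - 1) / 2] is chosen so that [V = q^(r+1)] satisfies
    [|V'| <= (r + 1) (q^m + |psi'|^2)], by the inequality of arithmetic and geometric means. Hence
    [V'] is integrable, and integrability of [q^m] provides far points where [V] is small. *)
Lemma sqr_modulus_vanishing (m : R) (u v u1 v1 : R -> R) : 1 <= m ->
  ac_on u u1 -> ac_on v v1 -> intble setT (fun x => u1 x ^+ 2 + v1 x ^+ 2) ->
  intble setT (fun x => apow m (u x ^+ 2 + v x ^+ 2)) ->
  vanishing (fun x => u x ^+ 2 + v x ^+ 2).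
Proof.
move=> m1 au av i1 im.
pose q x := u x ^+ 2 + v x ^+ 2.
have q0 x : 0 <= q x by rewrite addr_ge0 ?sqr_ge0.
have aq : ac_on q _ := ac_on_sqr_modulus au av.
have cq := ac_on_continuous aq.
pose r := (m - 1) / 2.
have r0 : 0 <= r by rewrite divr_ge0//; lra.
pose V x := q x * apow r (q x).
have V0 x : 0 <= V x by rewrite mulr_ge0 ?apow_ge0.
have car : continuous (apow r).
  have [->|rn] := eqVneq r 0; last by apply: apow_continuous; rewrite lt_neqAle eq_sym rn.
  by rewrite /apow; under eq_fun do rewrite powRr0; move=> x; exact: cvg_cst.
have aV : ac_on V (fun x => (r + 1) * apow r (q x) * (2 * (u x * u1 x + v x * v1 x))).
  apply: (ac_on_chain (G := fun t => t * apow r t) (g := fun t => (r + 1) * apow r t) aq).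
    exact: contZ.
  by move=> t; exact: der_apow.
have iV : intble setT (fun x => (r + 1) * apow r (q x) * (2 * (u x * u1 x + v x * v1 x))).
  apply: (@integrable_le _ _ (fun x => (r + 1) * (apow m (q x) + (u1 x ^+ 2 + v1 x ^+ 2)))).
  - by case: aV => -[].
  - move=> x; rewrite -mulrA normrM ger0_norm ?ler_wpM2l ?addr_ge0//.
    have E : apow m (q x) = apow r (q x) ^+ 2 * q x.
      have -> : m = (r + r) + 1 by rewrite /r; field.
      rewrite apowD ?addr_ge0// apowD// apow1 ger0_norm//.
    rewrite E normrM ger0_norm ?apow_ge0// normrM ger0_norm// mulrCA.
    move: (apow r (q x)) (apow_ge0 r (q x)) => w w0.
    have h1 : 2 * (w * `|u x * u1 x|) <= (w * u x) ^+ 2 + u1 x ^+ 2.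
      rewrite -[w in w * `|_|]ger0_norm// -normrM mulrA.
      have := sqr_ge0 (w * u x - u1 x); have := sqr_ge0 (w * u x + u1 x).
      by case: (ger0P (w * u x * u1 x)) => _; nra.
    have h2 : 2 * (w * `|v x * v1 x|) <= (w * v x) ^+ 2 + v1 x ^+ 2.
      rewrite -[w in w * `|_|]ger0_norm// -normrM mulrA.
      have := sqr_ge0 (w * v x - v1 x); have := sqr_ge0 (w * v x + v1 x).
      by case: (ger0P (w * v x * v1 x)) => _; nra.
    have h3 := ler_wpM2l w0 (ler_normD (u x * u1 x) (v x * v1 x)).
    rewrite mulrDr in h3.
    apply: (@le_trans _ _ (2 * (w * `|u x * u1 x|) + 2 * (w * `|v x * v1 x|))); first by lra.
    by apply: (le_trans (lerD h1 h2)); rewrite /q; nra.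
  - by apply: integrable_funZ; exact: integrable_funD.
have r10 : 0 < r + 1 by lra.
have VE x : V x = q x `^ (r + 1).
  by rewrite /V apow_eq// -(mulr_powRB1 (q0 x) r10) addrK.
have Vsmall (M e : R) : 0 < e -> (exists2 x, M <= x & `|V x| <= e) /\
     (exists2 x, x <= M & `|V x| <= e).
  move=> e0.
  have mE : m = 2 * r + 1 by rewrite /r; field.
  have d0 : 0 < e `^ (m / (r + 1)) by rewrite powR_gt0.
  have H x : apow m (q x) <= e `^ (m / (r + 1)) -> `|V x| <= e.
    move=> h; rewrite ger0_norm// VE.
    have -> : q x `^ (r + 1) = (q x `^ m) `^ ((r + 1) / m).
      by rewrite -powRrM mulrCA mulfV ?mulr1//; lra.
    have -> : e = (e `^ (m / (r + 1))) `^ ((r + 1) / m).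
      by rewrite -powRrM mulf_div [m * _]mulrC mulfV ?powRr1 ?(ltW e0)// mulf_neq0//; lra.
    apply: ge0_ler_powR; rewrite ?nnegrE ?powR_ge0 ?divr_ge0//; try lra.
    by rewrite -apow_eq.
  have [[x1 ? /H ?] [x2 ? /H ?]] := integrable_small M (fun x => apow_ge0 m (q x)) im d0.
  by split; [exists x1|exists x2].
have vV := ac_on_vanishing aV iV Vsmall.
move=> e e0; have d0 : 0 < e `^ (r + 1) by rewrite powR_gt0.
have [M M0 HM] := vV _ d0; exists M => // x /HM; rewrite ger0_norm// (ger0_norm (q0 x)) VE.
rewrite leNgt => h; rewrite leNgt; apply: contra h => h.
by apply: gt0_ltr_powR; rewrite ?nnegrE// ltW.
Qed.

End EnergySpace.

Section Bogomolny.
Context {R : realType}.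
Variables (s kappa c : R).
Hypotheses (s1 : 1 <= s) (k0 : 0 <= kappa)
  (hkc : 0 < kappa \/ (kappa = 0 /\ 0 < c)).
Local Notation mu := (@lebesgue_measure R).
Local Notation intble A f := (mu.-integrable A (EFin \o f)).
Local Notation g := (gfun s).
Local Notation w := (wfun s kappa c).
Local Notation sw := (swfun s kappa c).
Local Notation qt := (qtop s kappa c).

Variables (u v u1 v1 : R -> R).
Hypothesis hE : energy_space s kappa u v u1 v1.

Definition density x : R := u x ^+ 2 + v x ^+ 2.
Definition current x : R := u x * v1 x - v x * u1 x.
Definition kinetic x : R := u1 x ^+ 2 + v1 x ^+ 2.

Local Notation q := density.
Local Notation J := current.
Local Notation n1 := kinetic.

Let s0 : 0 < s. Proof. exact: lt_le_trans ltr01 s1. Qed.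
Let au : ac_on u u1. Proof. by case: hE. Qed.
Let av : ac_on v v1. Proof. by case: hE. Qed.
Let cu : continuous u. Proof. exact: ac_on_continuous au. Qed.
Let cv : continuous v. Proof. exact: ac_on_continuous av. Qed.
Let mu_ : measurable_fun [set: R] u. Proof. exact: continuous_measurable_fun cu. Qed.
Let mv : measurable_fun [set: R] v. Proof. exact: continuous_measurable_fun cv. Qed.
Let mu1 : measurable_fun [set: R] u1. Proof. by case: au => -[]. Qed.
Let mv1 : measurable_fun [set: R] v1. Proof. by case: av => -[]. Qed.

Lemma density_ge0 x : 0 <= q x. Proof. by rewrite addr_ge0 ?sqr_ge0. Qed.

Lemma density_ac : ac_on q (fun x => 2 * (u x * u1 x + v x * v1 x)).
Proof. exact: ac_on_sqr_modulus. Qed.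

Let cq : continuous q. Proof. exact: ac_on_continuous density_ac. Qed.

Lemma density_vanishing : vanishing q.
Proof.
case: hE => _ _ i1 im; apply: sqr_modulus_vanishing au av i1 im.
by case: ifP => // _; rewrite lerDr ltW.
Qed.

Lemma density_max : exists x0, forall x, q x <= q x0.
Proof. exact: vanishing_max cq density_ge0 density_vanishing. Qed.

Lemma kinetic_integrable : intble setT n1. Proof. by case: hE. Qed.

Lemma mass_integrable : intble setT (fun x => kappa * q x).
Proof.
have [kp|kn] := ltP 0 kappa.
  apply: integrable_funZ; case: hE => _ _ _; rewrite kp.
  by under eq_fun do rewrite apow1 ger0_norm ?density_ge0//.
have -> : kappa = 0 by apply/le_anti; rewrite kn k0.
by under eq_fun do rewrite mul0r; exact: integrable0.
Qed.

Let cgq : continuous (fun x => g (q x)).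
Proof. by apply: cont_comp cq _; exact: gfun_continuous. Qed.

Let gq_bounded : exists2 M, 0 <= M & forall x, g (q x) <= M.
Proof.
have [x0 h] := density_max; exists (g (q x0)); first exact: gfun_ge0.
by move=> x; apply: le_gfun => //; exact: density_ge0.
Qed.

Let gq_ge0 x : 0 <= g (q x) * q x.
Proof. by apply: mulr_ge0; [exact: gfun_ge0|exact: density_ge0]. Qed.

Lemma power_integrable : intble setT (fun x => g (q x) * q x).
Proof.
have [kp|kn] := ltP 0 kappa.
  have [M M0 HM] := gq_bounded.
  apply: (@continuous_integrable_le _ _ (fun x => M * q x)).
  - exact: contM.
  - move=> x; rewrite ger0_norm ?gq_ge0//.
    by rewrite ler_wpM2r ?density_ge0.
  - apply: integrable_funZ; case: hE => _ _ _; rewrite kp.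
    by under eq_fun do rewrite apow1 ger0_norm ?density_ge0//.
case: hE => _ _ _; rewrite ltNge kn /= => /(integrable_funZ (2 * s + 2)^-1).
congr (_ .-integrable _ _); apply/funext => x /=; congr EFin.
rewrite apowD ?ltW// apow1 ger0_norm ?density_ge0// /gfun.
by rewrite mulrA [_^-1 * _]mulrC.
Qed.

Lemma power2_integrable : intble setT (fun x => g (q x) ^+ 2 * q x).
Proof.
have [M M0 HM] := gq_bounded.
apply: (@continuous_integrable_le _ _ (fun x => M * (g (q x) * q x))).
- by apply: contM cq; exact: contM.
- move=> x; rewrite expr2 -mulrA ger0_norm; last first.
    by apply: mulr_ge0 (gq_ge0 x); exact: gfun_ge0.
  by rewrite ler_wpM2r// gq_ge0.
- exact/integrable_funZ/power_integrable.
Qed.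

Let mgq : measurable_fun [set: R] (fun x => g (q x)).
Proof. exact: continuous_measurable_fun. Qed.

Let mJ : measurable_fun [set: R] J.
Proof. by apply: measurable_funB; exact: measurable_funM. Qed.

Let amgm (y z : R) : 2 * `|y * z| <= y ^+ 2 + z ^+ 2.
Proof.
have := sqr_ge0 (y - z); have := sqr_ge0 (y + z).
by case: (ger0P (y * z)) => _; nra.
Qed.

Let bilinear_bound (k : R) (y z y1 z1 : R) : 0 <= k ->
  2 * `|k * (y * y1 + z * z1)| <= k ^+ 2 * (y ^+ 2 + z ^+ 2) + (y1 ^+ 2 + z1 ^+ 2).
Proof.
move=> hk; have h1 := amgm (k * y) y1; have h2 := amgm (k * z) z1.
have -> : k * (y * y1 + z * z1) = k * y * y1 + k * z * z1 by ring.
have := ler_normD (k * y * y1) (k * z * z1).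
move: `|_ + _| `|_| `|_| h1 h2 => N N1 N2; nra.
Qed.

Lemma current_integrable : intble setT (fun x => g (q x) * J x).
Proof.
apply: (@integrable_le _ _ (fun x => g (q x) ^+ 2 * q x + n1 x)).
- exact: measurable_funM.
- move=> x; have := bilinear_bound (u x) (- v x) (v1 x) (u1 x) (gfun_ge0 s1 (q x)).
  have -> : u x * v1 x + - v x * u1 x = J x by rewrite /current; ring.
  have -> : u x ^+ 2 + (- v x) ^+ 2 = q x by rewrite /density; ring.
  have -> : v1 x ^+ 2 + u1 x ^+ 2 = n1 x by rewrite /kinetic; ring.
  by have := normr_ge0 (g (q x) * J x); lra.
- by apply: integrable_funD; [exact: power2_integrable|exact: kinetic_integrable].
Qed.

Definition sgnx (xm x : R) : R := if x < xm then 1 else -1.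

(** The squared defect in the first-order equation of the scaled function [sqrt(L) psi(x / tau)],
    pulled back to the variable of [psi]. Amplitude and length thus enter as constants, and neither
    the scaled function nor a change of variables in an integral is needed. *)
Definition residual (L tau xm x : R) : R := tau / 2 * L *
  ((u1 x / tau - (sgnx xm x * sw (L * q x) * u x + g (L * q x) * v x)) ^+ 2 +
   (v1 x / tau - (sgnx xm x * sw (L * q x) * v x - g (L * q x) * u x)) ^+ 2).

Lemma gfunM (L x : R) : 0 <= L -> g (L * x) = apow s L * g x.
Proof.
move=> L0; rewrite /gfun /apow normrM powRM// ?normr_ge0//.
by rewrite mulrA.
Qed.

(* Completing the square: the energy density is a nonnegative residual plus an
   exact derivative. *)
Lemma bogomolny (Gam : R -> R) (L tau xm : R) :
  (forall t : R, is_derive t 1 Gam (sw t)) -> 0 < L -> 0 < tau ->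
  (forall x, q x <= q xm) -> L * q xm = qt ->
  intble setT (residual L tau xm) /\
  L / (2 * tau) * (\int[mu]_x n1 x) + L * tau / 2 * (\int[mu]_x (kappa * q x)) +
  c * tau * L * apow s L / 2 * (\int[mu]_x (g (q x) * q x)) +
  L * apow s L * (\int[mu]_x (g (q x) * J x)) =
  Gam qt - Gam 0 + \int[mu]_x residual L tau xm x.
Proof.
move=> dG L0 t0 qm Lm.
pose p x := u x * u1 x + v x * v1 x.
have Lq x : 0 <= L * q x by rewrite mulr_ge0 ?density_ge0// ltW.
have Lqt x : L * q x <= qt by rewrite -Lm ler_wpM2l// ltW.
pose Sd x := L / (2 * tau) * n1 x + L * tau / 2 * (kappa * q x) +
  c * tau * L * apow s L / 2 * (g (q x) * q x) +
  L * apow s L * (g (q x) * J x).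
pose f x := sgnx xm x * (sw (L * q x) * (L * (2 * p x))).
have resE x : residual L tau xm x = Sd x - 2^-1 * f x.
  have e2 : sgnx xm x ^+ 2 = 1 by rewrite /sgnx; case: ifP => _; rewrite ?sqrrN expr1n.
  have w2 : sw (L * q x) ^+ 2 = kappa + c * (apow s L * g (q x)) - (apow s L * g (q x)) ^+ 2.
    by rewrite sqr_swfun// /wfun gfunM ?ltW.
  rewrite /residual /Sd /f gfunM ?ltW//.
  set G := apow s L * g (q x) in w2 *.
  have -> : c * tau * L * apow s L / 2 * (g (q x) * q x) = c * tau * L / 2 * (G * q x).
    by rewrite /G; ring.
  have -> : L * apow s L * (g (q x) * J x) = L * (G * J x) by rewrite /G; ring.
  move: (sw _) (sgnx xm x) G e2 w2 => W E G e2 w2.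
  have kE : kappa = W ^+ 2 - c * G + G ^+ 2 by rewrite w2; ring.
  have key : E ^+ 2 * W ^+ 2 = W ^+ 2 by rewrite e2 mul1r.
  rewrite kE /p /kinetic /density /current.
  have tn : tau != 0 by rewrite gt_eqF.
  transitivity (tau / 2 * L * ((u1 x / tau) ^+ 2 + (v1 x / tau) ^+ 2
     + (E ^+ 2 * W ^+ 2 + G ^+ 2) * (u x ^+ 2 + v x ^+ 2)
     - 2 * (E * W * (u x * u1 x + v x * v1 x) / tau)
     + 2 * G * (u x * v1 x - v x * u1 x) / tau)).
    by field.
  by rewrite key; field.
have aF0 : ac_on (fun x => Gam (L * q x)) (fun x => sw (L * q x) * (L * (2 * p x))).
  apply: (ac_on_chain (ac_onZ L density_ac)) => //.
  exact: swfun_continuous.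
have aF1 : ac_on (fun x => 2 * Gam qt + - Gam (L * q x))
    (fun x => 0 + - (sw (L * q x) * (L * (2 * p x)))).
  by apply: ac_onD; [exact: ac_on_cst|exact: ac_onN].
(* Past the maximum, [Gam (L q)] is continued by its reflection in the value [Gam qt]. The glued
   function has derivative [f] on both sides and runs from [Gam 0] to [2 Gam qt - Gam 0]. *)
have Fm : Gam (L * q xm) = 2 * Gam qt + - Gam (L * q xm) by rewrite Lm; ring.
have := ac_on_glue aF0 aF1 Fm.
set F := (fun x => if x < xm then _ else _ : R).
have -> : (fun x => if x < xm then sw (L * q x) * (L * (2 * p x))
   else 0 + - (sw (L * q x) * (L * (2 * p x)))) = f.
  by apply/funext => x; rewrite /f /sgnx; case: ifP => _; ring.
move=> aF.
have cG : continuous Gam by exact: is_derive1_continuousT dG.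
have i_f : intble setT f.
  apply: (@integrable_le _ _ (fun x => L * ((kappa * q x + `|c| * apow s L * (g (q x) * q x)) + n1 x))).
  - by case: aF => -[].
  - move=> x; rewrite /f normrM.
    have -> : `|sgnx xm x| = 1 by rewrite /sgnx; case: ifP => _; rewrite ?normrN normr1.
    rewrite mul1r.
    have -> : sw (L * q x) * (L * (2 * p x)) = L * (2 * (sw (L * q x) * p x)) by ring.
    rewrite normrM gtr0_norm// ler_pM2l// normrM ger0_norm//.
    apply: (le_trans (bilinear_bound _ _ _ _ (sqrtr_ge0 _))).
    rewrite -/(sw (L * q x)) -/(n1 x) -/(q x) lerD2r sqr_swfun// /wfun (gfunM _ (ltW L0)).
    have := density_ge0 x; have gp := gfun_ge0 s1 (q x); have lp := apow_ge0 s L.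
    move: (q x) (g (q x)) gp (apow s L) lp => Q G G0 A A0 Q0.
    have h : c * (A * G) <= `|c| * (A * G) by rewrite ler_wpM2r ?mulr_ge0// ler_norm.
    have := sqr_ge0 (A * G) => h2.
    rewrite -[`|c| * A * _]/(`|c| * A * (G * Q)).
    have -> : kappa * Q + `|c| * A * (G * Q) = (kappa + `|c| * (A * G)) * Q by ring.
    by rewrite ler_wpM2r//; lra.
  - apply/integrable_funZ/integrable_funD; last exact: kinetic_integrable.
    apply: integrable_funD; first exact: mass_integrable.
    exact/integrable_funZ/power_integrable.
have i_S : intble setT Sd.
  apply: integrable_lin4; [exact: kinetic_integrable|exact: mass_integrable|
    exact: power_integrable|exact: current_integrable].
have i_f2 : intble setT (fun x => 2^-1 * f x) by exact: integrable_funZ.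
have i_r : intble setT (residual L tau xm).
  have : intble setT (fun x => Sd x - 2^-1 * f x).
    exact: (integrableB measurableT i_S i_f2).
  by congr (_ .-integrable _ _); apply/funext => x /=; rewrite resE.
split=> //.
transitivity (\int[mu]_x Sd x).
  apply/esym/Rintegral_lin4; [exact: kinetic_integrable|exact: mass_integrable|
    exact: power_integrable|exact: current_integrable].
have -> : \int[mu]_x residual L tau xm x = (\int[mu]_x Sd x) - \int[mu]_x (2^-1 * f x).
  by rewrite -RintegralB//; apply: eq_Rintegral => x _; rewrite resE.
have -> : \int[mu]_x (2^-1 * f x) = 2^-1 * \int[mu]_x f x by rewrite RintegralZl.
have -> : \int[mu]_x f x = (2 * Gam qt - Gam 0) - Gam 0.
  have G0 (e : R) : 0 < e -> exists2 M, 0 <= M & forall x, M <= `|x| -> `|Gam (L * q x) - Gam 0| <= e.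
    move=> e0; have /cvgrPdist_le/(_ _ e0)[d /= d0 Hd] := cG 0.
    have dL : 0 < d / (2 * L) by rewrite divr_gt0 ?mulr_gt0.
    have [M M0 HM] := density_vanishing dL.
    exists M => // x /HM; rewrite ger0_norm ?density_ge0// => h.
    rewrite distrC; apply: Hd; rewrite /ball_/= sub0r normrN ger0_norm//.
    apply: (@le_lt_trans _ _ (L * (d / (2 * L)))); first by rewrite ler_pM2l.
    have -> : L * (d / (2 * L)) = d / 2 by field; rewrite gt_eqF.
    by lra.
  apply: (ac_on_Rintegral aF i_f) => e e0; have [M M0 HM] := G0 e e0.
    exists (Num.max M xm) => x; rewrite ge_max => /andP[Mx mx].
    rewrite /F ltNge mx /=.
    have -> : 2 * Gam qt + - Gam (L * q x) - (2 * Gam qt - Gam 0) = - (Gam (L * q x) - Gam 0) by ring.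
    by rewrite normrN; apply: HM; rewrite ger0_norm// (le_trans M0 Mx).
  exists (Num.min (- M) (xm - 1)) => x; rewrite le_min => /andP[Mx mx].
  have xxm : x < xm by lra.
  by rewrite /F xxm; apply: HM; rewrite ler_normr; apply/orP; right; lra.
by move: (\int[mu]_x Sd x) (Gam qt) (Gam 0) => X g1 g0; field.
Qed.

End Bogomolny.

(** * The explicit profile *)

Section RayLemmas.
Context {R : realType}.
Implicit Types (f z : R -> R) (x y k : R).

Lemma const_ray f x0 : continuous f -> (forall x, x0 < x -> is_derive x 1 f 0) ->
  forall x, x0 <= x -> f x = f x0.
Proof.
move=> cf df x x0x.
have dfi t : t \in `]x0, x[ -> is_derive t 1 f (cst 0 t).
  by rewrite in_itv/= => /andP[? _]; exact: df.
have [t _ /eqP] := MVT_segment x0x dfi (continuous_subspaceT cf).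
by rewrite mul0r subr_eq0 => /eqP.
Qed.

Lemma nonincreasing_ray f (f1 : R -> R) x0 : continuous f ->
  (forall x, x0 < x -> is_derive x 1 f (f1 x)) ->
  (forall x, x0 < x -> f1 x <= 0) ->
  forall x y, x0 <= x -> x <= y -> f y <= f x.
Proof.
move=> cf df f10 x y x0x xy.
have dfi t : t \in `]x, y[ -> is_derive t 1 f (f1 t).
  by rewrite in_itv/= => /andP[? _]; apply: df; apply: le_lt_trans x0x _.
move: xy; rewrite le_eqVlt => /predU1P[->//|xy].
have [t] := MVT xy dfi (continuous_subspaceT cf).
rewrite in_itv/= => /andP[xt ty] E.
rewrite -subr_le0 E mulr_le0_ge0 ?subr_ge0 ?(ltW xy)// f10//.
exact: le_lt_trans x0x xt.
Qed.

Lemma linear_ray_unique z (z1 : R -> R) k x0 : continuous z -> continuous z1 ->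
  (forall x, x0 < x -> is_derive x 1 z (z1 x)) ->
  (forall x, x0 < x -> is_derive x 1 z1 (k ^+ 2 * z x)) ->
  z x0 = 0 -> z1 x0 = 0 -> forall x, x0 <= x -> z x = 0.
Proof.
move=> cz cz1 dz dz1 zx0 z1x0.
have dexp l x : is_derive x 1 (fun t : R => expR (l * t)) (l * expR (l * x)).
  apply: der_eq (der_comp (derZ l (der_id x)) (is_derive_expR _)) _.
  by rewrite mulr1 mulrC.
have cexp l : continuous (fun t : R => expR (l * t)).
  by apply: is_derive1_continuousT; exact: dexp.
have E1 x : x0 <= x -> z1 x = k * z x.
  move=> x0x.
  have H : (z1 x - k * z x) * expR (k * x) = 0.
    transitivity ((z1 x0 - k * z x0) * expR (k * x0)).
      apply: (const_ray (f := fun t => (z1 t - k * z t) * expR (k * t)) _ _ x0x).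
        by apply: contM (cexp k); apply: contB cz1 _; exact: contZ.
      move=> t x0t; apply: der_eq (derM (derB (dz1 t x0t) (derZ k (dz t x0t))) (dexp k t)) _.
      by rewrite /=; ring.
    by rewrite z1x0 zx0 mulr0 subrr mul0r.
  by apply/eqP; rewrite -subr_eq0; move/eqP: H; rewrite mulf_eq0 expR_eq0 orbF.
move=> x x0x.
have H : z x * expR (- k * x) = 0.
  transitivity (z x0 * expR (- k * x0)); last by rewrite zx0 mul0r.
  apply: (const_ray (f := fun t => z t * expR (- k * t)) _ _ x0x).
    exact: contM.
  move=> t x0t; apply: der_eq (derM (dz t x0t) (dexp (- k) t)) _.
  by rewrite /= (E1 t (ltW x0t)); ring.
by apply/eqP; move/eqP: H; rewrite mulf_eq0 expR_eq0 orbF.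
Qed.

End RayLemmas.

Section Profile.
Context {R : realType}.
Variables (s kappa c : R).
Hypotheses (s1 : 1 <= s) (k0 : 0 <= kappa)
  (hkc : 0 < kappa \/ (kappa = 0 /\ 0 < c)).
Local Notation g := (gfun s).
Local Notation w := (wfun s kappa c).
Local Notation sw := (swfun s kappa c).
Local Notation qt := (qtop s kappa c).
Local Notation gt := (gtop kappa c).
Implicit Types (x y q : R).

Let s0 : 0 < s. Proof. exact: lt_le_trans ltr01 s1. Qed.
Let s2 : 0 < 2 * s + 2. Proof. by rewrite addr_gt0 ?mulr_gt0. Qed.

Lemma der_gfun q : 0 < q -> is_derive q 1 g (s * g q / q).
Proof.
move=> q0; have dp := is_derive1_powR s q0.
have d : is_derive q 1 (fun x : R => x `^ s * (2 * s + 2)^-1) (s * g q / q).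
  apply: der_eq (derM dp (der_cst q _)) _.
  rewrite /gfun apow_eq ?(ltW q0)// -(mulr_powRB1 (ltW q0) s0).
  by field; rewrite !gt_eqF.
apply: der_near d _; near=> x.
by rewrite /gfun apow_eq// ltW//; near: x; exact: lt_nbhsr.
Unshelve. all: end_near. Qed.

Lemma der_wfun q : 0 < q -> is_derive q 1 w ((c - 2 * g q) * (s * g q / q)).
Proof.
move=> q0; have dg := der_gfun q0.
apply: der_eq (derB (derD (der_cst q kappa) (derZ c dg)) (der_sqr dg)) _.
by ring.
Qed.

Lemma der_swfun q : 0 < q -> q < qt ->
  is_derive q 1 sw ((c - 2 * g q) * (s * g q / q) / (2 * sw q)).
Proof.
move=> q0 qqt; have w0 : 0 < w q by exact: wfun_gt0.
apply: der_eq (der_comp (der_wfun q0) (is_derive1_sqrt w0)) _.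
by rewrite /swfun mulrC.
Qed.

Lemma swfun_gt0 q : 0 < q -> q < qt -> 0 < sw q.
Proof. by move=> q0 qqt; rewrite sqrtr_gt0; exact: wfun_gt0. Qed.

(** The reason why [q^(-s)] obeys a linear equation: the nonlinearity times [q^(-s)] is a
    constant. *)
Lemma powRN_gfun q : 0 < q -> q `^ (- s) * g q = (2 * s + 2)^-1.
Proof.
move=> q0; rewrite /gfun apow_eq ?(ltW q0)// mulrA -powRD.
  by rewrite addNr powRr0 mul1r.
by rewrite (gt_eqF q0) implybT.
Qed.

(* The inverse of the expression whose power [1/(2s)] is the profile of the
   solitary wave. *)
Definition Ysol x : R :=
  if 0 < kappa then
    (Num.sqrt (c ^+ 2 + 4 * kappa) * cosh (2 * s * Num.sqrt kappa * x) - c) /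
    (4 * kappa * (s + 1))
  else (s ^+ 2 * (c * x) ^+ 2 + 1) / (2 * (s + 1) * c).

Definition Ysol1 x : R :=
  if 0 < kappa then
    Num.sqrt (c ^+ 2 + 4 * kappa) * (2 * s * Num.sqrt kappa) *
    ((expR (2 * s * Num.sqrt kappa * x) - expR (- (2 * s * Num.sqrt kappa * x))) / 2) /
    (4 * kappa * (s + 1))
  else s ^+ 2 * c * x / (s + 1).

Let kc : 0 < kappa = false -> kappa = 0 /\ 0 < c.
Proof. by case: hkc => [->|//]. Qed.

Let s10 : 0 < s + 1. Proof. by rewrite addr_gt0. Qed.

Lemma der_Ysol x : is_derive x 1 Ysol (Ysol1 x).
Proof.
rewrite /Ysol /Ysol1; case: ifPn => [kp|/negbTE/kc[k00 c0]].
  set k := 2 * s * Num.sqrt kappa.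
  have dl := derZ k (der_id x).
  have d1 := der_comp dl (is_derive_expR _).
  have d2 := der_comp (derN dl) (is_derive_expR _).
  apply: der_eq (derM (derB (derZ (Num.sqrt (c ^+ 2 + 4 * kappa))
    (derM (derD d1 d2) (der_cst x 2^-1))) (der_cst x c)) (der_cst x _)) _.
  by rewrite /=; field; rewrite !gt_eqF.
apply: der_eq (derM (derD (derZ (s ^+ 2) (der_sqr (derZ c (der_id x))))
  (der_cst x 1)) (der_cst x (2 * (s + 1) * c)^-1)) _.
by rewrite /=; field; rewrite !gt_eqF.
Qed.

(** The coefficient [4 s^2 kappa] is written as the square of [2 s sqrt(kappa)], the form in which
    [linear_ray_unique] factors the operator. *)
Lemma der_Ysol1 x :
  is_derive x 1 Ysol1 ((2 * s * Num.sqrt kappa) ^+ 2 * Ysol x + s ^+ 2 * c / (s + 1)).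
Proof.
rewrite /Ysol /Ysol1; case: ifPn => [kp|/negbTE/kc[k00 c0]].
  set k := 2 * s * Num.sqrt kappa.
  have k2 : k ^+ 2 = 4 * s ^+ 2 * kappa.
    by rewrite /k exprMn sqr_sqrtr; [ring|exact: ltW].
  have dl := derZ k (der_id x).
  have d1 := der_comp dl (is_derive_expR _).
  have d2 := der_comp (derN dl) (is_derive_expR _).
  apply: der_eq (derM (derZ (Num.sqrt (c ^+ 2 + 4 * kappa) * k)
    (derM (derB d1 d2) (der_cst x 2^-1))) (der_cst x _)) _.
  rewrite /= /cosh; move: (expR _) (expR _) (Num.sqrt (c ^+ 2 + _)) => E1 E2 S.
  transitivity (k ^+ 2 * S * ((E2 + E1) / 2) / (4 * kappa * (s + 1))).
    by field; rewrite !gt_eqF.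
  by rewrite k2; field; rewrite !gt_eqF.
rewrite k00 sqrtr0 mulr0 expr0n/= mul0r add0r.
apply: der_eq (derM (derZ (s ^+ 2 * c) (der_id x)) (der_cst x (s + 1)^-1)) _.
by rewrite /=; field; rewrite gt_eqF.
Qed.

Lemma YsolN x : Ysol (- x) = Ysol x.
Proof.
by rewrite /Ysol /cosh !mulrN opprK sqrrN [expR (- _) + _]addrC.
Qed.

Lemma Ysol1_0 : Ysol1 0 = 0.
Proof.
rewrite /Ysol1 !mulr0 oppr0 subrr !mul0r.
by case: ifP => _; rewrite ?mulr0 ?mul0r.
Qed.

Lemma Ysol_0 : Ysol 0 = qt `^ (- s).
Proof.
have gt0 : 0 < gt by exact: gtop_gt0.
have -> : qt `^ (- s) = ((2 * s + 2) * gt)^-1.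
  have := powRN_gfun (qtop_gt0 s1 hkc); rewrite gfun_qtop// => /(canRL (mulfK _)) ->.
    by rewrite [in RHS]invfM.
  by rewrite gt_eqF.
have gE := gtop_sqr c k0; rewrite /Ysol; case: ifPn => [kp|/negbTE/kc[k00 c0]].
  have SE : Num.sqrt (c ^+ 2 + 4 * kappa) = 2 * gt - c by rewrite /gtop; field.
  rewrite mulr0 /cosh oppr0 expR0 SE.
  have kE : kappa = gt * (gt - c) by rewrite mulrBr -expr2 gE; ring.
  have gc : gt - c != 0.
    by apply/eqP => E; move: kp; rewrite kE E mulr0 ltxx.
  move: (gtop kappa c) gt0 kE gc {gE SE} => G G0 kE gc.
  by rewrite kE; field; rewrite gc !gt_eqF.
have -> : gt = c.
  apply: (mulfI (lt0r_neq0 gt0)); rewrite -expr2 gE k00; ring.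
by rewrite mulr0 expr0n/= mulr0 add0r; field; rewrite !gt_eqF.
Qed.

Lemma Ysol_gt0 x : 0 < Ysol x.
Proof.
rewrite /Ysol; case: ifPn => [kp|/negbTE/kc[k00 c0]]; last first.
  by rewrite divr_gt0 ?mulr_gt0// ltr_wpDl// mulr_ge0 ?sqr_ge0.
rewrite divr_gt0 ?mulr_gt0// subr_gt0.
have cS : c < Num.sqrt (c ^+ 2 + 4 * kappa).
  apply: le_lt_trans (ler_norm c) _; rewrite -sqrtr_sqr ltr_sqrt.
    by rewrite ltrDl mulr_gt0.
  by rewrite ltr_wpDl ?sqr_ge0 ?mulr_gt0.
have ch : 1 <= cosh (2 * s * Num.sqrt kappa * x).
  rewrite /cosh expRN; move: (expR _) (expR_gt0 (2 * s * Num.sqrt kappa * x)) => E E0.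
  rewrite -subr_ge0; have -> : (E + E^-1) / 2 - 1 = (E - 1) ^+ 2 / (2 * E).
    by field; rewrite gt_eqF.
  by rewrite divr_ge0 ?sqr_ge0// mulr_ge0 ?ltW.
by apply: lt_le_trans cS _; rewrite ler_peMr// sqrtr_ge0.
Qed.

Definition Qsol x : R := Ysol x `^ (- s^-1).

Lemma Qsol_gt0 x : 0 < Qsol x. Proof. by rewrite powR_gt0// Ysol_gt0. Qed.

Lemma powRN_Qsol x : Qsol x `^ (- s) = Ysol x.
Proof. by rewrite /Qsol -powRrM mulrNN mulVf ?gt_eqF// powRr1 ?(ltW (Ysol_gt0 x)). Qed.

Lemma powRN_eq_Qsol q x : 0 < q -> q `^ (- s) = Ysol x -> q = Qsol x.
Proof.
move=> q0 E; rewrite /Qsol -E -powRrM mulrNN mulfV ?gt_eqF//.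
by rewrite powRr1 ?(ltW q0).
Qed.

Lemma QsolN x : Qsol (- x) = Qsol x.
Proof. by rewrite /Qsol YsolN. Qed.

Lemma Qsol_0 : Qsol 0 = qt.
Proof. by apply/esym/powRN_eq_Qsol; rewrite ?Ysol_0//; exact: qtop_gt0. Qed.

(** This is [(q' / 2)'] when [q' = 2 h q] and [h^2 = wfun q], as far as [h] is differentiable. Along
    a solution of the first-order equation the constraint functional is [alpha] times its
    integral. *)
Definition kdens q : R := q * (2 * w q + s * c * g q - 2 * s * g q ^+ 2).

(* Right half of a decreasing profile: a plateau at height [qt], then [Qsol];
   [q^(-s)] solves a linear equation once the plateau is left. *)
Lemma half_profile (q : R -> R) xm : continuous q ->
  (forall x, 0 < q x) -> (forall x, q x <= qt) -> q xm = qt ->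
  (forall x, xm < x -> is_derive x 1 q (- (2 * sw (q x) * q x))) ->
  vanishing q ->
  exists2 x2, xm <= x2 & (forall x, xm <= x <= x2 -> q x = qt) /\
    (forall x, x2 < x -> q x < qt) /\
    (forall x, x2 <= x -> q x = Qsol (x - x2)).
Proof.
move=> cq q0 qle qm dq vq.
have qtp : 0 < qt by exact: qtop_gt0.
have mono := nonincreasing_ray cq dq.
have {}mono : forall x y, xm <= x -> x <= y -> q y <= q x.
  apply: mono => x _; rewrite oppr_le0 mulr_ge0 ?(ltW (q0 x))// mulr_ge0//.
  exact: sqrtr_ge0.
pose S := [set x | xm <= x /\ q x = qt].
have qt2 : 0 < qt / 2 by rewrite divr_gt0.
have [M M0 HM] := vq _ qt2.
have Sxm : S xm by split.
have ubS : has_ubound S.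
  exists M => x [_ qx]; rewrite leNgt; apply/negP => Mx.
  have : M <= `|x| by rewrite (le_trans (ltW Mx))// ler_norm.
  by move=> /HM; rewrite qx gtr0_norm//; lra.
have supS : has_sup S by split; [exists xm|].
pose x2 := sup S.
have xx2 : xm <= x2 by exact: ub_le_sup.
have qx2 : q x2 = qt.
  apply/eqP; rewrite eq_le qle /= leNgt; apply/negP => lt.
  have /cvgrPdist_lt/(_ _ _) := cq x2.
  have d0 : 0 < qt - q x2 by rewrite subr_gt0.
  move=> /(_ _ d0)[d /= dp Hd].
  have [t [xt qtE] tx2] := sup_adherent dp supS.
  have tle : t <= x2 by apply: ub_le_sup.
  have := Hd t; rewrite /ball_/= qtE => /(_ _).
  have -> : `|x2 - t| < d by rewrite ger0_norm ?subr_ge0//; move: tx2; rewrite -/x2; lra.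
  move=> /(_ isT); rewrite ltr0_norm; last by rewrite subr_lt0.
  by rewrite opprB ltxx.
have aft x : x2 < x -> q x < qt.
  move=> xx; rewrite lt_neqAle qle andbT; apply/eqP => qx.
  have : x <= x2 by apply: ub_le_sup => //; split=> //; apply: le_trans xx2 (ltW xx).
  by rewrite leNgt xx.
exists x2 => //; split.
  move=> x /andP[xmx xx]; apply/eqP; rewrite eq_le qle/= -qx2.
  exact: mono.
split=> // x xx; apply: powRN_eq_Qsol => //; apply/eqP; rewrite -subr_eq0; apply/eqP.
pose y t := q t `^ (- s).
have dy t : xm < t -> is_derive t 1 y (2 * s * sw (q t) * y t).
  move=> xt; apply: der_eq (der_comp (dq t xt) (is_derive1_powR (- s) (q0 t))) _.
  have -> : q t `^ (- s - 1) = y t / q t.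
    by rewrite powRB ?(gt_eqF (q0 t)) ?implybT// powRr1// ltW.
  by field; rewrite gt_eqF.
have cy : continuous y.
  move=> t; apply: (@continuous_comp _ _ _ q (fun r : R => r `^ (- s))); first exact: cq.
  exact: is_derive1_continuous (is_derive1_powR (- s) (q0 t)).
have csw : continuous (fun t => sw (q t)).
  by apply: cont_comp cq _; exact: swfun_continuous.
have cY : continuous Ysol by exact: is_derive1_continuousT der_Ysol.
have cY1 : continuous Ysol1 by exact: is_derive1_continuousT der_Ysol1.
have dsub (f : R -> R) l t : is_derive (t - x2) 1 f l -> is_derive t 1 (fun t : R => f (t - x2)) l.
  move=> df; apply: der_eq (der_comp (derB (der_id t) (der_cst t x2)) df) _.
  by rewrite subr0 mulr1.
(* Past [x2] one has [q < qt], so [sw (q)] is differentiable and [y = q^(-s)] solves the equation of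
   [Ysol]. At [x2] the data agree: [y = Ysol 0], and [y' = 2 s sw(q) y] vanishes because
   [sw qt = 0]. *)
apply: (@linear_ray_unique _ (fun t => y t - Ysol (t - x2))
  (fun t => 2 * s * sw (q t) * y t - Ysol1 (t - x2)) (2 * s * Num.sqrt kappa) x2).
- by apply: contB cy _; exact: cont_shift.
- by apply: contB; [apply: contM cy; exact: contZ|exact: cont_shift].
- move=> t xt; apply: derB; last exact/dsub/der_Ysol.
  by apply: dy; exact: le_lt_trans xx2 xt.
- move=> t xt; have xmt : xm < t by exact: le_lt_trans xx2 xt.
  have qlt := aft t xt; have swp := swfun_gt0 (q0 t) qlt.
  have dsw := der_comp (dq t xmt) (der_swfun (q0 t) qlt).
  apply: der_eq (derB (derM (derZ (2 * s) dsw) (dy t xmt)) (dsub _ _ _ (der_Ysol1 _))) _.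
  have w2 := sqr_swfun s1 k0 hkc (ltW (q0 t)) (ltW qlt).
  have yg : y t * g (q t) = (2 * s + 2)^-1 by exact: powRN_gfun.
  have k2 : (2 * s * Num.sqrt kappa) ^+ 2 = 4 * s ^+ 2 * kappa.
    by rewrite exprMn sqr_sqrtr; [ring|exact: k0].
  rewrite k2.
  transitivity (2 * s ^+ 2 * (y t * (2 * sw (q t) ^+ 2 + 2 * g (q t) ^+ 2) - c * (y t * g (q t)))
     - (4 * s ^+ 2 * kappa * Ysol (t - x2) + s ^+ 2 * c / (s + 1))).
    by field; rewrite !gt_eqF.
  rewrite w2 /wfun.
  transitivity (2 * s ^+ 2 * (2 * kappa * y t + c * (y t * g (q t)))
     - (4 * s ^+ 2 * kappa * Ysol (t - x2) + s ^+ 2 * c / (s + 1))); first by ring.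
  by rewrite yg; field; rewrite !gt_eqF.
- by rewrite subrr /y qx2 Ysol_0 subrr.
- by rewrite subrr qx2 swfun_qtop// mulr0 mul0r Ysol1_0 subrr.
- exact: xx.
Qed.

End Profile.

(** * The first-order flow: phase and plateau *)

Section ProfileFlow.
Context {R : realType}.
Variables (s kappa c : R).
Hypotheses (s1 : 1 <= s) (k0 : 0 <= kappa)
  (hkc : 0 < kappa \/ (kappa = 0 /\ 0 < c)).
Local Notation mu := (@lebesgue_measure R).
Local Notation intble A f := (mu.-integrable A (EFin \o f)).
Local Notation g := (gfun s).
Local Notation w := (wfun s kappa c).
Local Notation sw := (swfun s kappa c).
Local Notation qt := (qtop s kappa c).
Local Notation Q := (Qsol s kappa c).
Implicit Types (x y : R).

Let s0 : 0 < s. Proof. exact: lt_le_trans ltr01 s1. Qed.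
Let s2 : 0 < 2 * s + 2. Proof. by rewrite addr_gt0 ?mulr_gt0. Qed.

(* [psi' = (h - i g(|psi|^2)) psi] for [psi = u + i v]. *)
Definition profile_flow (h u v : R -> R) := continuous h /\
  forall x, is_derive x 1 u (h x * u x + g (density u v x) * v x) /\
            is_derive x 1 v (h x * v x - g (density u v x) * u x).

Lemma unit_circle_angle (a b : R) : a ^+ 2 + b ^+ 2 = 1 ->
  exists2 theta : R, 0 <= theta < 2 * pi & a = cos theta /\ b = sin theta.
Proof.
move=> ab.
have a1 : -1 <= a <= 1.
  by rewrite -ler_norml -(expr_le1 (ltn0Sn 1))// real_normK ?num_real//; have := sqr_ge0 b; lra.
have ca : cos (acos a) = a by rewrite acosK// in_itv.
have sa : sin (acos a) = `|b|.
  by rewrite sin_acos// -sqrtr_sqr; congr Num.sqrt; lra.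
have p0 := pi_gt0 R.
have a0 := acos_ge0 a1; have api := acos_lepi a1.
have [b0|b0] := leP 0 b.
  exists (acos a); first by rewrite a0/=; lra.
  by rewrite ca sa ger0_norm.
exists (2 * pi - acos a).
  rewrite subr_ge0 (le_trans api)/=; last by lra.
  rewrite ltrBlDr ltrDl lt_neqAle a0 andbT; apply/eqP => E.
  by move: sa; rewrite -E sin0 => /esym/eqP; rewrite normr_eq0 lt_eqF.
rewrite cosB sinB.
have c2 : cos (2 * pi) = 1 :> R by rewrite mulr_natl cos2pi.
have s2' : sin (2 * pi) = 0 :> R by rewrite mulr_natl sin2pi.
rewrite c2 s2' ca sa ltr0_norm//; split; ring.
Qed.

Lemma der_density (h u v : R -> R) x : profile_flow h u v ->
  is_derive x 1 (density u v) (2 * h x * density u v x).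
Proof.
move=> [_ /(_ x)[du dv]].
apply: der_eq (derD (der_sqr du) (der_sqr dv)) _.
by rewrite /density; ring.
Qed.

(** The density solves the linear equation [q' = 2 h q], so [q e^(-H)] is constant when
    [H' = 2 h]. *)
Lemma density_gt0 (h u v : R -> R) x0 : profile_flow h u v ->
  0 < density u v x0 -> forall x, 0 < density u v x.
Proof.
move=> hf q0 x; have [ch _] := hf.
have c2h : continuous (fun x => 2 * h x) by exact: contZ.
have [H dH] := continuous_primitive c2h.
pose f t := density u v t * expR (- H t).
have df (t : R) : is_derive t 1 f 0.
  apply: der_eq (derM (der_density t hf) (der_comp (derN (dH t)) (is_derive_expR _))) _.
  by rewrite /=; ring.
have := is_derive_0_is_cst x x0 df; rewrite /f => E.
by rewrite -(pmulr_lgt0 _ (expR_gt0 (- H x))) E mulr_gt0// expR_gt0.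
Qed.

Lemma gQ_continuous : continuous (fun x => g (Q x)).
Proof.
apply: cont_comp; last exact: gfun_continuous.
move=> x; apply: (@continuous_comp _ _ _ (Ysol s kappa c) (fun r : R => r `^ (- s^-1))).
  exact: is_derive1_continuous (der_Ysol s1 hkc x).
apply: is_derive1_continuous; apply: is_derive1_powR; exact: Ysol_gt0.
Qed.

(** The pair [(A, B)] consists of the parts of [psi e^(i T) / |psi|]. The flow makes this number
    constant, and it has modulus 1, so it is some [e^(i theta)]. *)
Lemma phase_form (h u v T : R -> R) x0 : profile_flow h u v ->
  (forall x, density u v x = Q (x - x0)) ->
  (forall x, is_derive x 1 T (g (Q x))) ->
  exists2 theta : R, 0 <= theta < 2 * pi & forall x,
    u x = Num.sqrt (Q (x - x0)) * cos (theta - T (x - x0)) /\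
    v x = Num.sqrt (Q (x - x0)) * sin (theta - T (x - x0)).
Proof.
move=> hf qQ dT; have [ch duv] := hf.
pose r x := Num.sqrt (density u v x).
have q0 x : 0 < density u v x by rewrite qQ; exact: Qsol_gt0.
have r0 x : 0 < r x by rewrite sqrtr_gt0.
have rn x : r x != 0 by rewrite gt_eqF.
have r2 x : r x ^+ 2 = density u v x by rewrite sqr_sqrtr// ltW.
have dr x : is_derive x 1 r (h x * r x).
  apply: der_eq (der_comp (der_density x hf) (is_derive1_sqrt (q0 x))) _.
  by rewrite -/(r x) -r2; field.
pose t x := T (x - x0).
have dt x : is_derive x 1 t (g (density u v x)).
  rewrite qQ; apply: der_eq (der_comp (derB (der_id x) (der_cst x x0)) (dT _)) _.
  by rewrite subr0 mulr1.
have dc x := der_comp (dt x) (is_derive_cos (t x)).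
have ds x := der_comp (dt x) (is_derive_sin (t x)).
have dri x := derV (rn x) (dr x).
pose A x := (u x * cos (t x) - v x * sin (t x)) * (r x)^-1.
pose B x := (u x * sin (t x) + v x * cos (t x)) * (r x)^-1.
have dA x : is_derive x 1 A 0.
  have [du dv] := duv x.
  apply: der_eq (derM (derB (derM du (dc x)) (derM dv (ds x))) (dri x)) _.
  by rewrite /=; field.
have dB x : is_derive x 1 B 0.
  have [du dv] := duv x.
  apply: der_eq (derM (derD (derM du (ds x)) (derM dv (dc x))) (dri x)) _.
  by rewrite /=; field.
have Ac x : A x = A x0 by exact: is_derive_0_is_cst.
have Bc x : B x = B x0 by exact: is_derive_0_is_cst.
have cs x : cos (t x) ^+ 2 + sin (t x) ^+ 2 = 1 by exact: cos2Dsin2.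
have uE x : u x = r x * (A x * cos (t x) + B x * sin (t x)).
  transitivity (u x * (cos (t x) ^+ 2 + sin (t x) ^+ 2)); first by rewrite cs mulr1.
  by rewrite /A /B; field.
have vE x : v x = r x * (B x * cos (t x) - A x * sin (t x)).
  transitivity (v x * (cos (t x) ^+ 2 + sin (t x) ^+ 2)); first by rewrite cs mulr1.
  by rewrite /A /B; field.
have AB : A x0 ^+ 2 + B x0 ^+ 2 = 1.
  transitivity ((u x0 ^+ 2 + v x0 ^+ 2) * (cos (t x0) ^+ 2 + sin (t x0) ^+ 2) / r x0 ^+ 2).
    by rewrite /A /B; field.
  by rewrite cs mulr1 r2 /density mulfV// -/(density u v x0) gt_eqF.
have [theta th [Ath Bth]] := unit_circle_angle AB.
exists theta => // x; rewrite -qQ -/(r x) -/(t x) cosB sinB -Ath -Bth.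
by rewrite uE vE Ac Bc; split; congr (_ * _); ring.
Qed.

(** At [qtop] the potential vanishes and the value is [- s qtop gtop sqrt(c^2 + 4 kappa)]. *)
Lemma kdens_qtop : kdens s kappa c qt < 0.
Proof.
have gt0 : 0 < gtop kappa c by exact: gtop_gt0.
rewrite /kdens wfun_qtop// gfun_qtop// mulr0 add0r pmulr_rlt0; last exact: qtop_gt0.
have -> : s * c * gtop kappa c - 2 * s * gtop kappa c ^+ 2 =
   s * gtop kappa c * (c - 2 * gtop kappa c) by ring.
rewrite (pmulr_rlt0 _ (mulr_gt0 s0 gt0)).
have -> : c - 2 * gtop kappa c = - Num.sqrt (c ^+ 2 + 4 * kappa) by rewrite /gtop; field.
rewrite oppr_lt0 sqrtr_gt0.
case: hkc => [kp|[-> c0]]; first by rewrite ltr_wpDl ?sqr_ge0 ?mulr_gt0.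
by rewrite mulr0 addr0 exprn_gt0.
Qed.

Lemma kdens_continuous : continuous (kdens s kappa c).
Proof.
have cg := gfun_continuous s1; have cw := @wfun_continuous _ s kappa c s1.
apply: contM; first by move=> x; exact: cvg_id.
by apply: contB; [apply: contD; exact: contZ|apply: contZ; exact: contM].
Qed.

Lemma swfun_bounded : exists2 W, 0 <= W & forall x, 0 <= x -> x <= qt -> `|sw x| <= W.
Proof.
have qp : 0 < qt by exact: qtop_gt0.
have csw : continuous sw by exact: swfun_continuous.
have [m _ hm] := EVT_max (ltW qp) (continuous_subspaceT csw).
exists (sw m); first exact: sqrtr_ge0.
by move=> x x0 xq; rewrite ger0_norm ?sqrtr_ge0// hm// in_itv/= x0.
Qed.

Definition signed_sw (u v : R -> R) xm x := sgnx xm x * sw (density u v x).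

(* The constraint density integrates to zero off the plateau [x1, x2] and is
   negative on it. *)
Lemma flow_plateau (u v : R -> R) xm :
  profile_flow (signed_sw u v xm) u v ->
  (forall x, density u v x <= qt) -> density u v xm = qt ->
  vanishing (density u v) -> intble setT (fun x => kdens s kappa c (density u v x)) ->
  exists x1 x2 : R, [/\ x1 <= xm <= x2,
    forall x, x2 <= x -> density u v x = Q (x - x2),
    forall x, x <= x1 -> density u v x = Q (x - x1) &
    \int[mu]_x kdens s kappa c (density u v x) = kdens s kappa c qt * (x2 - x1)].
Proof.
move=> hf qle qm vq ik.
have qp : 0 < qt by exact: qtop_gt0.
have q0 : forall x, 0 < density u v x.
  by apply: (density_gt0 (x0 := xm) hf); rewrite qm.
have dq x := der_density x hf.
have cq : continuous (density u v) by exact: is_derive1_continuousT dq.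
have [x2 xx2 [pl2 [lt2 Q2]]] : exists2 x2, xm <= x2 &
    (forall x, xm <= x <= x2 -> density u v x = qt) /\
    (forall x, x2 < x -> density u v x < qt) /\
    (forall x, x2 <= x -> density u v x = Q (x - x2)).
  apply: half_profile => // x xmx; apply: der_eq (dq x) _.
  by rewrite /signed_sw /sgnx ltNge (ltW xmx)/=; ring.
have copp (f : R -> R) : continuous f -> continuous (fun t : R => f (- t)).
  by move=> cf; apply: cont_comp cf => t; apply: cvgN; exact: cvg_id.
have dopp (f : R -> R) (l t : R) : is_derive (- t) 1 f l -> is_derive t 1 (fun t : R => f (- t)) (- l).
  by move=> df; apply: der_eq (der_comp (derN (der_id t)) df) _; rewrite mulrN1.
(* The half-line before [xm] is handled by the reflection [x |-> - x]; the plateau therefore begins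
   at [- y2]. *)
have [y2 yy2 [pl1 [lt1 Q1]]] : exists2 x2, - xm <= x2 &
    (forall x, - xm <= x <= x2 -> density u v (- x) = qt) /\
    (forall x, x2 < x -> density u v (- x) < qt) /\
    (forall x, x2 <= x -> density u v (- x) = Q (x - x2)).
  apply: (half_profile s1 k0 hkc (q := fun x => density u v (- x))) => //.
  - exact: copp.
  - by rewrite opprK.
  - move=> x xmx; have xlt : - x < xm by rewrite ltrNl.
    apply: der_eq (dopp _ _ _ (dq (- x))) _.
    by rewrite /signed_sw /sgnx xlt; ring.
  - by move=> e e0; have [M M0 HM] := vq e e0; exists M => // x Mx; apply: HM; rewrite normrN.
pose kq x := kdens s kappa c (density u v x).
have ckq : continuous kq.
  by apply: cont_comp cq _; exact: kdens_continuous.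
have [P dP] := continuous_primitive ckq.
have aP : ac_on P kq by exact: ac_on_FTC.
(* [T = q' / 2]. Off the plateau its derivative is [kq], so [P - T] is constant on each side; since
   [T] vanishes at both ends of the plateau and at infinity, only the plateau contributes to the
   integral. *)
pose T x := signed_sw u v xm x * density u v x.
have ch : continuous (signed_sw u v xm) by case: hf.
have cT : continuous T by exact: contM.
have cPT : continuous (fun x => P x - T x).
  by apply: contB cT; exact: is_derive1_continuousT dP.
have dT (x e : R) : density u v x < qt -> (\forall y \near x, sgnx xm y = e) -> e ^+ 2 = 1 ->
    is_derive x 1 T (kq x).
  move=> lt near_e e2; have swp := swfun_gt0 s1 k0 hkc (q0 x) lt.
  have ex : sgnx xm x = e by exact: nbhs_singleton near_e.
  have dsw := der_comp (dq x) (der_swfun s1 k0 hkc (q0 x) lt).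
  have : is_derive x 1 (fun y => e * sw (density u v y) * density u v y) (kq x).
    apply: der_eq (derM (derZ e dsw) (dq x)) _.
    rewrite /signed_sw ex /kq /kdens -(sqr_swfun s1 k0 hkc (ltW (q0 x)) (ltW lt)).
    transitivity (e ^+ 2 * (density u v x * (2 * sw (density u v x) ^+ 2 +
      s * c * g (density u v x) - 2 * s * g (density u v x) ^+ 2))); last by rewrite e2 mul1r.
    by field; rewrite !gt_eqF.
  move=> d; apply: der_near d _; apply: filterS near_e => y ey.
  by rewrite /T /signed_sw ey.
have R2 (x : R) : x2 <= x -> P x - T x = P x2 - T x2.
  move=> xx; apply: (const_ray cPT _ xx) => t x2t.
  have xmt : xm < t by exact: le_lt_trans xx2 x2t.
  have near1 : \forall y \near t, sgnx xm y = -1.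
    near=> y; rewrite /sgnx ltNge ltW//; near: y; exact: lt_nbhsr.
  have e1 : (- 1 : R) ^+ 2 = 1 by rewrite sqrrN expr1n.
  exact: der_eq (derB (dP t) (dT t _ (lt2 t x2t) near1 e1)) (subrr _).
have R1 (x : R) : x <= - y2 -> P x - T x = P (- y2) - T (- y2).
  move=> xx; have yx : y2 <= - x by rewrite lerNr.
  have := @const_ray _ (fun t => P (- t) - T (- t)) y2 (copp _ cPT) _ (- x) yx.
  rewrite opprK; apply=> t yt.
  have xmt : - t < xm by rewrite ltrNl; exact: le_lt_trans yy2 yt.
  have near1 : \forall y \near - t, sgnx xm y = 1.
    near=> y; rewrite /sgnx ifT//; near: y; exact: lt_nbhsl.
  have e1 : (1 : R) ^+ 2 = 1 by rewrite expr1n.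
  exact: der_eq (derB (dopp _ _ _ (dP (- t))) (dopp _ _ _ (dT (- t) _ (lt1 t yt) near1 e1))) (subrr _).
have T2 : T x2 = 0.
  by rewrite /T /signed_sw pl2 ?xx2 ?lexx// swfun_qtop// mulr0 mul0r.
have T1 : T (- y2) = 0.
  by rewrite /T /signed_sw pl1 ?yy2 ?lexx// swfun_qtop// mulr0 mul0r.
have [W W0 HW] := swfun_bounded.
have vT : vanishing T.
  move=> e e0; have d0 : 0 < e / (W + 1) by rewrite divr_gt0// ltr_wpDl.
  have [M M0 HM] := vq _ d0; exists M => // x /HM h.
  rewrite /T normrM /signed_sw normrM.
  have -> : `|sgnx xm x| = 1 by rewrite /sgnx; case: ifP => _; rewrite ?normrN normr1.
  rewrite mul1r; apply: (@le_trans _ _ (W * (e / (W + 1)))).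
    by apply: ler_pM => //; apply: HW; rewrite ?(ltW (q0 x)).
  rewrite mulrA ler_pdivrMr ?ltr_wpDl// mulrC ler_wpM2l ?(ltW e0)//; lra.
have y2xm : - y2 <= xm by rewrite lerNl.
exists (- y2), x2; split => //.
- by rewrite y2xm.
- move=> x xy; have yx : y2 <= - x by rewrite lerNr.
  by have := Q1 _ yx; rewrite opprK => ->; rewrite -QsolN; congr Q; ring.
- have -> : \int[mu]_x kq x = P x2 - P (- y2).
    apply: (ac_on_Rintegral aP ik) => e e0; have [M M0 HM] := vT e e0.
      exists (Num.max M x2) => x; rewrite ge_max => /andP[Mx xx].
      have := R2 x xx; rewrite T2 subr0 => E.
      have -> : P x - P x2 = T x by rewrite -E; ring.
      by apply: HM; rewrite (le_trans Mx)// ler_norm.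
    exists (Num.min (- M) (- y2)) => x; rewrite le_min => /andP[Mx xx].
    have := R1 x xx; rewrite T1 subr0 => E.
    have -> : P x - P (- y2) = T x by rewrite -E; ring.
    by apply: HM; rewrite ler_normr; apply/orP; right; lra.
  have yx : - y2 <= x2 by exact: le_trans y2xm xx2.
  rewrite (aP.2 _ _ yx).
  have aL : ac_on (fun x => kdens s kappa c qt * x) (fun=> kdens s kappa c qt).
    apply: ac_on_FTC; first by move=> x; exact: cvg_cst.
    by move=> x; apply: der_eq (derZ _ (der_id x)) _; rewrite mulr1.
  transitivity (\int[mu]_(t in `[- y2, x2]) kdens s kappa c qt).
    apply: eq_Rintegral => t; rewrite inE/= in_itv/= => /andP[h1 h2]; rewrite /kq.
    have [h|h] := leP xm t; first by rewrite pl2// h h2.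
    have yt : - xm <= - t <= y2 by rewrite lerN2 (ltW h) lerNl.
    by have := pl1 _ yt; rewrite opprK => ->.
  by rewrite -aL.2//; ring.
Unshelve. all: end_near. Qed.

End ProfileFlow.

Section AlmostEverywhere.
Context {R : realType}.
Local Notation mu := (@lebesgue_measure R).
Local Notation intble A f := (mu.-integrable A (EFin \o f)).
Implicit Types f g : R -> R.

Lemma Rintegral_eq0_ae f : intble setT f -> (forall x, 0 <= f x) ->
  \int[mu]_x f x = 0 -> {ae mu, forall x, f x = 0}.
Proof.
move=> i_f f0 I0; have mf := measurable_int _ i_f.
have /(ae_eq_integral_abs _ measurableT mf) : (\int[mu]_x `|(EFin \o f) x| = 0)%E.
  transitivity (\int[mu]_x (EFin \o f) x)%E.
    by apply: eq_integral => x _ /=; rewrite ger0_norm.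
  rewrite -(fineK (integrable_fin_num measurableT i_f)).
  by congr EFin; exact: I0.
by apply: aeS => x /(_ I) /= [].
Qed.

Lemma Rintegral_ae_eq f g : measurable_fun setT f -> measurable_fun setT g ->
  {ae mu, forall x, f x = g x} -> \int[mu]_x f x = \int[mu]_x g x.
Proof.
move=> mf mg fg; congr fine; apply: ae_eq_integral => //.
- exact/measurable_EFinP.
- exact/measurable_EFinP.
- by apply: aeS fg => x /= -> _.
Qed.

End AlmostEverywhere.

(** * The lower bound for the action and its equality case *)

Section Variational.
Context {R : realType}.
Variables (s kappa c alpha beta : R).
Hypotheses (s1 : 1 <= s) (k0 : 0 <= kappa)
  (hkc : 0 < kappa \/ (kappa = 0 /\ 0 < c)).
Hypotheses (hab1 : 0 < 2 * alpha - beta) (hab2 : 0 < 2 * alpha + beta)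
  (hbc : beta * c <= 0).
Local Notation mu := (@lebesgue_measure R).
Local Notation intble A f := (mu.-integrable A (EFin \o f)).
Local Notation g := (gfun s).
Local Notation w := (wfun s kappa c).
Local Notation sw := (swfun s kappa c).
Local Notation qt := (qtop s kappa c).
Local Notation Q := (Qsol s kappa c).

Let s0 : 0 < s. Proof. exact: lt_le_trans ltr01 s1. Qed.
Let al0 : 0 < alpha. Proof. by move: hab1 hab2; lra. Qed.

Definition real_action (u v u1 v1 : R -> R) : R :=
  1 / 2 * (\int[mu]_x kinetic u1 v1 x) +
  1 / 2 * (\int[mu]_x (kappa * density u v x)) +
  c / 2 * (\int[mu]_x (g (density u v x) * density u v x)) +
  1 * (\int[mu]_x (g (density u v x) * current u v u1 v1 x)).

Definition real_constraint (u v u1 v1 : R -> R) : R :=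
  (2 * alpha - beta) / 2 * (\int[mu]_x kinetic u1 v1 x) +
  (2 * alpha + beta) / 2 * (\int[mu]_x (kappa * density u v x)) +
  ((2 * s + 2) * alpha + beta) * c / 2 *
    (\int[mu]_x (g (density u v x) * density u v x)) +
  (2 * s + 2) * alpha * (\int[mu]_x (g (density u v x) * current u v u1 v1 x)).

Section OneState.
Variables (u v u1 v1 : R -> R).
Hypothesis hE : energy_space s kappa u v u1 v1.
Local Notation q := (density u v).
Local Notation J := (current u v u1 v1).
Local Notation n1 := (kinetic u1 v1).
Hypothesis nz : exists x, q x != 0.

(** Zero kinetic energy makes [u] and [v] constant, and a constant density that vanishes at infinity
    is 0. The positivity gives the strict case of [scaling_max]. *)
Lemma kinetic_gt0 : 0 < \int[mu]_x n1 x.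
Proof.
have n0 x : 0 <= n1 x by rewrite addr_ge0 ?sqr_ge0.
rewrite lt_neqAle Rintegral_ge0 ?andbT//; apply/eqP => /esym E.
have n10 := Rintegral_eq0_ae (kinetic_integrable hE) n0 E.
have cst_of (f f1 : R -> R) : ac_on f f1 -> {ae mu, forall x, f1 x = 0} ->
    forall x y, f x = f y.
  move=> af f10.
  have a0 : ac_on f (fun=> 0).
    by apply: ac_on_ae f10 af; apply: continuous_locint => x; exact: cvg_cst.
  have ac0 := ac_on_cst 0 : ac_on (fun=> 0 : R) (fun=> 0 : R).
  move=> x y; wlog xy : x y / x <= y => [W|].
    by have [/W//|/ltW/W] := leP x y.
  by have := a0.2 _ _ xy; rewrite -(ac0.2 _ _ xy); lra.
have [au av _ _] := hE.
have uc := cst_of _ _ au; have vc := cst_of _ _ av.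
have {}uc : forall x y, u x = u y.
  by apply: uc; apply: aeS n10 => x; rewrite /kinetic; have := sqr_ge0 (v1 x); have := sqr_ge0 (u1 x) => *; apply/eqP; rewrite -sqrf_eq0; apply/eqP; lra.
have {}vc : forall x y, v x = v y.
  by apply: vc; apply: aeS n10 => x; rewrite /kinetic; have := sqr_ge0 (v1 x); have := sqr_ge0 (u1 x) => *; apply/eqP; rewrite -sqrf_eq0; apply/eqP; lra.
case: nz => x0 qx0.
have q0 : 0 < q x0 by rewrite lt_neqAle eq_sym qx0 density_ge0.
have e0 : 0 < q x0 / 2 by rewrite divr_gt0.
have [M M0 HM] := density_vanishing s1 hE e0.
have : `|q M| <= q x0 / 2 by apply: HM; rewrite ger0_norm.
rewrite ger0_norm ?density_ge0//.
have -> : q M = q x0 by rewrite /density (uc M x0) (vc M x0).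
by lra.
Qed.

(* Scale so that the maximum of the density becomes [qtop]: Bogomolny's identity
   bounds the scaled action below, and under the constraint the action is
   maximal at scale 1. *)
Lemma variational (Gam : R -> R) : (forall t : R, is_derive t 1 Gam (sw t)) ->
  real_constraint u v u1 v1 = 0 ->
  Gam qt - Gam 0 <= real_action u v u1 v1 /\
  (real_action u v u1 v1 = Gam qt - Gam 0 -> exists xm : R,
    [/\ q xm = qt, forall x, q x <= qt &
      {ae mu, forall x,
        u1 x = signed_sw s kappa c u v xm x * u x + g (q x) * v x /\
        v1 x = signed_sw s kappa c u v xm x * v x - g (q x) * u x}]).
Proof.
move=> dG K0; have [xm hm] := density_max s1 hE.
have qm0 : 0 < q xm.
  by case: nz => x0 qx0; apply: lt_le_trans (hm x0); rewrite lt_neqAle eq_sym qx0 density_ge0.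
have qp : 0 < qt by exact: qtop_gt0.
pose a2 := 2 * alpha; have a20 : 0 < a2 by rewrite mulr_gt0.
pose t := (qt / q xm) `^ (a2^-1).
have t0 : 0 < t by rewrite powR_gt0// divr_gt0.
have tn : t != 0 by rewrite gt_eqF.
pose L := t `^ a2; pose tau := t `^ beta.
have L0 : 0 < L by exact: powR_gt0.
have tau0 : 0 < tau by exact: powR_gt0.
have LE : L = qt / q xm.
  by rewrite /L /t -powRrM mulVf ?gt_eqF// powRr1// divr_ge0 ?(ltW qp)// ltW.
have Lm : L * q xm = qt by rewrite LE mulfVK// gt_eqF.
have [ir E] := bogomolny s1 k0 hkc hE dG L0 tau0 hm Lm.
have r0 x : 0 <= residual s kappa c u v u1 v1 L tau xm x.
  by rewrite /residual mulr_ge0// ?addr_ge0 ?sqr_ge0// mulr_ge0 ?divr_ge0 ?(ltW tau0) ?(ltW L0).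
have R0 : 0 <= \int[mu]_x residual s kappa c u v u1 v1 L tau xm x by exact: Rintegral_ge0.
have pD (x y : R) : t `^ x * t `^ y = t `^ (x + y).
  by rewrite powRD// (negbTE tn) implybT.
have pN (x : R) : (t `^ x)^-1 = t `^ (- x) by rewrite powRN.
have sL : apow s L = t `^ (a2 * s).
  by rewrite (apow_eq s (ltW L0)) (powRrM t a2 s).
pose A := 1 / 2 * \int[mu]_x n1 x.
pose B := 1 / 2 * \int[mu]_x (kappa * q x).
pose C := 1 / 2 * \int[mu]_x (g (q x) * q x).
pose D := - \int[mu]_x (g (q x) * J x).
have A0 : 0 < A by rewrite mulr_gt0 ?kinetic_gt0 ?divr_gt0.
have B0 : 0 <= B.
  by rewrite mulr_ge0 ?divr_ge0// Rintegral_ge0// => x _; rewrite mulr_ge0 ?density_ge0.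
have C0 : 0 <= C.
  rewrite mulr_ge0 ?divr_ge0// Rintegral_ge0// => x _.
  by rewrite mulr_ge0 ?density_ge0//; exact: gfun_ge0.
have K0' : (2 * alpha - beta) * A + (2 * alpha + beta) * B +
    ((2 * s + 2) * alpha + beta) * (c * C) - (2 * s + 2) * alpha * D = 0.
  rewrite -K0 /real_constraint /A /B /C /D.
  move: (\int[mu]_x n1 x) (\int[mu]_x (kappa * q x)) (\int[mu]_x (g (q x) * q x))
    (\int[mu]_x (g (q x) * J x)) => I1 I2 I3 I4.
  by field.
have := scaling_max s1 hab1 hab2 hbc A0 B0 C0 K0' t0.
have -> : A * t `^ (2 * alpha - beta) + B * t `^ (2 * alpha + beta) +
    c * C * t `^ ((2 * s + 2) * alpha + beta) - D * t `^ ((2 * s + 2) * alpha) =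
    Gam qt - Gam 0 + \int[mu]_x residual s kappa c u v u1 v1 L tau xm x.
  rewrite -E /A /B /C /D.
  move: (\int[mu]_x n1 x) (\int[mu]_x (kappa * q x)) (\int[mu]_x (g (q x) * q x))
    (\int[mu]_x (g (q x) * J x)) => I1 I2 I3 I4.
  have -> : t `^ (2 * alpha - beta) = L / tau by rewrite /L /tau pN pD.
  have -> : t `^ (2 * alpha + beta) = L * tau by rewrite /L /tau pD.
  have -> : t `^ ((2 * s + 2) * alpha + beta) = tau * L * apow s L.
    by rewrite sL /L /tau !pD; congr (_ `^ _); rewrite /a2; ring.
  have -> : t `^ ((2 * s + 2) * alpha) = L * apow s L.
    by rewrite sL /L pD; congr (_ `^ _); rewrite /a2; ring.
  by field; rewrite gt_eqF.
have -> : A + B + c * C - D = real_action u v u1 v1.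
  rewrite /real_action /A /B /C /D.
  move: (\int[mu]_x n1 x) (\int[mu]_x (kappa * q x)) (\int[mu]_x (g (q x) * q x))
    (\int[mu]_x (g (q x) * J x)) => I1 I2 I3 I4.
  by field.
move=> leS; split; first by apply: le_trans leS.1; rewrite lerDl.
(* The value [d] plus the residual is at most the action, which is now [d]: the residual integral
   vanishes, and the equality case of the scaling inequality forces [t = 1], hence [L = tau = 1]. *)
move=> SE; have I0 : \int[mu]_x residual s kappa c u v u1 v1 L tau xm x = 0.
  by apply/le_anti; rewrite R0 andbT; move: leS.1; rewrite SE; lra.
have t1 : t = 1 by apply/eqP; rewrite -leS.2 SE I0 addr0.
have L1 : L = 1 by rewrite /L t1 powR1.
have tau1 : tau = 1 by rewrite /tau t1 powR1.
move: Lm ir I0 r0; rewrite L1 tau1 mul1r => qmE ir I0 r0.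
exists xm; split => //; first by move=> x; rewrite -qmE.
apply: aeS (Rintegral_eq0_ae ir r0 I0) => x.
rewrite /residual /signed_sw !mul1r !divr1 => /eqP.
rewrite mulr1 mulf_eq0 invr_eq0 pnatr_eq0/= paddr_eq0 ?sqr_ge0// !sqrf_eq0 !subr_eq0.
by move=> /andP[/eqP -> /eqP ->].
Qed.

(** The sign jumps where [sw (q)] vanishes, which allows the function to be written as a difference
    of [sw (q)] at [min x xm] and at [max x xm], both continuous in [x]. *)
Lemma signed_sw_continuous xm : q xm = qt -> continuous (signed_sw s kappa c u v xm).
Proof.
move=> qm; have cq : continuous q by exact: ac_on_continuous (density_ac hE).
have csw : continuous sw by exact: swfun_continuous.
have swm : sw (q xm) = 0 by rewrite qm; exact: swfun_qtop.
have -> : signed_sw s kappa c u v xm = fun x =>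
    sw (q (Order.min x xm)) - sw (q (Order.max x xm)).
  apply/funext => x; rewrite /signed_sw /sgnx.
  by have [xlt|xge] := ltP x xm; rewrite swm ?subr0 ?sub0r ?mul1r ?mulN1r.
have cF (h : R -> R) : continuous h -> continuous (fun x => sw (q (h x))).
  by move=> ch; exact: cont_comp (cont_comp ch cq) csw.
have c1 : continuous (fun x : R => Order.min x xm).
  by move=> y; apply: (@continuous_min _ _ (fun x : R => x) (fun=> xm)); [exact: cvg_id|exact: cvg_cst].
have c2 : continuous (fun x : R => Order.max x xm).
  by move=> y; apply: (@continuous_max _ _ (fun x : R => x) (fun=> xm)); [exact: cvg_id|exact: cvg_cst].
by apply: contB; [exact: cF c1|exact: cF c2].
Qed.

Lemma kdens_integrable : intble setT (fun x => kdens s kappa c (q x)).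
Proof.
have := integrable_lin4 0 2 ((s + 2) * c) (- (2 * s + 2)) (kinetic_integrable hE)
  (mass_integrable k0 hE) (power_integrable s1 hE) (power2_integrable s1 hE).
by congr (_ .-integrable _ _); apply/funext => x /=; congr EFin; rewrite /kdens /wfun; ring.
Qed.

(* Along a solution of the first-order equation the constraint functional is
   [alpha / 2] times the integral of the second derivative of the density,
   computed formally. *)
Lemma constraint_kdens (h : R -> R) :
  (forall x, h x ^+ 2 = w (q x)) ->
  {ae mu, forall x, u1 x = h x * u x + g (q x) * v x /\
                    v1 x = h x * v x - g (q x) * u x} ->
  real_constraint u v u1 v1 = alpha * \int[mu]_x kdens s kappa c (q x).
Proof.
move=> h2 uv1.
rewrite /real_constraint -(Rintegral_lin4 _ _ _ _ (kinetic_integrable hE)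
  (mass_integrable k0 hE) (power_integrable s1 hE) (current_integrable s1 hE)).
rewrite -RintegralZl//; last exact: kdens_integrable.
have mi (f : R -> R) : intble setT f -> measurable_fun setT f.
  by move=> /measurable_int /measurable_EFinP.
apply: Rintegral_ae_eq.
- apply: mi; apply: integrable_lin4; [exact: kinetic_integrable hE|exact: mass_integrable hE|
    exact: power_integrable hE|exact: current_integrable hE].
- by apply: mi; apply: integrable_funZ; exact: kdens_integrable.
- apply: aeS uv1 => x [E1 E2].
  (* This equals [kappa q + c g q], so the terms in [beta] of the constraint cancel and [alpha]
     factors out. *)
  have -> : n1 x = (w (q x) + g (q x) ^+ 2) * q x.
    rewrite /kinetic E1 E2 -h2; move: (h x) (g (q x)) => H G.
    by rewrite /density; ring.
  have -> : J x = - (g (q x) * q x).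
    rewrite /current E1 E2; move: (h x) (g (q x)) => H G.
    by rewrite /density; ring.
  by rewrite /kdens /wfun; field.
Qed.

(** The almost everywhere equation from the equality case has a continuous right-hand side, so [u]
    and [v] are continuously differentiable and it holds everywhere. The constraint then equals
    [alpha] times a negative number times the length of the plateau, which must be 0. *)
Lemma minimizer_flow (Gam : R -> R) : (forall t : R, is_derive t 1 Gam (sw t)) ->
  real_constraint u v u1 v1 = 0 -> real_action u v u1 v1 = Gam qt - Gam 0 ->
  exists2 h, profile_flow s h u v & exists x0, forall x, q x = Q (x - x0).
Proof.
move=> dG K0 SE; have [_ /(_ SE)[xm [qm qle uv1]]] := variational dG K0.
set h := signed_sw s kappa c u v xm in uv1.
have ch : continuous h by exact: signed_sw_continuous.
have h2 x : h x ^+ 2 = w (q x).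
  rewrite /h /signed_sw exprMn (sqr_swfun s1 k0 hkc)// ?density_ge0//.
  by rewrite /sgnx; case: ifP => _; rewrite ?sqrrN expr1n mul1r.
have [au av _ _] := hE.
have cu : continuous u by exact: ac_on_continuous au.
have cv : continuous v by exact: ac_on_continuous av.
have cq : continuous q by exact: ac_on_continuous (density_ac hE).
have cgq : continuous (fun x => g (q x)).
  by apply: cont_comp cq _; exact: gfun_continuous.
have cU : continuous (fun x => h x * u x + g (q x) * v x).
  by apply: contD; exact: contM.
have cV : continuous (fun x => h x * v x - g (q x) * u x).
  by apply: contB; exact: contM.
have aU : ac_on u (fun x => h x * u x + g (q x) * v x).
  by apply: ac_on_ae (continuous_locint cU) _ au; apply: aeS uv1 => x [].
have aV : ac_on v (fun x => h x * v x - g (q x) * u x).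
  by apply: ac_on_ae (continuous_locint cV) _ av; apply: aeS uv1 => x [].
have flow : profile_flow s h u v.
  by split=> // x; split; [exact: ac_on_is_derive_continuous aU (cU x)|exact: ac_on_is_derive_continuous aV (cV x)].
exists h => //.
have [x1 [x2 [/andP[x1m xm2] Q2 Q1]]] := flow_plateau s1 k0 hkc flow qle qm
  (density_vanishing s1 hE) kdens_integrable.
have /eqP := K0; rewrite (constraint_kdens h2 uv1) mulf_eq0 gt_eqF//= => /eqP -> /esym /eqP.
rewrite mulf_eq0 (lt_eqF (kdens_qtop s1 k0 hkc))/= subr_eq0 => /eqP x12.
exists x2 => x; have [/Q2//|/ltW] := leP x2 x.
by rewrite x12 => /Q1.
Qed.

End OneState.

End Variational.

(** * The explicit profile: first integral, integrability, constraint and action *)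

Section ProfileFacts.
Context {R : realType}.
Variables (s kappa c : R).
Hypotheses (s1 : 1 <= s) (k0 : 0 <= kappa)
  (hkc : 0 < kappa \/ (kappa = 0 /\ 0 < c)).
Local Notation mu := (@lebesgue_measure R).
Local Notation intble A f := (mu.-integrable A (EFin \o f)).
Local Notation g := (gfun s).
Local Notation w := (wfun s kappa c).
Local Notation sw := (swfun s kappa c).
Local Notation qt := (qtop s kappa c).
Local Notation gt := (gtop kappa c).
Local Notation Q := (Qsol s kappa c).
Local Notation Y := (Ysol s kappa c).
Local Notation Y1 := (Ysol1 s kappa c).
Implicit Types (x y : R).

Let s0 : 0 < s. Proof. exact: lt_le_trans ltr01 s1. Qed.
Let s2 : 0 < 2 * s + 2. Proof. by rewrite addr_gt0 ?mulr_gt0. Qed.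
Let s10 : 0 < s + 1. Proof. by rewrite addr_gt0. Qed.
Let Y0 x : 0 < Y x. Proof. exact: Ysol_gt0. Qed.
Let Q0 x : 0 < Q x. Proof. exact: Qsol_gt0. Qed.
Let gt0 : 0 < gt. Proof. exact: gtop_gt0. Qed.
Let qt0 : 0 < qt. Proof. exact: qtop_gt0. Qed.

Lemma gfun_Qsol x : g (Q x) = (2 * s + 2)^-1 / Y x.
Proof.
have := powRN_gfun s (Q0 x); rewrite (powRN_Qsol s1 hkc) => <-.
by rewrite mulrAC mulfV ?gt_eqF// mul1r.
Qed.

(** The energy integral of the linear equation for [Ysol]. Its constant is read off at 0, where the
    derivative vanishes and [Ysol 0 = 1 / ((2 s + 2) gtop)]. *)
Lemma sqr_Ysol1 x : Y1 x ^+ 2 =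
  4 * s ^+ 2 * (kappa * Y x ^+ 2 + c * Y x / (2 * s + 2) - (2 * s + 2)^-1 ^+ 2).
Proof.
pose D x := Y1 x ^+ 2 - 4 * s ^+ 2 * (kappa * Y x ^+ 2 + c / (2 * s + 2) * Y x).
have dD (t : R) : is_derive t 1 D 0.
  have dY := der_Ysol s1 hkc t.
  apply: der_eq (derB (der_sqr (der_Ysol1 s1 hkc t)) (derZ _ (derD (derZ _ (der_sqr dY)) (derZ _ dY)))) _.
  rewrite exprMn sqr_sqrtr//; field.
  by rewrite (gt_eqF s2) (gt_eqF s10).
have : D x = D 0 by exact: is_derive_0_is_cst.
have : D 0 = - (4 * s ^+ 2 * (2 * s + 2)^-1 ^+ 2).
  rewrite /D (Ysol1_0 s kappa c).
  have G := gfun_Qsol 0; rewrite (Qsol_0 s1 k0 hkc) (gfun_qtop s1 hkc) in G.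
  have YE : Y 0 = (2 * s + 2)^-1 / gt.
    by rewrite G; field; rewrite (gt_eqF s2) (gt_eqF (Y0 0)).
  have kE : kappa = gt ^+ 2 - c * gt by rewrite (gtop_sqr c k0); ring.
  rewrite YE; move: gt gt0 kE => G' G0 kE; rewrite kE.
  by field; rewrite (gt_eqF s2) (gt_eqF G0).
move=> -> ; rewrite /D => E.
rewrite -[LHS](subrK (4 * s ^+ 2 * (kappa * Y x ^+ 2 + c / (2 * s + 2) * Y x))) E.
by ring.
Qed.

(** Half the logarithmic derivative of [Qsol], that is, the [h] of the first-order equation. *)
Definition profile_slope x : R := - Y1 x / (2 * s * Y x).
Local Notation H := profile_slope.

Lemma der_Qsol x : is_derive x 1 Q (2 * H x * Q x).
Proof.
apply: der_eq (der_comp (der_Ysol s1 hkc x) (is_derive1_powR (- s^-1) (Y0 x))) _.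
have -> : Y x `^ (- s^-1 - 1) = Q x / Y x.
  rewrite powRD; last by rewrite (gt_eqF (Y0 x)) implybT.
  by rewrite (powR_inv1 (ltW (Y0 x))).
by rewrite /H; field; rewrite (gt_eqF s0) (gt_eqF (Y0 x)).
Qed.

Lemma sqr_slope x : H x ^+ 2 = w (Q x).
Proof.
have -> : H x ^+ 2 = Y1 x ^+ 2 / (2 * s * Y x) ^+ 2 by rewrite /H expr_div_n sqrrN.
rewrite sqr_Ysol1 /wfun gfun_Qsol.
by field; rewrite (gt_eqF s0) (gt_eqF s2) (gt_eqF (Y0 x)).
Qed.

Lemma der_slope x :
  is_derive x 1 H (s * c * g (Q x) - 2 * s * g (Q x) ^+ 2).
Proof.
have dY := der_Ysol s1 hkc x; have Yn : 2 * s * Y x != 0.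
  by rewrite gt_eqF// !mulr_gt0.
apply: der_eq (derM (derN (der_Ysol1 s1 hkc x)) (derV (f := fun x => 2 * s * Y x) Yn (derZ _ dY))) _.
have H2 := sqr_slope x.
have -> : - Y1 x * - (2 * s * Y1 x / (2 * s * Y x) ^+ 2) = 2 * s * H x ^+ 2.
  by rewrite /H; field; rewrite (gt_eqF s0) (gt_eqF (Y0 x)).
have k2 : (2 * s * Num.sqrt kappa) ^+ 2 = 4 * s ^+ 2 * kappa.
  by rewrite exprMn (sqr_sqrtr k0); ring.
rewrite H2 /wfun gfun_Qsol k2; field.
by rewrite (gt_eqF s0) (gt_eqF s2) (gt_eqF s10) (gt_eqF (Y0 x)).
Qed.

Lemma slope_continuous : continuous H.
Proof. by move=> x; exact: is_derive1_continuous (der_slope x). Qed.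

(** [w (Q)] is the square of the slope, hence nonnegative, whereas [w] is negative beyond [qtop]. *)
Lemma Qsol_le x : Q x <= qt.
Proof.
rewrite leNgt; apply/negP => /(lt_gfun s1 (ltW qt0)); rewrite (gfun_qtop s1 hkc) => h.
have p : 0 < g (Q x) + kappa / gt.
  exact: ltr_wpDr (divr_ge0 k0 (ltW gt0)) (gfun_gt0 s1 (Q0 x)).
by have := sqr_ge0 (H x); rewrite sqr_slope (wfunE s k0 hkc) nmulr_rge0 ?subr_lt0// leNgt p.
Qed.

Lemma Ysol1_gt0 x : 0 < x -> 0 < Y1 x.
Proof.
move=> x0; rewrite /Ysol1; case: ifPn => [kp|kn].
  have k1 : 0 < 2 * s * Num.sqrt kappa by rewrite !mulr_gt0// sqrtr_gt0.
  have d0 : 0 < 4 * kappa * (s + 1) by rewrite !mulr_gt0.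
  have sq : 0 < Num.sqrt (c ^+ 2 + 4 * kappa).
    by rewrite sqrtr_gt0 ltr_wpDl ?sqr_ge0// mulr_gt0.
  apply: divr_gt0 d0; apply: mulr_gt0; first exact: mulr_gt0.
  rewrite divr_gt0// subr_gt0 ltr_expR -subr_gt0 opprK.
  by rewrite addr_gt0// mulr_gt0.
case: hkc => [kp|[_ c0]]; first by rewrite kp in kn.
by rewrite divr_gt0// !mulr_gt0// exprn_gt0.
Qed.

Lemma Ysol1N x : Y1 (- x) = - Y1 x.
Proof.
rewrite /Ysol1; case: ifP => _; first by rewrite mulrN opprK; ring.
by rewrite mulrN mulNr.
Qed.

Lemma Qsol_lt x : 0 < x -> Q x < qt.
Proof.
move=> x0; rewrite lt_neqAle Qsol_le andbT; apply/eqP => E.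
have := sqr_slope x; rewrite E (wfun_qtop s1 k0 hkc) => /eqP.
by rewrite sqrf_eq0 /H mulf_eq0 oppr_eq0 invr_eq0 (gt_eqF (Ysol1_gt0 x0)) !mulf_eq0
  pnatr_eq0 (gt_eqF s0) (gt_eqF (Y0 x)).
Qed.

Lemma Qsol_inj0 x : Q x = qt -> x = 0.
Proof.
move=> E; have [x0|x0|//] := ltgtP 0 x; first by have := Qsol_lt x0; rewrite E ltxx.
by have := @Qsol_lt (- x); rewrite oppr_gt0 QsolN E ltxx => /(_ x0).
Qed.

Lemma slope_signed x : H x = sgnx 0 x * sw (Q x).
Proof.
rewrite /swfun -sqr_slope sqrtr_sqr /sgnx; case: ltP => x0.
  rewrite mul1r ger0_norm// /H divr_ge0 ?mulr_ge0 ?(ltW s0) ?(ltW (Y0 x))//.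
  by rewrite -[x]opprK Ysol1N opprK ltW// Ysol1_gt0// oppr_gt0.
rewrite mulN1r ler0_norm ?opprK// /H mulNr oppr_le0 divr_ge0 ?mulr_ge0 ?(ltW s0) ?(ltW (Y0 x))//.
by move: x0; rewrite le_eqVlt => /predU1P[<-|/Ysol1_gt0/ltW//]; rewrite Ysol1_0.
Qed.

Lemma Qsol_continuous : continuous Q.
Proof. by move=> x; exact: is_derive1_continuous (der_Qsol x). Qed.

Let cgQ : continuous (fun x => g (Q x)). Proof. exact: gQ_continuous. Qed.

Let cpot : continuous (fun x => (g (Q x) + kappa / gt) * Q x).
Proof.
by apply: contM Qsol_continuous; apply: contD cgQ _ => x; exact: cvg_cst.
Qed.

(** The integrand is [|Q'|]. As [Q] rises up to 0 and falls afterwards, gluing [Q] and [2 qt - Q] at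
    0 gives a bounded primitive. *)
Lemma speed_Qsol_integrable : intble setT (fun x => 2 * sw (Q x) * Q x).
Proof.
have csw : continuous sw by exact: swfun_continuous.
have cHQ : continuous (fun x => 2 * H x * Q x).
  by apply: contM Qsol_continuous; apply: contZ slope_continuous.
have aQ : ac_on Q (fun x => 2 * H x * Q x) by exact: ac_on_FTC cHQ der_Qsol.
have aF := ac_on_glue (c := 0) aQ (ac_onD (ac_on_cst (2 * qt)) (ac_onN aQ)).
have {}aF := aF _; rewrite (Qsol_0 s1 k0 hkc) in aF.
have /aF {}aF : qt = 2 * qt + - qt by ring.
apply: (integrable_bounded_primitive (C := 2 * qt)).
- apply: ac_on_ae aF.
    apply: continuous_locint; apply: contM Qsol_continuous; apply: contZ.
    exact: cont_comp Qsol_continuous csw.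
  by apply: aeW => x; rewrite slope_signed /sgnx; case: (ltP x 0) => _; ring.
- by move=> x; rewrite !mulr_ge0 ?sqrtr_ge0 ?(ltW (Q0 x)).
- move=> x; have := Q0 x; have := Qsol_le x; case: ifP => _ h1 h2.
    by rewrite gtr0_norm//; lra.
  by rewrite ger0_norm; lra.
Qed.

(** This one function controls both [kappa Q] and [g(Q) Q]. For [|x| >= 1] the factor [gtop - g(Q)]
    of [w] is at least [d], so [(g + kappa / gtop)^2 <= (B / d) w] and the integrand is at most a
    multiple of [|Q'|]. For [|x| < 1] it is bounded, and the derivative of [atan] serves as the
    dominating function. Exponential and algebraic decay are thus treated alike. *)
Lemma potential_Qsol_integrable : intble setT (fun x => (g (Q x) + kappa / gt) * Q x).
Proof.
have g0 x : 0 <= g (Q x) by exact: gfun_ge0.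
have kg : 0 <= kappa / gt by rewrite divr_ge0 ?(ltW gt0).
pose B := gt + kappa / gt; have B0 : 0 < B by rewrite ltr_wpDr.
pose d := gt - g (Q 1).
have d0 : 0 < d by rewrite subr_gt0 -(gfun_qtop s1 hkc) lt_gfun ?(ltW (Q0 1))// Qsol_lt.
have g_le x : g (Q x) <= gt.
  by rewrite -(gfun_qtop s1 hkc) le_gfun ?(ltW (Q0 x))// Qsol_le.
have mono x : 1 <= x -> Q x <= Q 1.
  apply: (@nonincreasing_ray _ Q _ 1 Qsol_continuous (fun x _ => der_Qsol x)) => // y y1.
  have y0 : 0 < y by exact: lt_trans y1.
  rewrite slope_signed /sgnx ltNge (ltW y0)/= mulN1r mulrN mulNr oppr_le0.
  by rewrite !mulr_ge0 ?sqrtr_ge0 ?(ltW (Q0 y)).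
have far x : 1 <= `|x| -> d <= gt - g (Q x).
  move=> x1; rewrite lerD2l lerN2; apply: le_gfun => //; first exact: ltW.
  by have [h|h] := lerP 0 x; [rewrite ger0_norm// in x1|rewrite ltr0_norm// in x1; rewrite -QsolN]; exact: mono.
apply: (@continuous_integrable_le _ _ (fun x =>
    Num.sqrt (B / d) * (2 * sw (Q x) * Q x) + 2 * B * qt * (1 + x ^+ 2)^-1)).
- exact: cpot.
- move=> x; have a0 : 0 <= g (Q x) + kappa / gt by rewrite addr_ge0.
  have aB : g (Q x) + kappa / gt <= B by rewrite lerD2r.
  have x20 : 0 < 1 + x ^+ 2 by rewrite ltr_wpDr ?sqr_ge0.
  have X0 : 0 <= Num.sqrt (B / d) * (2 * sw (Q x) * Q x).
    by rewrite !mulr_ge0 ?sqrtr_ge0 ?(ltW (Q0 x)).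
  have Z0 : 0 <= 2 * B * qt * (1 + x ^+ 2)^-1.
    by rewrite !mulr_ge0 ?invr_ge0 ?(ltW x20) ?(ltW B0) ?(ltW qt0).
  rewrite ger0_norm ?mulr_ge0 ?(ltW (Q0 x))//.
  have [x1|x1] := leP 1 `|x|.
    apply: ler_wpDr => //; rewrite mulrA ler_wpM2r ?(ltW (Q0 x))//.
    have h : g (Q x) + kappa / gt <= Num.sqrt (B / d) * sw (Q x).
      have Bd : 0 <= B / d by rewrite divr_ge0 ?(ltW B0) ?(ltW d0).
      rewrite -(sqrtrM _ Bd) -(ger0_norm a0) -sqrtr_sqr; apply: ler_wsqrtr.
      rewrite (wfunE s k0 hkc) expr2 mulrA ler_wpM2r//.
      apply: (le_trans aB); rewrite mulrAC (ler_pdivlMr _ _ d0).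
      exact: (ler_wpM2l (ltW B0) (far _ x1)).
    apply: (le_trans h); rewrite mulrCA ler_peMl ?mulr_ge0 ?sqrtr_ge0//.
    by rewrite ler1n.
  apply: ler_wpDl => //; apply: (@le_trans _ _ (B * qt)).
    by apply: ler_pM => //; [exact: ltW|exact: Qsol_le].
  have x21 : x ^+ 2 <= 1 by rewrite -real_normK ?num_real// expr_le1// ltW.
  have -> : 2 * B * qt = B * qt * 2 by ring.
  rewrite (ler_pdivlMr _ _ x20); apply: ler_wpM2l; last by lra.
  by rewrite mulr_ge0 ?(ltW B0) ?(ltW qt0).
- apply: integrable_funD; first exact/integrable_funZ/speed_Qsol_integrable.
  apply: integrable_funZ.
  apply: (integrable_bounded_primitive (F := @atan R) (C := pi / 2)).
  + apply: ac_on_FTC.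
    move=> x; have x20 : 1 + x ^+ 2 != 0 :> R by rewrite gt_eqF// ltr_wpDr ?sqr_ge0.
    apply: cvgV => //; apply: cvgD; first exact: cvg_cst.
    by apply: (is_derive1_continuous (der_sqr (der_id x))).
  + by move=> x; rewrite invr_ge0 addr_ge0 ?sqr_ge0.
  + by move=> x; rewrite ler_norml (ltW (atan_gtNpi2 x)) (ltW (atan_ltpi2 x)).
Qed.

Section FlowProfile.
Variables (h u v : R -> R) (x0 : R).
Hypotheses (flow : profile_flow s h u v)
  (qQ : forall x, density u v x = Q (x - x0)).
Local Notation q := (density u v).
Let u1 x := h x * u x + g (q x) * v x.
Let v1 x := h x * v x - g (q x) * u x.
Local Notation n1 := (kinetic u1 v1).

Let dsh x : is_derive x 1 (fun x => x - x0) 1.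
Proof. by apply: der_eq (derB (der_id x) (der_cst x x0)) _; rewrite subr0. Qed.

Lemma flow_slope x : h x = H (x - x0).
Proof.
have d1 := der_density x flow.
have : is_derive x 1 q (2 * H (x - x0) * Q (x - x0)).
  have -> : q = fun x => Q (x - x0) by apply/funext.
  by apply: der_eq (der_comp (dsh x) (der_Qsol _)) _; rewrite mulr1.
move=> [_ d2]; case: d1 => _; rewrite d2 qQ => /(mulIf (lt0r_neq0 (Q0 _))) E.
by apply: (mulfI (x := 2)); rewrite ?pnatr_eq0.
Qed.

Let h2 x : h x ^+ 2 = w (q x). Proof. by rewrite flow_slope qQ sqr_slope. Qed.

Lemma flow_kinetic x : n1 x = (kappa + c * g (q x)) * q x.
Proof.
transitivity ((h x ^+ 2 + g (q x) ^+ 2) * q x).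
  rewrite /kinetic /u1 /v1; move: (h x) (g (q x)) => X G.
  by rewrite /density; ring.
by rewrite h2 /wfun; ring.
Qed.

Lemma der_flow_slope x :
  is_derive x 1 h (s * c * g (q x) - 2 * s * g (q x) ^+ 2).
Proof.
have -> : h = fun x => H (x - x0) by apply/funext => y; rewrite flow_slope.
by rewrite qQ; apply: der_eq (der_comp (dsh x) (der_slope _)) _; rewrite mulr1.
Qed.

(* [psi'' = kappa psi + (c/2) |psi|^(2s) psi - i |psi|^(2s) psi'] for
   [psi = u + i v]; note that [g = |psi|^(2s) / (2s+2)]. *)
Definition second_order (u v u1 v1 : R -> R) := forall x,
  [/\ is_derive x 1 u (u1 x), is_derive x 1 v (v1 x),
    is_derive x 1 u1 (kappa * u x + (s + 1) * c * g (density u v x) * u x +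
      (2 * s + 2) * g (density u v x) * v1 x) &
    is_derive x 1 v1 (kappa * v x + (s + 1) * c * g (density u v x) * v x -
      (2 * s + 2) * g (density u v x) * u1 x)].

Let q0 x : 0 < q x. Proof. by rewrite qQ. Qed.

Lemma flow_second_order : second_order u v u1 v1.
Proof.
move=> x; have [_ /(_ x)[du dv]] := flow.
have dh := der_flow_slope x.
have dg : is_derive x 1 (fun x => g (q x)) (2 * s * h x * g (q x)).
  apply: der_eq (der_comp (der_density x flow) (der_gfun s1 (q0 x))) _.
  by field; rewrite gt_eqF.
split => //.
- apply: der_eq (derD (derM dh du) (derM dg dv)) _.
  have kE : kappa = h x ^+ 2 - c * g (q x) + g (q x) ^+ 2 by rewrite h2 /wfun; ring.
  by rewrite /v1 kE; ring.
- apply: der_eq (derB (derM dh dv) (derM dg du)) _.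
  have kE : kappa = h x ^+ 2 - c * g (q x) + g (q x) ^+ 2 by rewrite h2 /wfun; ring.
  by rewrite /u1 kE; ring.
Qed.

(** A nonnegative integrable continuous function has a bounded primitive, and its translate inherits
    one. *)
Let shift_integrable (f : R -> R) : continuous f -> (forall x, 0 <= f x) ->
  intble setT f -> intble setT (fun x => f (x - x0)).
Proof.
move=> cf f0 i_f; have [F dF] := continuous_primitive cf.
have aF : ac_on F f by exact: ac_on_FTC.
pose I := \int[mu]_x f x.
have bound x y : x <= y -> 0 <= F y - F x <= I.
  move=> xy; rewrite (aF.2 _ _ xy) Rintegral_ge0//= /I; apply: fine_le.
  - by apply: integrable_fin_num => //; exact: integrableS i_f.
  - by apply: integrable_fin_num.
  - apply: ge0_subset_integral => //; first exact: measurable_int i_f.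
    by move=> t _; rewrite lee_fin.
have csh : continuous (fun x => f (x - x0)) by exact: cont_shift.
apply: (integrable_bounded_primitive (F := fun x => F (x - x0) - F 0) (C := I)) => //.
- apply: ac_on_FTC => // x.
  by apply: der_eq (derB (der_comp (dsh x) (dF _)) (der_cst x (F 0))) _; rewrite mulr1 subr0.
- move=> x; have [h0|h0] := leP 0 (x - x0).
    by have /andP[a b] := bound _ _ h0; rewrite ger0_norm.
  by have /andP[a b] := bound _ _ (ltW h0); rewrite ler0_norm; lra.
Qed.

Let cq : continuous q.
Proof. by move=> x; exact: is_derive1_continuous (der_density x flow). Qed.

Let cgq : continuous (fun x => g (q x)).
Proof. by apply: cont_comp cq _; exact: gfun_continuous. Qed.

Let pot_integrable : intble setT (fun x => (g (q x) + kappa / gt) * q x).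
Proof.
have -> : (fun x => (g (q x) + kappa / gt) * q x) =
    (fun y => (fun x => (g (Q x) + kappa / gt) * Q x) (y - x0)).
  by apply/funext => x; rewrite qQ.
apply: shift_integrable potential_Qsol_integrable.
- exact: cpot.
- move=> x; apply: mulr_ge0; last exact: ltW.
  by apply: addr_ge0; [exact: gfun_ge0|exact: divr_ge0 k0 (ltW gt0)].
Qed.

Let gq_integrable : intble setT (fun x => g (q x) * q x).
Proof.
apply: continuous_integrable_le pot_integrable.
  exact: contM.
move=> x; rewrite ger0_norm; last exact: mulr_ge0 (gfun_ge0 s1 _) (ltW (q0 x)).
by rewrite (ler_wpM2r (ltW (q0 x)))// lerDl divr_ge0// ltW.
Qed.

Let kq_integrable : intble setT (fun x => kappa * q x).
Proof.
have := integrable_funZ gt pot_integrable.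
apply: continuous_integrable_le; first exact: contZ.
move=> x; rewrite ger0_norm; last exact: mulr_ge0 k0 (ltW (q0 x)).
have -> : gt * ((g (q x) + kappa / gt) * q x) = gt * g (q x) * q x + kappa * q x.
  by field; rewrite (gt_eqF gt0).
by rewrite lerDr mulr_ge0 ?(ltW (q0 x))//; exact: mulr_ge0 (ltW gt0) (gfun_ge0 s1 _).
Qed.

Lemma flow_energy_space : energy_space s kappa u v u1 v1.
Proof.
have so := flow_second_order; split.
- apply: ac_on_FTC => x; last by case: (so x).
  by case: (so x) => _ _ d _; exact: is_derive1_continuous d.
- apply: ac_on_FTC => x; last by case: (so x).
  by case: (so x) => _ _ _ d; exact: is_derive1_continuous d.
- have -> : (fun x => u1 x ^+ 2 + v1 x ^+ 2) = (fun x => kappa * q x + c * (g (q x) * q x)).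
    by apply/funext => x; rewrite -[LHS]/(n1 x) flow_kinetic; ring.
  by apply: integrable_funD kq_integrable _; exact: integrable_funZ.
- case: ifPn => [kp|_].
    have -> : (fun x => apow 1 (u x ^+ 2 + v x ^+ 2)) = (fun x => kappa^-1 * (kappa * q x)).
      apply/funext => x; rewrite apow1 ger0_norm ?(ltW (q0 x))//.
      by rewrite mulrA mulVf ?gt_eqF// mul1r.
    exact: integrable_funZ.
  have -> : (fun x => apow (s + 1) (u x ^+ 2 + v x ^+ 2)) =
      (fun x => (2 * s + 2) * (g (q x) * q x)).
    apply/funext => x; rewrite apowD ?(ltW s0)// apow1 ger0_norm ?(ltW (q0 x))//.
    by rewrite -/(q x) mulrA /gfun [_ / _]mulrC mulrA mulfV ?gt_eqF// mul1r.
  exact: integrable_funZ.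
Qed.

Let hE := flow_energy_space.

Let signed_flow : profile_flow s (signed_sw s kappa c u v x0) u v.
Proof.
have <- : h = signed_sw s kappa c u v x0 => //.
apply/funext => x; rewrite flow_slope slope_signed /signed_sw qQ /sgnx.
by rewrite subr_lt0.
Qed.

Let uv1 : {ae mu, forall x, u1 x = h x * u x + g (q x) * v x /\
                            v1 x = h x * v x - g (q x) * u x}.
Proof. exact: aeW. Qed.

Let q_le x : q x <= qt. Proof. by rewrite qQ Qsol_le. Qed.

Let q_x0 : q x0 = qt. Proof. by rewrite qQ subrr Qsol_0. Qed.

(** [Qsol] reaches [qtop] only at 0, so both ends of the plateau coincide with [x0] and its
    contribution is 0. *)
Lemma flow_constraint alpha beta : real_constraint s kappa c alpha beta u v u1 v1 = 0.
Proof.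
rewrite (constraint_kdens _ _ s1 k0 hE h2 uv1).
have [x1 [x2 [/andP[x1x xx2] Q2 Q1 ->]]] := flow_plateau s1 k0 hkc signed_flow
  q_le q_x0 (density_vanishing s1 hE) (kdens_integrable c s1 k0 hE).
have E x : (x = x2 \/ x = x1) -> x = x0.
  move=> xE; apply/eqP; rewrite -subr_eq0; apply/eqP/Qsol_inj0; rewrite -qQ.
  by case: xE => ->; [rewrite Q2|rewrite Q1]; rewrite // subrr Qsol_0.
by rewrite (E x2 (or_introl erefl)) (E x1 (or_intror erefl)) subrr !mulr0.
Qed.

(** At [L = tau = 1] the residual of an exact solution vanishes identically, so Bogomolny's identity
    gives the value. *)
Lemma flow_action (Gam : R -> R) : (forall t : R, is_derive t 1 Gam (sw t)) ->
  real_action s kappa c u v u1 v1 = Gam qt - Gam 0.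
Proof.
move=> dG; have qm x : q x <= q x0 by rewrite q_x0.
have Lm : 1 * q x0 = qt by rewrite mul1r.
have [_] := bogomolny s1 k0 hkc hE dG ltr01 ltr01 qm Lm.
have -> : \int[mu]_x residual s kappa c u v u1 v1 1 1 x0 x = 0.
  transitivity (\int[mu]_x (fun=> 0 : R) x).
    apply: eq_Rintegral => x _; rewrite /residual !mul1r !divr1 /u1 /v1.
    have -> : sgnx x0 x * sw (q x) = h x.
      by rewrite flow_slope slope_signed qQ /sgnx subr_lt0.
    by rewrite !subrr expr0n/= addr0 mulr0.
  by rewrite Rintegral_cst// mul0r.
rewrite addr0 => <-; rewrite /real_action.
have -> : apow s 1 = 1 :> R by rewrite apow_eq// powR1.
move: (\int[mu]_x n1 x) (\int[mu]_x (kappa * q x)) (\int[mu]_x (g (q x) * q x))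
    (\int[mu]_x (g (q x) * current u v u1 v1 x)) => I1 I2 I3 I4.
by field.
Qed.

End FlowProfile.

Lemma wave_flow (T : R -> R) (theta x0 : R) :
  (forall x, is_derive x 1 T (g (Q x))) ->
  let u x := Num.sqrt (Q (x - x0)) * cos (theta - T (x - x0)) in
  let v x := Num.sqrt (Q (x - x0)) * sin (theta - T (x - x0)) in
  profile_flow s (fun x => H (x - x0)) u v /\ forall x, density u v x = Q (x - x0).
Proof.
move=> dT u v.
have qE x : density u v x = Q (x - x0).
  rewrite /density /u /v !exprMn -mulrDr cos2Dsin2 mulr1 sqr_sqrtr//.
  exact: ltW.
split=> //; split.
  by apply: cont_shift; exact: slope_continuous.
move=> x; rewrite qE.
have dsh : is_derive x 1 (fun x : R => x - x0) 1.
  by apply: der_eq (derB (der_id x) (der_cst x x0)) _; rewrite subr0.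
have dr : is_derive x 1 (fun x => Num.sqrt (Q (x - x0))) (H (x - x0) * Num.sqrt (Q (x - x0))).
  apply: der_eq (der_comp dsh (der_comp (der_Qsol _) (is_derive1_sqrt (Q0 _)))) _.
  rewrite mulr1 -{2}[Q _](sqr_sqrtr (ltW (Q0 (x - x0)))); field.
  by rewrite gt_eqF// sqrtr_gt0.
have dt : is_derive x 1 (fun x => theta - T (x - x0)) (- g (Q (x - x0))).
  by apply: der_eq (derB (der_cst x theta) (der_comp dsh (dT _))) _; rewrite mulr1 sub0r.
split.
  by apply: der_eq (derM dr (der_comp dt (is_derive_cos _))) _; rewrite /u /v; ring.
by apply: der_eq (derM dr (der_comp dt (is_derive_sin _))) _; rewrite /u /v; ring.
Qed.

End ProfileFacts.

(** * Critical points *)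

Section Critical.
Context {R : realType}.
Variables (s kappa c : R).
Hypotheses (s1 : 1 <= s) (k0 : 0 <= kappa)
  (hkc : 0 < kappa \/ (kappa = 0 /\ 0 < c)).
Local Notation mu := (@lebesgue_measure R).
Local Notation intble A f := (mu.-integrable A (EFin \o f)).
Local Notation g := (gfun s).
Local Notation w := (wfun s kappa c).
Local Notation qt := (qtop s kappa c).
Local Notation Q := (Qsol s kappa c).
Local Notation Y := (Ysol s kappa c).
Local Notation Y1 := (Ysol1 s kappa c).
Implicit Types (x y : R).

Let s0 : 0 < s. Proof. exact: lt_le_trans ltr01 s1. Qed.
Let s2 : 0 < 2 * s + 2. Proof. by rewrite addr_gt0 ?mulr_gt0. Qed.

Variables (u v u1 v1 : R -> R).
Hypotheses (hE : energy_space s kappa u v u1 v1)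
  (so : second_order s kappa c u v u1 v1) (nz : exists x, density u v x != 0).
Local Notation q := (density u v).
Local Notation J := (current u v u1 v1).
Local Notation n1 := (kinetic u1 v1).
Let p x := u x * u1 x + v x * v1 x.

Let dq x : is_derive x 1 q (2 * p x).
Proof.
have [du dv _ _] := so x.
by apply: der_eq (derD (der_sqr du) (der_sqr dv)) _; rewrite /p; ring.
Qed.

Let dgq x : is_derive x 1 (fun x => g (q x) * q x) ((2 * s + 2) * g (q x) * p x).
Proof.
have d := der_comp (dq x) (derZ (2 * s + 2)^-1 (der_apow (q x) (ltW s0))).
have -> : (fun x => g (q x) * q x) =
    (fun x => (2 * s + 2)^-1 * (q x * apow s (q x))).
  by apply/funext => y; rewrite /gfun; ring.
by apply: der_eq d _; rewrite /gfun; field; rewrite gt_eqF.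
Qed.

Let q_ge0 x : 0 <= q x. Proof. exact: density_ge0. Qed.

Let cq : continuous q.
Proof. by move=> x; exact: is_derive1_continuous (dq x). Qed.

Let cst_small (k : R) : (forall e : R, 0 < e -> `|k| <= e) -> k = 0.
Proof.
move=> h; apply/eqP; rewrite -normr_le0 leNgt; apply/negP => k1.
have := h (`|k| / 2); rewrite divr_gt0// => /(_ isT); lra.
Qed.

(* First integral of the second-order equation; its constant vanishes by
   integrability. *)
Lemma critical_kinetic x : n1 x = kappa * q x + c * (g (q x) * q x).
Proof.
pose D x := n1 x - (kappa * q x + c * (g (q x) * q x)).
have dD (t : R) : is_derive t 1 D 0.
  have [_ _ du1 dv1] := so t.
  apply: der_eq (derB (derD (der_sqr du1) (der_sqr dv1)) (derD (derZ kappa (dq t)) (derZ c (dgq t)))) _.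
  by rewrite /p; ring.
have Dc y : D y = D x by exact: is_derive_0_is_cst.
suff : D x = 0 by rewrite /D => /eqP; rewrite subr_eq0 => /eqP.
have iD : intble setT (fun y => `|D y|).
  apply: integrable_norm.
  have := integrable_lin4 1 (- 1) (- c) 0 (kinetic_integrable hE)
    (mass_integrable k0 hE) (power_integrable s1 hE) (power2_integrable s1 hE).
  by congr (_ .-integrable _ _); apply/funext => y /=; congr EFin; rewrite /D; ring.
apply: cst_small => e e0.
have [[y _ h] _] := integrable_small 0 (fun y => normr_ge0 (D y)) iD e0.
by rewrite -(Dc y).
Qed.

Let gq_bounded : exists2 M, 0 <= M & forall x, g (q x) <= M.
Proof.
have [x0 h] := density_max s1 hE; exists (g (q x0)); first exact: gfun_ge0.
by move=> x; exact: le_gfun.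
Qed.

Let n1_bounded : exists2 C, 0 <= C & forall x, n1 x <= C * q x.
Proof.
have [M M0 HM] := gq_bounded; exists (kappa + `|c| * M).
  by rewrite addr_ge0// mulr_ge0.
move=> x; rewrite critical_kinetic mulrA -mulrDl; apply: ler_wpM2r => //.
rewrite lerD2l (le_trans (ler_norm _))// normrM ler_wpM2l//.
by rewrite ger0_norm//; exact: gfun_ge0.
Qed.

Let J_bound x : `|J x| <= q x + n1 x.
Proof.
rewrite /current /density /kinetic ler_norml.
have := sqr_ge0 (u x - v1 x); have := sqr_ge0 (u x + v1 x).
have := sqr_ge0 (v x - u1 x); have := sqr_ge0 (v x + u1 x).
have := sqr_ge0 (u x); have := sqr_ge0 (v x); have := sqr_ge0 (u1 x); have := sqr_ge0 (v1 x).
by move: (u x) (v x) (u1 x) (v1 x) => a b a1 b1; nra.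
Qed.

Let p_bound x : `|p x| <= q x + n1 x.
Proof.
rewrite /p /density /kinetic ler_norml.
have := sqr_ge0 (u x - u1 x); have := sqr_ge0 (u x + u1 x).
have := sqr_ge0 (v x - v1 x); have := sqr_ge0 (v x + v1 x).
have := sqr_ge0 (u x); have := sqr_ge0 (v x); have := sqr_ge0 (u1 x); have := sqr_ge0 (v1 x).
by move: (u x) (v x) (u1 x) (v1 x) => a b a1 b1; nra.
Qed.

(** The second first integral: [J + g q] has derivative 0. Both terms are bounded by a multiple of
    [q], the current through the bound on [n1], and [q] vanishes at infinity. *)
Lemma critical_current x : J x = - (g (q x) * q x).
Proof.
pose D x := J x + g (q x) * q x.
have dD (t : R) : is_derive t 1 D 0.
  have [du dv du1 dv1] := so t.
  apply: der_eq (derD (derB (derM du dv1) (derM dv du1)) (dgq t)) _.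
  by rewrite /p; ring.
have Dc y : D y = D x by exact: is_derive_0_is_cst.
suff : D x = 0 by rewrite /D => /eqP; rewrite addr_eq0 => /eqP.
have [C C0 HC] := n1_bounded; have [M M0 HM] := gq_bounded.
have B0 : 0 < 1 + C + M by lra.
apply: cst_small => e e0.
have d0 : 0 < e / (1 + C + M) by rewrite divr_gt0.
have [X X0 HX] := density_vanishing s1 hE d0.
have {}HX : q X <= e / (1 + C + M).
  by have := HX X; rewrite (ger0_norm X0) (ger0_norm (q_ge0 X)); apply.
rewrite -(Dc X) (le_trans (ler_normD _ _))//.
apply: (@le_trans _ _ ((1 + C + M) * q X)); last first.
  by rewrite mulrC -ler_pdivlMr.
have h1 := J_bound X; have h2 := HC X.
have h3 : `|g (q X) * q X| <= M * q X.
  rewrite ger0_norm; first exact: ler_wpM2r.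
  by apply: mulr_ge0 => //; exact: gfun_ge0.
by apply: (le_trans (lerD h1 h3)); rewrite !mulrDl mul1r lerD2r lerD2l.
Qed.

(** From [|q'| <= k q], the function [q e^(k t)] is nondecreasing and [q e^(-k t)] is nonincreasing,
    so positivity at one point propagates in both directions. *)
Let q_gt0 x : 0 < q x.
Proof.
have [x0 qx0] := nz.
have qp : 0 < q x0 by rewrite lt_neqAle eq_sym qx0 q_ge0.
have [C C0 HC] := n1_bounded; pose k := 2 * (1 + C).
have pk y : `|2 * p y| <= k * q y.
  rewrite normrM ger0_norm// /k -mulrA ler_pM2l//.
  by apply: (le_trans (p_bound y)); have := HC y; rewrite mulrDl mul1r; lra.
have de (e t : R) : is_derive t 1 (fun t => expR (e * k * t)) (e * k * expR (e * k * t)).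
  apply: der_eq (der_comp (derZ (e * k) (der_id t)) (is_derive_expR _)) _.
  by ring.
have [h|h] := leP x0 x.
  have cF : continuous (fun t => - (q t * expR (1 * k * t))).
    move=> t; apply: (is_derive1_continuous (derN (derM (dq t) (de 1 t)))).
  have := @nonincreasing_ray _ _ _ x0 cF (fun t _ => derN (derM (dq t) (de 1 t))).
  move=> /(_ _ x0 x (lexx _) h); rewrite lerN2 => H.
  rewrite -(pmulr_lgt0 _ (expR_gt0 (1 * k * x))); apply: lt_le_trans (H _).
    by rewrite mulr_gt0// expR_gt0.
  move=> t _; apply: (@le_trans _ _ (- ((2 * p t + k * q t) * expR (1 * k * t)))).
    by rewrite le_eqVlt; apply/orP; left; apply/eqP; ring.
  rewrite oppr_le0 mulr_ge0 ?expR_ge0//.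
  by have := pk t; rewrite ler_norml => /andP[]; lra.
have cF : continuous (fun t => q t * expR (-1 * k * t)).
  move=> t; apply: (is_derive1_continuous (derM (dq t) (de (-1) t))).
have := @nonincreasing_ray _ _ _ x cF (fun t _ => derM (dq t) (de (-1) t)).
move=> /(_ _ x x0 (lexx _) (ltW h)) => H.
rewrite -(pmulr_lgt0 _ (expR_gt0 (-1 * k * x))); apply: lt_le_trans (H _).
  by rewrite mulr_gt0// expR_gt0.
move=> t _; apply: (@le_trans _ _ ((2 * p t - k * q t) * expR (-1 * k * t))).
  by rewrite le_eqVlt; apply/orP; left; apply/eqP; ring.
rewrite mulr_le0_ge0 ?expR_ge0//.
by have := pk t; rewrite ler_norml => /andP[]; lra.
Qed.

Let h x := p x / q x.

Let dp x : is_derive x 1 p (kdens s kappa c (q x)).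
Proof.
have [du dv du1 dv1] := so x.
apply: der_eq (derD (derM du du1) (derM dv dv1)) _.
transitivity (n1 x + kappa * q x + (s + 1) * c * (g (q x) * q x) +
    (2 * s + 2) * g (q x) * J x).
  by rewrite /kinetic /current; move: (g (q x)) => G; rewrite /density; ring.
by rewrite critical_kinetic critical_current /kdens /wfun; ring.
Qed.

(** Lagrange's identity [p^2 + J^2 = q n1], with [J] and [n1] replaced through the two first
    integrals. *)
Let h2 x : h x ^+ 2 = w (q x).
Proof.
have : p x ^+ 2 + J x ^+ 2 = q x * n1 x.
  by rewrite /p /current /density /kinetic; ring.
rewrite critical_kinetic critical_current => E.
have -> : h x ^+ 2 = p x ^+ 2 / q x ^+ 2 by rewrite /h expr_div_n.
have -> : p x ^+ 2 = q x * (kappa * q x + c * (g (q x) * q x)) - (- (g (q x) * q x)) ^+ 2.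
  by rewrite -E; ring.
by rewrite /wfun; field; rewrite gt_eqF.
Qed.

Let dh x : is_derive x 1 h (s * c * g (q x) - 2 * s * g (q x) ^+ 2).
Proof.
apply: der_eq (derM (dp x) (derV (lt0r_neq0 (q_gt0 x)) (dq x))) _.
transitivity (- 2 * h x ^+ 2 + (q x)^-1 * kdens s kappa c (q x)).
  by rewrite /h; field; rewrite gt_eqF.
by rewrite h2 /kdens; field; rewrite gt_eqF.
Qed.

(** Where [psi] does not vanish, [psi' = ((p + i J) / q) psi], and here [J / q = - g(q)]. *)
Lemma critical_flow : profile_flow s h u v.
Proof.
split; first by move=> x; exact: is_derive1_continuous (dh x).
move=> x; have [du dv _ _] := so x; have qn := lt0r_neq0 (q_gt0 x).
have Jq : - (g (q x) * q x) / q x = - g (q x) by field.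
have uE : u1 x = h x * u x - (J x / q x) * v x.
  transitivity ((p x * u x - J x * v x) / q x); last by rewrite /h; field.
  by rewrite -[LHS](mulfK qn); congr (_ / _); rewrite /p /current /density; ring.
have vE : v1 x = h x * v x + (J x / q x) * u x.
  transitivity ((p x * v x + J x * u x) / q x); last by rewrite /h; field.
  by rewrite -[LHS](mulfK qn); congr (_ / _); rewrite /p /current /density; ring.
rewrite critical_current Jq in uE vE.
split; first by apply: der_eq du _; rewrite uE; ring.
by apply: der_eq dv _; rewrite vE; ring.
Qed.

(* The power [q^(-s)] solves the linear equation satisfied by [Ysol], with the
   same data at the maximum of [q]. *)
Lemma critical_density : exists x0, forall x, q x = Q (x - x0).
Proof.
have [xm hm] := density_max s1 hE; exists xm.
pose y x := q x `^ (- s); pose y1 x := - (2 * s * h x * y x).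
have dqh x := der_density x critical_flow.
have dy x : is_derive x 1 y (y1 x).
  apply: der_eq (der_comp (dqh x) (is_derive1_powR (- s) (q_gt0 x))) _.
  rewrite /y1 /y powRD; last by rewrite (gt_eqF (q_gt0 x)) implybT.
  by rewrite (powR_inv1 (ltW (q_gt0 x))); field; rewrite gt_eqF.
have gy x : g (q x) * y x = (2 * s + 2)^-1 by rewrite mulrC /y powRN_gfun.
have dy1 x : is_derive x 1 y1 ((2 * s * Num.sqrt kappa) ^+ 2 * y x + s ^+ 2 * c / (s + 1)).
  apply: der_eq (derN (derM (derZ (2 * s) (dh x)) (dy x))) _.
  transitivity (4 * s ^+ 2 * kappa * y x + 2 * s ^+ 2 * c * (g (q x) * y x)).
    have kE : kappa = h x ^+ 2 - c * g (q x) + g (q x) ^+ 2 by rewrite h2 /wfun; ring.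
    by rewrite kE /y1; ring.
  rewrite gy exprMn (sqr_sqrtr k0); field.
  by rewrite (gt_eqF s2) (gt_eqF (addr_gt0 s0 ltr01)).
(* At the maximum [q' = 2 h q] vanishes, so [w (q xm) = h^2 = 0] and [q xm = qtop]: the data of [y]
   at [xm] are those of [Ysol] at 0. *)
have hm0 : h xm = 0.
  have : is_derive xm 1 q 0.
    have I1 : xm - 1 <= xm + 1 by lra.
    have Im : xm \in `]xm - 1, xm + 1[ by rewrite in_itv/=; lra.
    have dm t : t \in `]xm - 1, xm + 1[ -> derivable q t 1 by case: (dq t).
    exact: (derive1_at_max I1 dm Im (fun t _ => hm t)).
  case=> _ E; case: (dqh xm) => _; rewrite E => E2.
  apply: (mulIf (lt0r_neq0 (q_gt0 xm))); rewrite mul0r.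
  by apply: (mulfI (x := 2)); rewrite ?pnatr_eq0// mulr0 mulrA.
have qmE : q xm = qt.
  by apply: (qtop_wfun s1 k0 hkc (q_gt0 xm)); rewrite -h2 hm0 expr0n.
have ym : y xm = Y 0 by rewrite /y qmE Ysol_0.
have y1m : y1 xm = 0 by rewrite /y1 hm0 mulr0 mul0r oppr0.
have sy (e : R) (t : R) : is_derive t 1 (fun t => xm + e * t) e.
  by apply: der_eq (derD (der_cst t xm) (derZ e (der_id t))) _; rewrite add0r mulr1.
(* The values [e = 1] and [e = -1] treat the half-lines after and before [xm] with the same
   uniqueness lemma on a ray. *)
have half (e : R) : e ^+ 2 = 1 -> forall t, 0 <= t -> y (xm + e * t) = Y t.
  move=> e2 t t0; apply/eqP; rewrite -subr_eq0; apply/eqP.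
  have dz (x : R) : is_derive x 1 (fun x => y (xm + e * x) - Y x) (e * y1 (xm + e * x) - Y1 x).
    by apply: der_eq (derB (der_comp (sy e x) (dy _)) (der_Ysol s1 hkc x)) _; ring.
  have dz1 (x : R) : is_derive x 1 (fun x => e * y1 (xm + e * x) - Y1 x)
      ((2 * s * Num.sqrt kappa) ^+ 2 * (y (xm + e * x) - Y x)).
    apply: der_eq (derB (derZ e (der_comp (sy e x) (dy1 _))) (der_Ysol1 s1 hkc x)) _.
    rewrite [e * (_ * e)]mulrCA -expr2 e2; ring.
  apply: (@linear_ray_unique _ _ _ _ 0 _ _ (fun x _ => dz x) (fun x _ => dz1 x) _ _ _ t0).
  - by move=> x; exact: is_derive1_continuous (dz x).
  - by move=> x; exact: is_derive1_continuous (dz1 x).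
  - by rewrite mulr0 addr0 ym subrr.
  - by rewrite mulr0 addr0 y1m mulr0 Ysol1_0 subrr.
move=> x; apply: powRN_eq_Qsol => //; rewrite -[LHS]/(y x).
have [xh|xh] := leP xm x.
  by rewrite -(half 1) ?expr1n ?subr_ge0// mul1r addrC subrK.
have e2 : (-1 : R) ^+ 2 = 1 by rewrite sqrrN expr1n.
rewrite -YsolN -(half (-1) e2); last by rewrite oppr_ge0 subr_le0 ltW.
by rewrite mulN1r opprK addrC subrK.
Qed.

End Critical.

(** * From distributions to real functions *)

Section ComplexParts.
Context {R : realType}.
Implicit Types (z w : R[i]).

Lemma ReMc z w : complex.Re (z * w) =
  complex.Re z * complex.Re w - complex.Im z * complex.Im w.
Proof. by case: z w => [? ?] [? ?]. Qed.

Lemma ImMc z w : complex.Im (z * w) =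
  complex.Re z * complex.Im w + complex.Im z * complex.Re w.
Proof. by case: z w => [? ?] [? ?]. Qed.

Lemma complex_ext z w : complex.Re z = complex.Re w ->
  complex.Im z = complex.Im w -> z = w.
Proof. by case: z w => [a b] [a' b'] /= -> ->. Qed.

Lemma cabs_powR p z :
  cabs z `^ p = apow (p / 2) (complex.Re z ^+ 2 + complex.Im z ^+ 2).
Proof.
have n0 : 0 <= complex.Re z ^+ 2 + complex.Im z ^+ 2 by rewrite addr_ge0 ?sqr_ge0.
rewrite apow_eq//; have -> : cabs z = Num.sqrt (complex.Re z ^+ 2 + complex.Im z ^+ 2).
  by case: z {n0}.
by rewrite -powR12_sqrt// -powRrM mulrC.
Qed.

End ComplexParts.

Section WeakDerivatives.
Context {R : realType}.
Local Notation mu := (@lebesgue_measure R).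
Local Notation intble A f := (mu.-integrable A (EFin \o f)).
Implicit Types (f g a b : R -> R) (psi phi : R -> R[i]).

Lemma locint_ae f g : measurable_fun setT g -> {ae mu, forall x, f x = g x} ->
  locally_integrable setT f -> locally_integrable setT g.
Proof.
move=> mg fg [mf oT If]; split=> // K KT cK; rewrite (le_lt_trans _ (If K KT cK))//.
rewrite le_eqVlt; apply/orP; left; apply/eqP; apply: ae_eq_integral => //.
- exact: compact_measurable.
- apply/measurable_EFinP; apply: measurableT_comp => //.
  exact: measurable_funS mg.
- apply/measurable_EFinP; apply: measurableT_comp => //.
  exact: measurable_funS mf.
- by apply: aeS fg => x /= -> _.
Qed.

Lemma ae_sym f g : {ae mu, forall x, f x = g x} -> {ae mu, forall x, g x = f x}.
Proof. by apply: aeS. Qed.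

Lemma real_weak_derivative_ae f f' g g' :
  measurable_fun setT f' -> measurable_fun setT g' ->
  {ae mu, forall x, f x = f' x} -> {ae mu, forall x, g x = g' x} ->
  real_weak_derivative f g -> real_weak_derivative f' g'.
Proof.
move=> mf' mg' ff gg [lf [lg D]]; split; first exact: locint_ae ff lf.
split; first exact: locint_ae gg lg.
move=> t tt; have [mf _ _] := lf; have [mg _ _] := lg.
have mt : measurable_fun setT t.
  by apply: continuous_measurable_fun; exact: test_function_continuous.
have mt1 : measurable_fun setT (derive1 t).
  by apply: continuous_measurable_fun; exact/test_function_continuous/test_function_derive.
have -> : \int[mu]_x (f' x * derive1 t x) = \int[mu]_x (f x * derive1 t x).
  apply: Rintegral_ae_eq; [exact: measurable_funM|exact: measurable_funM|].
  by apply: aeS ff => x ->.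
rewrite D//; congr (- _); apply: Rintegral_ae_eq; [exact: measurable_funM|exact: measurable_funM|].
by apply: aeS gg => x ->.
Qed.

(** A primitive of [f - g] is also a primitive of 0; by continuity its derivative at every point is
    given by both. *)
Lemma continuous_ae_eq f g : continuous f -> continuous g ->
  {ae mu, forall x, f x = g x} -> forall x, f x = g x.
Proof.
move=> cf cg fg x; apply/eqP; rewrite -subr_eq0; apply/eqP.
have cd : continuous (fun x => f x - g x) by exact: contB.
have [H dH] := continuous_primitive cd.
have aH : ac_on H (fun x => f x - g x) by exact: ac_on_FTC.
have aH0 : ac_on H (fun=> 0).
  apply: ac_on_ae aH; first by apply: continuous_locint => y; exact: cvg_cst.
  by apply: aeS fg => y ->; rewrite subrr.
have : is_derive x 1 H ((fun=> 0) x).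
  by apply: (ac_on_is_derive_continuous aH0); exact: cvg_cst.
by case=> _; case: (dH x) => _ ->.
Qed.

Lemma real_weak_derivative_unique f g g' : real_weak_derivative f g ->
  real_weak_derivative f g' -> {ae mu, forall x, g x = g' x}.
Proof.
move=> /weak_derivative_ac_on[F aF fF] /weak_derivative_ac_on[G aG fG].
have FG : F = G.
  apply/funext; apply: continuous_ae_eq; [exact: ac_on_continuous aF|exact: ac_on_continuous aG|].
  by apply: aeS (aeI fF fG) => x [<- <-].
by rewrite -FG in aG; exact: ac_on_ae_unique aF aG.
Qed.

Lemma pairingE psi f : pairing psi f =
  ((\int[mu]_x (complex.Re (psi x) * f x)) +i* (\int[mu]_x (complex.Im (psi x) * f x)))%C.
Proof.
rewrite /pairing /cintegral; congr (_ +i* _)%C; apply: eq_Rintegral => x _.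
  by rewrite ReMc/= mulr0 subr0.
by rewrite ImMc/= mulr0 add0r.
Qed.

Lemma is_weak_derivativeE psi phi : is_weak_derivative psi phi <->
  real_weak_derivative (fun x => complex.Re (psi x)) (fun x => complex.Re (phi x)) /\
  real_weak_derivative (fun x => complex.Im (psi x)) (fun x => complex.Im (phi x)).
Proof.
split=> [[[l1 l2] [[l3 l4] D]]|[[l1 [l3 D1]] [l2 [l4 D2]]]].
  by split; split=> //; split=> // f tf; have := D f tf; rewrite !pairingE => -[].
by split=> //; split=> // f tf; rewrite !pairingE D1// D2.
Qed.

(* [a + i b] is the continuous representative of [psi]. *)
Definition represents psi a b a1 b1 :=
  [/\ cmeasurable psi, {ae mu, forall x, psi x = (a x +i* b x)%C}, ac_on a a1 & ac_on b b1].

Lemma represents_parts psi a b a1 b1 : represents psi a b a1 b1 ->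
  {ae mu, forall x, complex.Re (psi x) = a x} /\ {ae mu, forall x, complex.Im (psi x) = b x}.
Proof. by move=> [_ pE _ _]; split; apply: aeS pE => x ->. Qed.

Lemma represents_weak psi a b a1 b1 : represents psi a b a1 b1 ->
  is_weak_derivative psi (fun x => (a1 x +i* b1 x)%C).
Proof.
move=> rp; have [rE iE] := represents_parts rp; have [[mr mi] _ aa ab] := rp.
apply/is_weak_derivativeE; split.
  apply: (real_weak_derivative_ae _ _ (ae_sym rE) _ (ac_on_weak_derivative aa)) => //.
    by case: aa => -[].
  exact: aeW.
apply: (real_weak_derivative_ae _ _ (ae_sym iE) _ (ac_on_weak_derivative ab)) => //.
  by case: ab => -[].
exact: aeW.
Qed.

Lemma weak_represents psi phi : cmeasurable psi -> is_weak_derivative psi phi ->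
  exists a b, represents psi a b (fun x => complex.Re (phi x)) (fun x => complex.Im (phi x)).
Proof.
move=> mp /is_weak_derivativeE[/weak_derivative_ac_on[a aa ra] /weak_derivative_ac_on[b ab rb]].
exists a, b; split=> //; apply: aeS (aeI ra rb) => x [E1 E2].
by apply: complex_ext; rewrite ?E1 ?E2.
Qed.

Lemma represents_weak_derivative psi a b a1 b1 : represents psi a b a1 b1 ->
  is_weak_derivative psi (weak_derivative psi).
Proof.
move=> /represents_weak wd.
by rewrite /weak_derivative; case: xgetP => [g -> //|/(_ _ wd)].
Qed.

Lemma weak_derivative_parts psi a b a1 b1 : represents psi a b a1 b1 ->
  [/\ cmeasurable (weak_derivative psi),
    {ae mu, forall x, complex.Re (weak_derivative psi x) = a1 x} &
    {ae mu, forall x, complex.Im (weak_derivative psi x) = b1 x}].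
Proof.
move=> rp; have /is_weak_derivativeE[r1 i1] := represents_weak_derivative rp.
have /is_weak_derivativeE[r2 i2] := represents_weak rp; split.
- by case: r1 => _ [[? _ _] _]; case: i1 => _ [[? _ _] _].
- exact: real_weak_derivative_unique r1 r2.
- exact: real_weak_derivative_unique i1 i2.
Qed.

Lemma cmeasurable_sqr psi : cmeasurable psi ->
  measurable_fun setT (fun x => complex.Re (psi x) ^+ 2 + complex.Im (psi x) ^+ 2).
Proof. by move=> [mr mi]; apply: measurable_funD; exact: measurable_funX. Qed.

Lemma cmeasurable_apow psi r : 0 < r -> cmeasurable psi ->
  measurable_fun setT (fun x => apow r (complex.Re (psi x) ^+ 2 + complex.Im (psi x) ^+ 2)).
Proof.
move=> r0 mp; apply: (@measurableT_comp _ _ _ _ _ _ (apow r)).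
  by apply: continuous_measurable_fun; exact: apow_continuous.
exact: cmeasurable_sqr.
Qed.

Let NormE psi p : 0 < p ->
  (\int[mu]_x (`|(EFin \o (fun x => cabs (psi x))) x| `^ p))%E =
  (\int[mu]_x (apow (p / 2) (complex.Re (psi x) ^+ 2 + complex.Im (psi x) ^+ 2))%:E)%E.
Proof.
move=> p0; apply: eq_integral => x _ /=.
have -> : `|cabs (psi x)| = cabs (psi x).
  by apply: ger0_norm; rewrite /cabs; case: (psi x) => y z; exact: sqrtr_ge0.
by rewrite cabs_powR.
Qed.

Lemma in_LpE p psi : 0 < p -> in_Lp p psi <-> cmeasurable psi /\
  intble setT (fun x => apow (p / 2) (complex.Re (psi x) ^+ 2 + complex.Im (psi x) ^+ 2)).
Proof.
move=> p0; have pn : p != 0 by rewrite gt_eqF.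
have E := poweR_Lnorm mu (EFin \o (fun x => cabs (psi x))) pn.
rewrite NormE// in E.
have abs : (\int[mu]_x `|(EFin \o (fun x => apow (p / 2) (complex.Re (psi x) ^+ 2 + complex.Im (psi x) ^+ 2))) x|)%E =
  (\int[mu]_x (apow (p / 2) (complex.Re (psi x) ^+ 2 + complex.Im (psi x) ^+ 2))%:E)%E.
  by apply: eq_integral => x _ /=; rewrite ger0_norm ?apow_ge0.
split=> [[mp fp]|[mp ip]]; split=> //.
  apply/integrableP; split.
    by apply/measurable_EFinP; apply: cmeasurable_apow => //; rewrite divr_gt0.
  by rewrite abs -E poweR_lty.
move/integrableP : ip => [_]; rewrite abs -E => h.
rewrite /finite_norm ltey; apply/eqP => h2; move: h.
by rewrite h2 poweRyr.
Qed.

Lemma Lpnorm_powR p psi : 0 < p -> in_Lp p psi -> Lpnorm p psi `^ p =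
  \int[mu]_x (apow (p / 2) (complex.Re (psi x) ^+ 2 + complex.Im (psi x) ^+ 2)).
Proof.
move=> p0 [mp fp]; have pn : p != 0 by rewrite gt_eqF.
have E := poweR_Lnorm mu (EFin \o (fun x => cabs (psi x))) pn.
rewrite NormE// in E.
rewrite /Rintegral -E /Lpnorm.
have := Lnorm_ge0 mu p%:E (EFin \o (fun x => cabs (psi x))); move: fp; rewrite /finite_norm.
by case: ('N[mu]_(p%:E)[_])%E.
Qed.

End WeakDerivatives.

Section Functionals.
Context {R : realType}.
Variables (s omega c : R).
Hypotheses (s1 : 1 <= s)
  (homega : c ^+ 2 / 4 < omega \/ (omega = c ^+ 2 / 4 /\ 0 < c)).
Local Notation mu := (@lebesgue_measure R).
Local Notation intble A f := (mu.-integrable A (EFin \o f)).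
Local Notation kappa := (omega - c ^+ 2 / 4).
Local Notation g := (gfun s).
Implicit Types (psi phi : R -> R[i]) (a b : R -> R).

Let s0 : 0 < s. Proof. exact: lt_le_trans ltr01 s1. Qed.
Let s2 : 0 < 2 * s + 2. Proof. by rewrite addr_gt0 ?mulr_gt0. Qed.

Lemma kappa_ge0 : 0 <= kappa.
Proof. by rewrite subr_ge0; case: homega => [/ltW//|[-> _]]. Qed.

Lemma kappa_cases : 0 < kappa \/ (kappa = 0 /\ 0 < c).
Proof. by case: homega => [h|[-> h]]; [left; rewrite subr_gt0|right; rewrite subrr]. Qed.

Lemma integrable_ae (f f' : R -> R) : measurable_fun setT f' ->
  {ae mu, forall x, f x = f' x} -> intble setT f -> intble setT f'.
Proof.
move=> mf' ff' /integrableP[mf If]; apply/integrableP; split.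
  exact/measurable_EFinP.
rewrite (le_lt_trans _ If)// le_eqVlt; apply/orP; left; apply/eqP.
apply: ae_eq_integral => //.
- by apply/measurable_EFinP; apply: measurableT_comp.
- by apply: measurableT_comp.
- by apply: aeS ff' => x /= -> _.
Qed.

Lemma powerE (q : R) : 0 <= q -> apow (s + 1) q = (2 * s + 2) * (g q * q).
Proof.
move=> q0; rewrite apowD ?(ltW s0)// apow1 ger0_norm// mulrA /gfun.
by rewrite [_ / _]mulrC mulrA mulfV ?gt_eqF// mul1r.
Qed.

Lemma represents_measurable psi a b a1 b1 : represents psi a b a1 b1 ->
  [/\ measurable_fun setT a, measurable_fun setT b, measurable_fun setT a1 &
      measurable_fun setT b1].
Proof.
move=> [_ _ aa ab]; split.
- by apply: continuous_measurable_fun; exact: ac_on_continuous aa.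
- by apply: continuous_measurable_fun; exact: ac_on_continuous ab.
- by case: aa => -[].
- by case: ab => -[].
Qed.

Lemma Lpnorm_ge0 p psi : 0 <= Lpnorm p psi.
Proof. by rewrite /Lpnorm fine_ge0// Lnorm_ge0. Qed.

Lemma in_X_energy psi : in_X s omega c psi -> exists a b a1 b1,
  represents psi a b a1 b1 /\ energy_space s kappa a b a1 b1.
Proof.
have r0 : 0 < (if c ^+ 2 / 4 < omega then 2 else 2 * s + 2 : R) by case: ifP.
have -> : in_X s omega c psi =
    (in_Lp (if c ^+ 2 / 4 < omega then 2 else 2 * s + 2 : R) psi /\ weak_derivative_in_L2 psi).
  by rewrite /in_X; case: ifP.
move=> [/(in_LpE _ r0)[mp ip] [phi [wd lp]]].
have [a [b rp]] := weak_represents mp wd.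
exists a, b, (fun x => complex.Re (phi x)), (fun x => complex.Im (phi x)).
split=> //; have [rE iE] := represents_parts rp.
have [ma mb _ _] := represents_measurable rp.
have [_ _ aa ab] := rp; split=> //.
  move/in_LpE : lp => -[//|_]; rewrite divff ?pnatr_eq0//.
  congr (_ .-integrable _ _); apply/funext => x /=; congr EFin.
  by rewrite apow1 ger0_norm// addr_ge0 ?sqr_ge0.
rewrite subr_gt0.
have -> : (if c ^+ 2 / 4 < omega then 1 else s + 1) =
    (if c ^+ 2 / 4 < omega then 2 else 2 * s + 2 : R) / 2.
  by case: ifP => _; field.
apply: integrable_ae ip; last by apply: aeS (aeI rE iE) => x [-> ->].
have r20 : 0 < (if c ^+ 2 / 4 < omega then 2 else 2 * s + 2 : R) / 2 by rewrite divr_gt0.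
apply: (@measurableT_comp _ _ _ _ _ _ (apow _)).
  by apply: continuous_measurable_fun; exact: apow_continuous.
by apply: measurable_funD; exact: measurable_funX.
Qed.

Section Represented.
Variables (psi : R -> R[i]) (a b a1 b1 : R -> R).
Hypotheses (rp : represents psi a b a1 b1) (hE : energy_space s kappa a b a1 b1).
Local Notation q := (density a b).

Let mp : cmeasurable psi. Proof. by case: rp. Qed.

Let q_ge0 x : 0 <= q x. Proof. exact: density_ge0. Qed.

Let qE : {ae mu, forall x, complex.Re (psi x) ^+ 2 + complex.Im (psi x) ^+ 2 = q x}.
Proof. by have [rE iE] := represents_parts rp; apply: aeS (aeI rE iE) => x [-> ->]. Qed.

Let apowE r : {ae mu, forall x,
  apow r (q x) = apow r (complex.Re (psi x) ^+ 2 + complex.Im (psi x) ^+ 2)}.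
Proof. by apply: aeS qE => x ->. Qed.

Let in_Lp_power r : 0 < r -> intble setT (fun x => apow (r / 2) (q x)) -> in_Lp r psi.
Proof.
move=> r0 iq; apply/in_LpE => //; split=> //.
by apply: integrable_ae (apowE _) iq; apply: cmeasurable_apow => //; rewrite divr_gt0.
Qed.

Lemma energy_in_X : in_X s omega c psi.
Proof.
have wd : weak_derivative_in_L2 psi.
  exists (fun x => (a1 x +i* b1 x)%C); split; first exact: represents_weak rp.
  have [_ _ ma1 mb1] := represents_measurable rp.
  apply/in_LpE => //; split=> //; rewrite divff ?pnatr_eq0//.
  have := kinetic_integrable hE; congr (_ .-integrable _ _); apply/funext => x /=.
  by congr EFin; rewrite apow1 ger0_norm// addr_ge0 ?sqr_ge0.
have [_ _ _] := hE; rewrite /in_X -[0 < kappa]/(0 < omega - _) subr_gt0.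
case: ifP => _ im; split=> //; apply: in_Lp_power => //.
  by rewrite divff ?pnatr_eq0.
by have -> : (2 * s + 2) / 2 = s + 1 by field.
Qed.

Let kineticE : Lpnorm 2 (weak_derivative psi) ^+ 2 = \int[mu]_x kinetic a1 b1 x.
Proof.
have [mw rE iE] := weak_derivative_parts rp.
have [_ _ ma1 mb1] := represents_measurable rp.
have mk : measurable_fun setT (kinetic a1 b1).
  by apply: measurable_funD; exact: measurable_funX.
have E : {ae mu, forall x, kinetic a1 b1 x =
   apow (2 / 2) (complex.Re (weak_derivative psi x) ^+ 2 + complex.Im (weak_derivative psi x) ^+ 2)}.
  apply: aeS (aeI rE iE) => x [-> ->].
  by rewrite divff ?pnatr_eq0// apow1 ger0_norm// addr_ge0 ?sqr_ge0.
have mw2 : measurable_fun setT (fun x => apow (2 / 2)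
    (complex.Re (weak_derivative psi x) ^+ 2 + complex.Im (weak_derivative psi x) ^+ 2)).
  by apply: cmeasurable_apow.
rewrite -(powR_mulrn 2 (Lpnorm_ge0 2 _)).
rewrite Lpnorm_powR//.
  by apply: Rintegral_ae_eq => //; exact: ae_sym.
apply/in_LpE => //; split=> //.
by apply: integrable_ae E _ => //; exact: kinetic_integrable hE.
Qed.

Let massE : kappa * Lpnorm 2 psi ^+ 2 = \int[mu]_x (kappa * q x).
Proof.
have [kp|kn] := ltP 0 kappa; last first.
  (* In the borderline case both sides are 0, even when [psi] is not in L^2 and [Lpnorm 2 psi] is
     only the real value assigned to an infinite norm. *)
  have k0 : kappa = 0 by apply/le_anti; rewrite kn kappa_ge0.
  rewrite k0 mul0r; transitivity (\int[mu]_x (fun=> 0 : R) x).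
    by rewrite Rintegral_cst// mul0r.
  by apply: eq_Rintegral => x _; rewrite mul0r.
have iq : intble setT (fun x => apow (2 / 2) (q x)).
  by case: hE => _ _ _; rewrite kp divff ?pnatr_eq0.
have q1 : (fun x => apow (2 / 2) (q x)) = q.
  by apply/funext => x; rewrite divff ?pnatr_eq0// apow1 ger0_norm.
rewrite -(powR_mulrn 2 (Lpnorm_ge0 2 _)).
rewrite (Lpnorm_powR _ (in_Lp_power _ iq))// RintegralZl//; last by rewrite -q1.
congr (_ * _); rewrite -[in RHS]q1; apply: Rintegral_ae_eq (ae_sym (apowE _)).
  exact: cmeasurable_apow.
by move/measurable_int : iq => /measurable_EFinP.
Qed.

Let powerE' : Lpnorm (2 * s + 2) psi `^ (2 * s + 2) =
  (2 * s + 2) * \int[mu]_x (g (q x) * q x).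
Proof.
have E2 : (2 * s + 2) / 2 = s + 1 by field.
have iq : intble setT (fun x => apow ((2 * s + 2) / 2) (q x)).
  rewrite E2; have := integrable_funZ (2 * s + 2) (power_integrable s1 hE).
  by congr (_ .-integrable _ _); apply/funext => x /=; rewrite powerE.
rewrite (Lpnorm_powR s2 (in_Lp_power s2 iq)) -RintegralZl//; last exact: power_integrable hE.
transitivity (\int[mu]_x apow ((2 * s + 2) / 2) (q x)).
  apply: Rintegral_ae_eq (ae_sym (apowE _)).
    by apply: cmeasurable_apow => //; rewrite E2 addr_gt0.
  by move/measurable_int : iq => /measurable_EFinP.
by apply: eq_Rintegral => x _; rewrite E2 powerE.
Qed.

(** The real part of [i conj(psi) psi'] is [- J], and [|psi|^(2s) = (2 s + 2) g]. *)
Let currentE : functional_N s psi =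
  - ((2 * s + 2) * \int[mu]_x (g (q x) * current a b a1 b1 x)).
Proof.
have [mw rE1 iE1] := weak_derivative_parts rp.
have [rE iE] := represents_parts rp.
have iJ := current_integrable s1 hE.
rewrite -mulNr -RintegralZl// /functional_N /cintegral.
transitivity (\int[mu]_x - (apow s (complex.Re (psi x) ^+ 2 + complex.Im (psi x) ^+ 2) *
    (complex.Re (psi x) * complex.Im (weak_derivative psi x) -
     complex.Im (psi x) * complex.Re (weak_derivative psi x)))).
  apply: eq_Rintegral => x _.
  have -> : cabs (psi x) `^ (2 * s) = apow s (complex.Re (psi x) ^+ 2 + complex.Im (psi x) ^+ 2).
    by rewrite cabs_powR; congr (apow _ _); field.
  move: (apow s _) => G; case: (psi x) => y z; case: (weak_derivative psi x) => y1 z1.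
  by rewrite /=; ring.
have [mr mi] := mp; have [mr1 mi1] := mw.
apply: Rintegral_ae_eq.
- apply: measurable_funN; apply: measurable_funM; first exact: cmeasurable_apow.
  by apply: measurable_funB; exact: measurable_funM.
- by move/measurable_int : (integrable_funZ (- (2 * s + 2)) iJ) => /measurable_EFinP.
- apply: aeS (aeI (aeI rE iE) (aeI rE1 iE1)) => x [[-> ->] [-> ->]].
  by rewrite /gfun /current -/(q x); field; rewrite gt_eqF.
Qed.

Lemma S_tilde_real : S_tilde s omega c psi = real_action s kappa c a b a1 b1.
Proof.
rewrite /S_tilde -[_ * kappa * _]mulrA massE kineticE powerE' currentE /real_action.
move: (\int[mu]_x kinetic a1 b1 x) (\int[mu]_x (kappa * q x)) (\int[mu]_x (g (q x) * q x))
    (\int[mu]_x (g (q x) * current a b a1 b1 x)) => I1 I2 I3 I4.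
by field; rewrite gt_eqF.
Qed.

Lemma K_tilde_real alpha beta :
  K_tilde s omega c alpha beta psi = real_constraint s kappa c alpha beta a b a1 b1.
Proof.
rewrite /K_tilde -[_ * kappa * _]mulrA massE kineticE powerE' currentE /real_constraint.
move: (\int[mu]_x kinetic a1 b1 x) (\int[mu]_x (kappa * q x)) (\int[mu]_x (g (q x) * q x))
    (\int[mu]_x (g (q x) * current a b a1 b1 x)) => I1 I2 I3 I4.
by field; rewrite gt_eqF.
Qed.

End Represented.

Lemma expiD (x y : R) : expi x * expi y = expi (x + y).
Proof. by apply: complex_ext; rewrite ?ReMc ?ImMc/= ?cosD ?sinD; ring. Qed.

Lemma expi0 : expi 0 = 1 :> R[i].
Proof. by apply: complex_ext; rewrite /= ?cos0 ?sin0. Qed.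

Section Rotation.
Variables (k : R) (a b a1 b1 : R -> R).

(* Real and imaginary parts of [e^(i k x) (a + i b)] and of its derivative. *)
Definition rot_re x := cos (k * x) * a x - sin (k * x) * b x.
Definition rot_im x := cos (k * x) * b x + sin (k * x) * a x.
Definition rot_re1 x := cos (k * x) * a1 x - sin (k * x) * b1 x - k * rot_im x.
Definition rot_im1 x := cos (k * x) * b1 x + sin (k * x) * a1 x + k * rot_re x.

Lemma der_cosk (x : R) : is_derive x 1 (fun x => cos (k * x)) (- (k * sin (k * x))).
Proof. by apply: der_eq (der_comp (derZ k (der_id x)) (is_derive_cos _)) _; ring. Qed.

Lemma der_sink (x : R) : is_derive x 1 (fun x => sin (k * x)) (k * cos (k * x)).
Proof. by apply: der_eq (der_comp (derZ k (der_id x)) (is_derive_sin _)) _; ring. Qed.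

Let cck : continuous (fun x => cos (k * x)).
Proof. by move=> x; exact: is_derive1_continuous (der_cosk x). Qed.

Let csk : continuous (fun x => sin (k * x)).
Proof. by move=> x; exact: is_derive1_continuous (der_sink x). Qed.

Let ac_cosk : ac_on (fun x => cos (k * x)) (fun x => - (k * sin (k * x))).
Proof.
by apply: ac_on_FTC der_cosk => x; apply: cvgN; exact: contZ csk x.
Qed.

Let ac_sink : ac_on (fun x => sin (k * x)) (fun x => k * cos (k * x)).
Proof.
by apply: ac_on_FTC der_sink; exact: contZ.
Qed.

Lemma cmeasurable_expi psi : cmeasurable psi ->
  cmeasurable (fun x => expi (k * x) * psi x).
Proof.
move=> [mr mi].
have mc : measurable_fun setT (fun x : R => cos (k * x)).
  exact: continuous_measurable_fun.
have ms : measurable_fun setT (fun x : R => sin (k * x)).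
  exact: continuous_measurable_fun.
split.
  have -> : (fun x => complex.Re (expi (k * x) * psi x)) =
      (fun x => cos (k * x) * complex.Re (psi x) - sin (k * x) * complex.Im (psi x)).
    by apply/funext => x; rewrite ReMc.
  by apply: measurable_funB; exact: measurable_funM.
have -> : (fun x => complex.Im (expi (k * x) * psi x)) =
    (fun x => cos (k * x) * complex.Im (psi x) + sin (k * x) * complex.Re (psi x)).
  by apply/funext => x; rewrite ImMc.
by apply: measurable_funD; exact: measurable_funM.
Qed.

Lemma represents_rot psi : represents psi a b a1 b1 ->
  represents (fun x => expi (k * x) * psi x) rot_re rot_im rot_re1 rot_im1.
Proof.
move=> [mp pE aa ab]; split; first exact: cmeasurable_expi.
- by apply: aeS pE => x ->; apply: complex_ext; rewrite ?ReMc ?ImMc.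
- have := ac_onD (ac_onM ac_cosk aa) (ac_onN (ac_onM ac_sink ab)).
  by congr ac_on; apply/funext => x; rewrite /rot_re1 /rot_im; ring.
- have := ac_onD (ac_onM ac_cosk ab) (ac_onM ac_sink aa).
  by congr ac_on; apply/funext => x; rewrite /rot_im1 /rot_re; ring.
Qed.

Lemma density_rot x : density rot_re rot_im x = density a b x.
Proof.
rewrite /density /rot_re /rot_im.
transitivity ((cos (k * x) ^+ 2 + sin (k * x) ^+ 2) * (a x ^+ 2 + b x ^+ 2)); first by ring.
by rewrite cos2Dsin2 mul1r.
Qed.

End Rotation.

End Functionals.

(** * The Euler-Lagrange equation in real form and the gauge transformation *)

Section EulerLagrange.
Context {R : realType}.
Local Open Scope complex_scope.
Local Open Scope ring_scope.
Variables (s omega c : R).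
Hypotheses (s1 : 1 <= s)
  (homega : c ^+ 2 / 4 < omega \/ (omega = c ^+ 2 / 4 /\ 0 < c)).
Local Notation mu := (@lebesgue_measure R).
Local Notation intble A f := (mu.-integrable A (EFin \o f)).
Local Notation kappa := (omega - c ^+ 2 / 4).
Local Notation g := (gfun s).
Implicit Types (psi phi : R -> R[i]) (f h a b A B : R -> R).

Let s0 : 0 < s. Proof. exact: lt_le_trans ltr01 s1. Qed.
Let s2 : 0 < 2 * s + 2. Proof. by rewrite addr_gt0 ?mulr_gt0. Qed.

Lemma test_integrable h f : locally_integrable setT h -> test_function f ->
  intble setT (fun x => h x * f x).
Proof.
move=> lh tf; have [M M0 HM] := test_function_supp tf.
apply: (@integrable_supp _ _ (- M) M).
  under eq_fun do rewrite mulrC.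
  by apply: locintM => //; exact: test_function_continuous.
move=> x xM; have [|-> _] := HM x; last by rewrite mulr0.
by rewrite ler_normr; apply/orP; case: xM => h'; [right|left]; lra.
Qed.

Lemma pairing_ae psi a b f : cmeasurable psi -> measurable_fun setT a ->
  measurable_fun setT b -> {ae mu, forall x, complex.Re (psi x) = a x} ->
  {ae mu, forall x, complex.Im (psi x) = b x} -> test_function f ->
  pairing psi f = ((\int[mu]_x (a x * f x)) +i* (\int[mu]_x (b x * f x)))%C.
Proof.
move=> [mr mi] ma mb rE iE tf.
have mf : measurable_fun setT f.
  by apply: continuous_measurable_fun; exact: test_function_continuous.
rewrite pairingE; congr (_ +i* _)%C; apply: Rintegral_ae_eq; try exact: measurable_funM.
  by apply: aeS rE => x ->.
by apply: aeS iE => x ->.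
Qed.

Section OneFunction.
Variables (phi : R -> R[i]) (A B A1 B1 : R -> R).
Hypothesis rp : represents phi A B A1 B1.

(* Parts of [omega phi + i c phi' - i |phi|^(2s) phi'] for [phi = A + i B]: the
   Euler-Lagrange equation says that this is [phi'']. *)
Definition force_re x :=
  omega * A x - c * B1 x + apow s (density A B x) * B1 x.
Definition force_im x :=
  omega * B x + c * A1 x - apow s (density A B x) * A1 x.

Let aA : ac_on A A1. Proof. by case: rp. Qed.
Let aB : ac_on B B1. Proof. by case: rp. Qed.
Let cA : continuous A. Proof. exact: ac_on_continuous aA. Qed.
Let cB : continuous B. Proof. exact: ac_on_continuous aB. Qed.
Let lA1 : locally_integrable setT A1. Proof. by case: aA. Qed.
Let lB1 : locally_integrable setT B1. Proof. by case: aB. Qed.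

Lemma power_density_continuous : continuous (fun x => apow s (density A B x)).
Proof.
apply: cont_comp; last exact: apow_continuous.
by apply: contD; exact: contM.
Qed.
Let cq := power_density_continuous.

Let lqA1 : locally_integrable setT (fun x => apow s (density A B x) * A1 x).
Proof. exact: locintM. Qed.
Let lqB1 : locally_integrable setT (fun x => apow s (density A B x) * B1 x).
Proof. exact: locintM. Qed.

Lemma force_locint : locally_integrable setT force_re /\ locally_integrable setT force_im.
Proof.
have lA : locally_integrable setT A by exact: continuous_locint.
have lB : locally_integrable setT B by exact: continuous_locint.
split.
  have := locally_integrableD (locally_integrableD (locintZ omega lA) (locintZ (- c) lB1)) lqB1.
  by congr (locally_integrable _ _); apply/funext => x; rewrite /force_re /=; ring.
have := locally_integrableD (locally_integrableD (locintZ omega lB) (locintZ c lA1)) (locintZ (- 1) lqA1).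
by congr (locally_integrable _ _); apply/funext => x; rewrite /force_im /=; ring.
Qed.

(** Only one of the two derivatives is taken off the test function, by the weak derivative of [phi].
    The equation then says that the force is the weak derivative of [phi']. *)
Let critical_real f : test_function f ->
  - pairing phi (derive1n 2 f) + omega%:C * pairing phi f
  + 'i%C * c%:C * pairing (weak_derivative phi) f
  - 'i%C * pairing (fun x => (cabs (phi x) `^ (2 * s))%:C * weak_derivative phi x) f =
  ((\int[mu]_x (A1 x * derive1 f x) + \int[mu]_x (force_re x * f x)) +i*
   (\int[mu]_x (B1 x * derive1 f x) + \int[mu]_x (force_im x * f x)))%C.
Proof.
move=> tf; have tf1 := test_function_derive tf.
have [mw rE1 iE1] := weak_derivative_parts rp.
have [rE iE] := represents_parts rp.
have [mA mB mA1 mB1] := represents_measurable rp.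
have mp : cmeasurable phi by case: rp.
have [_ [_ wd]] := represents_weak_derivative rp.
have -> : pairing phi (derive1n 2 f) =
   - ((\int[mu]_x (A1 x * derive1 f x)) +i* (\int[mu]_x (B1 x * derive1 f x)))%C.
  by rewrite -(pairing_ae mw mA1 mB1 rE1 iE1 tf1); exact: wd.
rewrite (pairing_ae mp mA mB rE iE tf) (pairing_ae mw mA1 mB1 rE1 iE1 tf).
have mqw : cmeasurable (fun x => (cabs (phi x) `^ (2 * s))%:C * weak_derivative phi x).
  have mq : measurable_fun setT (fun x => cabs (phi x) `^ (2 * s)).
    under eq_fun do rewrite cabs_powR.
    by apply: cmeasurable_apow => //; rewrite divr_gt0 ?mulr_gt0.
  have [mr mi] := mw; split.
    have -> : (fun x => complex.Re ((cabs (phi x) `^ (2 * s))%:C * weak_derivative phi x)) =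
      (fun x => cabs (phi x) `^ (2 * s) * complex.Re (weak_derivative phi x)).
      by apply/funext => x; rewrite ReMc/= mul0r subr0.
    exact: measurable_funM.
  have -> : (fun x => complex.Im ((cabs (phi x) `^ (2 * s))%:C * weak_derivative phi x)) =
      (fun x => cabs (phi x) `^ (2 * s) * complex.Im (weak_derivative phi x)).
    by apply/funext => x; rewrite ImMc/= mul0r addr0.
  exact: measurable_funM.
have E2 : 2 * s / 2 = s by field.
have qr : {ae mu, forall x, complex.Re ((cabs (phi x) `^ (2 * s))%:C * weak_derivative phi x) =
   apow s (density A B x) * A1 x}.
  apply: aeS (aeI (aeI rE iE) (aeI rE1 iE1)) => x [[E3 E4] [E5 E6]].
  by rewrite ReMc/= mul0r subr0 cabs_powR E2 E3 E4 E5.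
have qi : {ae mu, forall x, complex.Im ((cabs (phi x) `^ (2 * s))%:C * weak_derivative phi x) =
   apow s (density A B x) * B1 x}.
  apply: aeS (aeI (aeI rE iE) (aeI rE1 iE1)) => x [[E3 E4] [E5 E6]].
  by rewrite ImMc/= mul0r addr0 cabs_powR E2 E3 E4 E6.
have [mqA1 _ _] := lqA1; have [mqB1 _ _] := lqB1.
rewrite (pairing_ae mqw mqA1 mqB1 qr qi tf).
have iA := test_integrable (continuous_locint cA) tf.
have iB := test_integrable (continuous_locint cB) tf.
have iA1 := test_integrable lA1 tf; have iB1 := test_integrable lB1 tf.
have iqA1 := test_integrable lqA1 tf; have iqB1 := test_integrable lqB1 tf.
have -> : \int[mu]_x (force_re x * f x) = omega * (\int[mu]_x (A x * f x)) +
    (- c) * (\int[mu]_x (B1 x * f x)) + 1 * (\int[mu]_x (apow s (density A B x) * B1 x * f x)) +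
    0 * (\int[mu]_x (A x * f x)).
  rewrite -(Rintegral_lin4 _ _ _ _ iA iB1 iqB1 iA).
  by apply: eq_Rintegral => x _; rewrite /force_re; ring.
have -> : \int[mu]_x (force_im x * f x) = omega * (\int[mu]_x (B x * f x)) +
    c * (\int[mu]_x (A1 x * f x)) + (- 1) * (\int[mu]_x (apow s (density A B x) * A1 x * f x)) +
    0 * (\int[mu]_x (A x * f x)).
  rewrite -(Rintegral_lin4 _ _ _ _ iB iA1 iqA1 iA).
  by apply: eq_Rintegral => x _; rewrite /force_im; ring.
move: (\int[mu]_x (A x * f x)) (\int[mu]_x (B x * f x)) (\int[mu]_x (A1 x * f x))
  (\int[mu]_x (B1 x * f x)) (\int[mu]_x (apow s (density A B x) * A1 x * f x))
  (\int[mu]_x (apow s (density A B x) * B1 x * f x)) (\int[mu]_x (A1 x * derive1 f x))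
  (\int[mu]_x (B1 x * derive1 f x)) => I1 I2 I3 I4 I5 I6 I7 I8.
by apply: complex_ext; rewrite /=; ring.
Qed.

Lemma critical_pointE : critical_point s omega c phi <->
  real_weak_derivative A1 force_re /\ real_weak_derivative B1 force_im.
Proof.
have [lr li] := force_locint; split=> [cp|[[_ [_ hr]] [_ [_ hi]]] f tf].
  split; split=> //; split=> // f tf; have := cp f tf; rewrite critical_real// => -[E1 E2].
    by apply/eqP; rewrite -addr_eq0 E1.
  by apply/eqP; rewrite -addr_eq0 E2.
by rewrite critical_real// hr// hi// !addNr.
Qed.

(** Bootstrap: [A1] and [B1] have locally integrable weak derivatives, hence continuous
    representatives [A2] and [B2]. With these the force is continuous, so [A2] and [B2] are
    differentiable everywhere. *)
Lemma critical_regular : critical_point s omega c phi -> exists A2 B2 : R -> R,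
  forall x : R, [/\ is_derive x 1 A (A2 x), is_derive x 1 B (B2 x),
    is_derive x 1 A2 (omega * A x - c * B2 x + apow s (density A B x) * B2 x) &
    is_derive x 1 B2 (omega * B x + c * A2 x - apow s (density A B x) * A2 x)].
Proof.
move=> /critical_pointE[/weak_derivative_ac_on[A2 aA2 A2E] /weak_derivative_ac_on[B2 aB2 B2E]].
have cA2 : continuous A2 by exact: ac_on_continuous aA2.
have cB2 : continuous B2 by exact: ac_on_continuous aB2.
have cr : continuous (fun x => omega * A x - c * B2 x + apow s (density A B x) * B2 x).
  by apply: contD; [apply: contB; exact: contZ|exact: contM].
have ci : continuous (fun x => omega * B x + c * A2 x - apow s (density A B x) * A2 x).
  by apply: contB; [apply: contD; exact: contZ|exact: contM].
have a1 : ac_on A A2 by exact: ac_on_ae (continuous_locint cA2) A2E aA.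
have a2 : ac_on B B2 by exact: ac_on_ae (continuous_locint cB2) B2E aB.
have a3 : ac_on A2 (fun x => omega * A x - c * B2 x + apow s (density A B x) * B2 x).
  apply: ac_on_ae (continuous_locint cr) _ aA2.
  by apply: aeS B2E => x E; rewrite /force_re E.
have a4 : ac_on B2 (fun x => omega * B x + c * A2 x - apow s (density A B x) * A2 x).
  apply: ac_on_ae (continuous_locint ci) _ aB2.
  by apply: aeS A2E => x E; rewrite /force_im E.
exists A2, B2 => x; split.
- exact: ac_on_is_derive_continuous a1 (cA2 x).
- exact: ac_on_is_derive_continuous a2 (cB2 x).
- exact: ac_on_is_derive_continuous a3 (cr x).
- exact: ac_on_is_derive_continuous a4 (ci x).
Qed.

End OneFunction.

Lemma der_rot (k : R) a b (x da db : R) :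
  is_derive x 1 a da -> is_derive x 1 b db ->
  is_derive x 1 (rot_re k a b) (cos (k * x) * da - sin (k * x) * db - k * rot_im k a b x) /\
  is_derive x 1 (rot_im k a b) (cos (k * x) * db + sin (k * x) * da + k * rot_re k a b x).
Proof.
move=> dA dB; have dc := der_cosk k x; have ds := der_sink k x; split.
  by apply: der_eq (derB (derM dc dA) (derM ds dB)) _; rewrite /rot_im; ring.
by apply: der_eq (derD (derM dc dB) (derM ds dA)) _; rewrite /rot_re; ring.
Qed.

Lemma rotK (k : R) a b : rot_re (- k) (rot_re k a b) (rot_im k a b) = a /\
  rot_im (- k) (rot_re k a b) (rot_im k a b) = b.
Proof.
split; apply/funext => x; rewrite /rot_re /rot_im mulNr cosN sinN.
  transitivity ((cos (k * x) ^+ 2 + sin (k * x) ^+ 2) * a x); first by ring.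
  by rewrite cos2Dsin2 mul1r.
transitivity ((cos (k * x) ^+ 2 + sin (k * x) ^+ 2) * b x); first by ring.
by rewrite cos2Dsin2 mul1r.
Qed.

Lemma gauge_rot phi : gauge c phi = fun x => expi (- (c / 2) * x) * phi x.
Proof. by apply/funext => x; rewrite /gauge mulNr. Qed.

Lemma gaugeK phi : (fun x => expi (c / 2 * x) * gauge c phi x) = phi.
Proof. by apply/funext => x; rewrite /gauge mulrA expiD subrr expi0 mul1r. Qed.

Lemma cmeasurable_gauge phi : cmeasurable phi <-> cmeasurable (gauge c phi).
Proof.
split=> [|/(cmeasurable_expi (c / 2))]; last by rewrite gaugeK.
by move=> /(cmeasurable_expi (- (c / 2))); rewrite -gauge_rot.
Qed.

(** Rotation by [- c / 2] removes the term [i c phi'], lowers [omega] to [kappa] and extracts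
    [(c/2) |psi|^(2s) psi] from the nonlinearity. The derivatives in the energy space are exchanged
    for their continuous representatives. *)
Lemma critical_second_order phi a b a1 b1 : represents (gauge c phi) a b a1 b1 ->
  energy_space s kappa a b a1 b1 -> critical_point s omega c phi ->
  exists a2 b2, energy_space s kappa a b a2 b2 /\ second_order s kappa c a b a2 b2.
Proof.
move=> rp hE cp; have := represents_rot (c / 2) rp; rewrite gaugeK.
set A := rot_re _ _ _; set B := rot_im _ _ _ => rA.
have [A2 [B2 so]] := critical_regular rA cp.
have [aE bE] := rotK (c / 2) a b; rewrite -/A -/B in aE bE.
set k := - (c / 2) in aE bE.
pose a2 x := cos (k * x) * A2 x - sin (k * x) * B2 x - k * b x.
pose b2 x := cos (k * x) * B2 x + sin (k * x) * A2 x + k * a x.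
have da (x : R) : is_derive x 1 a (a2 x).
  by have [d1 d2 _ _] := so x; have [d _] := der_rot k d1 d2; rewrite aE bE in d.
have db (x : R) : is_derive x 1 b (b2 x).
  by have [d1 d2 _ _] := so x; have [_ d] := der_rot k d1 d2; rewrite aE bE in d.
have qE x : apow s (density A B x) = (2 * s + 2) * g (density a b x).
  by rewrite /A /B density_rot /gfun mulrCA mulfV ?mulr1// gt_eqF.
have ka x : a x = cos (k * x) * A x - sin (k * x) * B x by rewrite -[in LHS]aE.
have kb x : b x = cos (k * x) * B x + sin (k * x) * A x by rewrite -[in LHS]bE.
have so2 : second_order s kappa c a b a2 b2.
  move=> x; have [_ _ d3 d4] := so x; rewrite qE in d3 d4.
  have [dr di] := der_rot k d3 d4; split=> //.
  - have rE : rot_re k A2 B2 = fun x => cos (k * x) * A2 x - sin (k * x) * B2 x by [].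
    apply: der_eq (derB dr (derZ k (db x))) _.
    by move: (g _) => G; rewrite /b2 /rot_im ?ka ?kb /k; field.
  - apply: der_eq (derD di (derZ k (da x))) _.
    by move: (g _) => G; rewrite /a2 /rot_re ?ka ?kb /k; field.
exists a2, b2; split=> //.
have [aa ab i1 im] := hE.
have ca2 : continuous a2 by move=> x; have [_ _ d _] := so2 x; exact: is_derive1_continuous d.
have cb2 : continuous b2 by move=> x; have [_ _ _ d] := so2 x; exact: is_derive1_continuous d.
have aa2 : ac_on a a2 by exact: ac_on_FTC.
have ab2 : ac_on b b2 by exact: ac_on_FTC.
split=> //; apply: integrable_ae i1.
  by apply: measurable_funD; apply: measurable_funX; exact: continuous_measurable_fun.
by apply: aeS (aeI (ac_on_ae_unique aa aa2) (ac_on_ae_unique ab ab2)) => x [-> ->].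
Qed.

Lemma second_order_critical phi a b a1 b1 : represents (gauge c phi) a b a1 b1 ->
  second_order s kappa c a b a1 b1 -> critical_point s omega c phi.
Proof.
move=> rp so; have := represents_rot (c / 2) rp; rewrite gaugeK.
set k := c / 2; set A := rot_re _ _ _; set B := rot_im _ _ _.
set A1 := rot_re1 _ _ _ _ _; set B1 := rot_im1 _ _ _ _ _ => rA.
apply/(critical_pointE rA).
have qE x : apow s (density A B x) = (2 * s + 2) * g (density a b x).
  by rewrite /A /B density_rot /gfun mulrCA mulfV ?mulr1// gt_eqF.
have dA (x : R) : is_derive x 1 A (A1 x).
  by have [d1 d2 _ _] := so x; have [d _] := der_rot k d1 d2.
have dB (x : R) : is_derive x 1 B (B1 x).
  by have [d1 d2 _ _] := so x; have [_ d] := der_rot k d1 d2.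
have dA1 (x : R) : is_derive x 1 A1 (force_re A B B1 x).
  have [_ _ d3 d4] := so x; have [dr _] := der_rot k d3 d4.
  apply: der_eq (derB dr (derZ k (dB x))) _.
  rewrite /force_re qE; move: (g _) => G.
  by rewrite /A1 /B1 /A /B /rot_re1 /rot_im1 /rot_re /rot_im /k; field.
have dB1 (x : R) : is_derive x 1 B1 (force_im A B A1 x).
  have [_ _ d3 d4] := so x; have [_ di] := der_rot k d3 d4.
  apply: der_eq (derD di (derZ k (dA x))) _.
  rewrite /force_im qE; move: (g _) => G.
  by rewrite /A1 /B1 /A /B /rot_re1 /rot_im1 /rot_re /rot_im /k; field.
have cA : continuous A by move=> x; exact: is_derive1_continuous (dA x).
have cB : continuous B by move=> x; exact: is_derive1_continuous (dB x).
have cA1 : continuous A1 by move=> x; exact: is_derive1_continuous (dA1 x).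
have cB1 : continuous B1 by move=> x; exact: is_derive1_continuous (dB1 x).
have cq := power_density_continuous rA.
split; apply: ac_on_weak_derivative; apply: ac_on_FTC => //.
  by apply: contD; [apply: contB; exact: contZ|exact: contM].
by apply: contB; [apply: contD; exact: contZ|exact: contM].
Qed.

End EulerLagrange.

(** * Minimizers, critical points and the orbit as one set *)

Section Orbit.
Context {R : realType}.
Local Open Scope complex_scope.
Local Open Scope ring_scope.
Variables (s omega c : R).
Hypotheses (s1 : 1 <= s)
  (homega : c ^+ 2 / 4 < omega \/ (omega = c ^+ 2 / 4 /\ 0 < c)).
Local Notation mu := (@lebesgue_measure R).
Local Notation kappa := (omega - c ^+ 2 / 4).
Local Notation g := (gfun s).
Local Notation Y := (Ysol s kappa c).
Local Notation Q := (Qsol s kappa c).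
Implicit Types (phi : R -> R[i]).

Let s0 : 0 < s. Proof. exact: lt_le_trans ltr01 s1. Qed.
Let s2 : 0 < 2 * s + 2. Proof. by rewrite addr_gt0 ?mulr_gt0. Qed.
Let s10 : 0 < s + 1. Proof. by rewrite addr_gt0. Qed.
Let k0 : 0 <= kappa. Proof. exact: kappa_ge0 homega. Qed.
Let hkc := kappa_cases homega.
Let Y0 x : 0 < Y x. Proof. exact: Ysol_gt0. Qed.
Let Q0 x : 0 < Q x. Proof. exact: Qsol_gt0. Qed.

Lemma profile_modulusE x : profile_modulus s omega c x = Num.sqrt (Q x).
Proof.
have -> : profile_modulus s omega c x = (Y x)^-1 `^ (1 / (2 * s)).
  congr (_ `^ _); rewrite /Ysol subr_gt0; case: ifPn => [h|hn]; last first.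
    by rewrite invf_div; congr (_ / _); ring.
  have kp : 0 < kappa by rewrite subr_gt0.
  have o0 : 0 < omega by apply: le_lt_trans h; rewrite divr_ge0 ?sqr_ge0.
  have four : Num.sqrt 4 = 2 :> R.
    by have -> : 4 = 2 ^+ 2 :> R by [ring]; rewrite sqrtr_sqr ger0_norm.
  have r1 : Num.sqrt (4 * omega - c ^+ 2) = 2 * Num.sqrt kappa.
    have -> : 4 * omega - c ^+ 2 = 4 * kappa by field.
    by rewrite sqrtrM// four.
  have r2 : Num.sqrt (c ^+ 2 + 4 * kappa) = 2 * Num.sqrt omega.
    have -> : c ^+ 2 + 4 * kappa = 4 * omega by field.
    by rewrite sqrtrM// four.
  rewrite r1 r2 invf_div.
  have -> : s * (2 * Num.sqrt kappa) * x = 2 * s * Num.sqrt kappa * x by ring.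
  by congr (_ / _); field.
rewrite /Qsol -powR12_sqrt ?powR_ge0// -powRrM -(powR_inv1 (ltW (Y0 x))) -powRrM.
by congr (_ `^ _); field; rewrite gt_eqF.
Qed.

Lemma profile_modulus_power x :
  profile_modulus s omega c x `^ (2 * s) = (2 * s + 2) * g (Q x).
Proof.
rewrite profile_modulusE -powR12_sqrt ?(ltW (Q0 x))// -powRrM.
have -> : 2^-1 * (2 * s) = s by field.
by rewrite /gfun apow_eq ?(ltW (Q0 x))// mulrCA mulfV ?mulr1// gt_eqF.
Qed.

Definition wave_phase x := 1 / (2 * s + 2) *
  integral_from0 (fun y => profile_modulus s omega c y `^ (2 * s)) x.

Lemma der_wave_phase (x : R) : is_derive x 1 wave_phase (g (Q x)).
Proof.
have cgQ : continuous (fun x => g (Q x)) by exact: gQ_continuous hkc.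
have ch : continuous (fun x => (2 * s + 2) * g (Q x)) by exact: contZ.
have [F dF] := continuous_primitive ch.
have aF : ac_on F (fun x => (2 * s + 2) * g (Q x)) by exact: ac_on_FTC.
have -> : wave_phase = fun x => (2 * s + 2)^-1 * (F x - F 0).
  apply/funext => y; rewrite /wave_phase mul1r; congr (_ * _).
  have -> : (fun y => profile_modulus s omega c y `^ (2 * s)) = (fun x => (2 * s + 2) * g (Q x)).
    by apply/funext => t; rewrite profile_modulus_power.
  rewrite /integral_from0; case: leP => y0; first by rewrite (aF.2 _ _ y0).
  by rewrite -(aF.2 _ _ (ltW y0)) opprB.
apply: der_eq (derZ _ (derB (dF x) (der_cst x (F 0)))) _.
by rewrite subr0 mulrA mulVf ?mul1r// gt_eqF.
Qed.

Lemma gauge_wave (theta0 x0 x : R) :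
  expi (- (c / 2 * x)) * (expi theta0 * solitary_wave s omega c (x - x0)) =
  (Num.sqrt (Q (x - x0)) * cos (theta0 - c / 2 * x0 - wave_phase (x - x0))) +i*
  (Num.sqrt (Q (x - x0)) * sin (theta0 - c / 2 * x0 - wave_phase (x - x0))).
Proof.
rewrite /solitary_wave -/(wave_phase (x - x0)) profile_modulusE.
rewrite [_%:C * _]mulrC [expi theta0 * _]mulrA expiD mulrA expiD.
have -> : - (c / 2 * x) + (theta0 + (c / 2 * (x - x0) - wave_phase (x - x0))) =
   theta0 - c / 2 * x0 - wave_phase (x - x0) by ring.
by apply: complex_ext; rewrite /=; ring.
Qed.

(** The common form with which each of the three sets is identified. It keeps the first-order
    equation and the density but no explicit phase, so that both the variational and the critical
    point arguments end here. *)
Definition is_wave phi := cmeasurable phi /\ exists a b h x0,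
  [/\ profile_flow s h a b, forall x, density a b x = Q (x - x0) &
    {ae mu, forall x, gauge c phi x = a x +i* b x}].

Lemma orbitE phi : solitary_wave_orbit s omega c phi <-> is_wave phi.
Proof.
split=> [[mp [theta0 [x0 [_ pE]]]]|[mp [a [b [h [x0 [hf qE gE]]]]]]]; split=> //.
  have [hf qE] := wave_flow s1 k0 hkc (theta0 - c / 2 * x0) x0 der_wave_phase.
  exists (fun x => Num.sqrt (Q (x - x0)) * cos (theta0 - c / 2 * x0 - wave_phase (x - x0))),
    (fun x => Num.sqrt (Q (x - x0)) * sin (theta0 - c / 2 * x0 - wave_phase (x - x0))),
    (fun x => profile_slope s kappa c (x - x0)), x0; split=> //.
  by apply: aeS pE => x; rewrite /gauge => ->; exact: gauge_wave.
have [theta _ ab] := phase_form s1 hkc hf qE der_wave_phase.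
(* The gauge factor adds [c x0 / 2] to the phase, which may leave [[0, 2 pi)]; [theta0] is the angle
   of that interval with the same cosine and sine. *)
have [theta0 th [ct st]] := unit_circle_angle (cos2Dsin2 (theta + c / 2 * x0)).
exists theta0, x0; split=> //; apply: aeS gE => x.
have -> : phi x = expi (c / 2 * x) * gauge c phi x by rewrite -[in LHS](gaugeK c phi).
move=> ->; apply: (mulfI (x := expi (- (c / 2 * x)))).
  apply/eqP => E; have := expi0 (R := R); rewrite -(addNr (c / 2 * x)) -expiD E mul0r.
  by move/eqP; rewrite eq_sym oner_eq0.
rewrite mulrA expiD addNr expi0 mul1r gauge_wave.
have [-> ->] := ab x.
have cE (t : R) : cos (theta0 - c / 2 * x0 - t) = cos (theta - t).
  have -> : theta0 - c / 2 * x0 - t = theta0 + (- (c / 2 * x0) - t) by ring.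
  by rewrite cosD -ct -st -cosD; congr cos; ring.
have sE (t : R) : sin (theta0 - c / 2 * x0 - t) = sin (theta - t).
  have -> : theta0 - c / 2 * x0 - t = theta0 + (- (c / 2 * x0) - t) by ring.
  by rewrite sinD -ct -st -sinD; congr sin; ring.
by rewrite cE sE.
Qed.

Lemma admissible_nonzero phi a b a1 b1 : represents (gauge c phi) a b a1 b1 ->
  ~ ceq_ae (gauge c phi) (fun=> 0) <-> exists x, density a b x != 0.
Proof.
move=> [_ gE aa ab]; split=> [nz|[x0 x0n] gE0]; last first.
  have cq : continuous (density a b) by exact: ac_on_continuous (ac_on_sqr_modulus aa ab).
  have c0 : continuous (fun _ : R => 0 : R) by move=> x; exact: cvg_cst.
  have q0 : {ae mu, forall x, density a b x = 0}.
    by apply: aeS (aeI gE gE0) => x [-> [xa xb]]; rewrite /density xa xb expr0n addr0.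
  by move: x0n; rewrite (continuous_ae_eq cq c0 q0) eqxx.
apply: contrapT => /forallNP q0; apply: nz; apply: aeS gE => x ->.
have /negP/negPn := q0 x; rewrite paddr_eq0 ?sqr_ge0// !sqrf_eq0.
by move=> /andP[/eqP -> /eqP ->].
Qed.

Lemma wave_represents phi : is_wave phi -> exists a b a1 b1,
  [/\ represents (gauge c phi) a b a1 b1, energy_space s kappa a b a1 b1,
    second_order s kappa c a b a1 b1, exists x, density a b x != 0 &
    (forall alpha beta, real_constraint s kappa c alpha beta a b a1 b1 = 0) /\
    forall Gam : R -> R, (forall t : R, is_derive t 1 Gam (swfun s kappa c t)) ->
      real_action s kappa c a b a1 b1 = Gam (qtop s kappa c) - Gam 0].
Proof.
move=> [mp [a [b [h [x0 [hf qE gE]]]]]].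
have hE := flow_energy_space s1 k0 hkc hf qE.
exists a, b, (fun x => h x * a x + g (density a b x) * b x),
  (fun x => h x * b x - g (density a b x) * a x); split=> //.
- by have [aa ab _ _] := hE; split=> //; exact: (cmeasurable_gauge _ _).1 mp.
- exact (flow_second_order s1 k0 hkc hf qE).
- by exists x0; rewrite qE gt_eqF.
- split=> [alpha beta|Gam dG]; first exact (flow_constraint s1 k0 hkc hf qE _ _).
  exact (flow_action s1 k0 hkc hf qE dG).
Qed.

Lemma wave_admissible phi : is_wave phi -> admissible s omega c phi.
Proof.
move=> /wave_represents[a [b [a1 [b1 [rp hE _ nz _]]]]]; split.
  exact (energy_in_X s1 rp hE).
exact/(admissible_nonzero rp).
Qed.

Lemma critical_pointsE phi : critical_points s omega c phi <-> is_wave phi.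
Proof.
split=> [[[inX nz] cp]|wp].
  have [a [b [a1 [b1 [rp hE]]]]] := in_X_energy s1 inX.
  have {}nz : exists x, density a b x != 0 by exact/(admissible_nonzero rp).
  have [a2 [b2 [hE2 so]]] := critical_second_order s1 rp hE cp.
  have [mg gE _ _] := rp.
  have [x0 qE] := critical_density s1 k0 hkc hE2 so nz.
  split; first exact: (cmeasurable_gauge _ _).2 mg.
  by exists a, b; eexists; exists x0; split; [exact (critical_flow s1 k0 hE2 so nz)|exact: qE|exact: gE].
split; first exact: wave_admissible.
have [a [b [a1 [b1 [rp _ so _ _]]]]] := wave_represents wp.
exact (second_order_critical s1 rp so).
Qed.

(** Supplies the competitor that bounds the infimum from above. *)
Lemma wave_exists : exists phi, is_wave phi.
Proof.
have [hf qE] := wave_flow s1 k0 hkc 0 0 der_wave_phase.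
have [aa ab _ _] := flow_energy_space s1 k0 hkc hf qE.
set a := fun x => _ * cos _ in hf qE aa ab; set b := fun x => _ * sin _ in hf qE aa ab.
exists (fun x => expi (c / 2 * x) * (a x +i* b x)); split.
  apply: cmeasurable_expi; split; apply: continuous_measurable_fun.
    exact: ac_on_continuous aa.
  exact: ac_on_continuous ab.
exists a, b, (fun x => profile_slope s kappa c (x - 0)), 0; split=> //.
by apply: aeW => x; rewrite /gauge mulrA expiD addNr expi0 mul1r.
Qed.

Section Minimizers.
Variables alpha beta : R.
Hypotheses (hab1 : 0 < 2 * alpha - beta) (hab2 : 0 < 2 * alpha + beta)
  (hbc : beta * c <= 0).

(** The infimum is [d]: it is a lower bound by [variational] and is attained by every wave. The
    equality case then turns a minimizer into a wave. *)
Lemma minimizersE phi : minimizers s omega c alpha beta phi <-> is_wave phi.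
Proof.
have csw : continuous (swfun s kappa c) by exact: swfun_continuous.
have [Gam dG] := continuous_primitive csw.
pose d := Gam (qtop s kappa c) - Gam 0.
have wave_value psi : is_wave psi ->
    action_S s omega c psi = d /\ functional_K s omega c alpha beta psi = 0.
  move=> /wave_represents[a [b [a1 [b1 [rp hE _ _ [K0 Sd]]]]]].
  by rewrite /action_S (S_tilde_real s1 homega rp hE) Sd// /functional_K
    (K_tilde_real s1 homega rp hE).
have bound psi : admissible s omega c psi -> functional_K s omega c alpha beta psi = 0 ->
    d <= action_S s omega c psi /\ (action_S s omega c psi = d -> is_wave psi).
  move=> [inX nz]; have [a [b [a1 [b1 [rp hE]]]]] := in_X_energy s1 inX.
  have {}nz : exists x, density a b x != 0 by exact/(admissible_nonzero rp).
  rewrite /functional_K (K_tilde_real s1 homega rp hE) => K0.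
  rewrite /action_S (S_tilde_real s1 homega rp hE).
  have [dS _] := variational s1 k0 hkc hab1 hab2 hbc hE nz dG K0; split=> // SE.
  have [h hf [x0 qE]] := minimizer_flow s1 k0 hkc hab1 hab2 hbc hE nz dG K0 SE.
  have [mg gE _ _] := rp; split; first exact: (cmeasurable_gauge _ _).2 mg.
  by exists a, b, h, x0; split.
have muE : mu_min s omega c alpha beta = d%:E.
  apply/le_anti/andP; split.
    have [psi wp] := wave_exists; have [Sd Kd] := wave_value _ wp.
    rewrite -Sd; apply: ereal_inf_lbound; exists psi => //; split=> //.
    exact: wave_admissible.
  apply: le_ereal_inf_tmp => _ [psi [adm K0] <-]; rewrite lee_fin.
  exact: (bound psi adm K0).1.
split=> [[adm [SE K0]]|wp].
  by apply: (bound phi adm K0).2; move: SE; rewrite muE => -[].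
have [Sd Kd] := wave_value _ wp.
by split; [exact: wave_admissible|rewrite muE Sd].
Qed.

End Minimizers.

End Orbit.

Theorem theorem1p1 (R : realType) (sigma omega c alpha beta : R)
    (hsigma : 1 <= sigma)
    (homega : c ^+ 2 / 4 < omega \/ (omega = c ^+ 2 / 4 /\ 0 < c))
    (hab1 : 0 < 2 * alpha - beta) (hab2 : 0 < 2 * alpha + beta)
    (hbeta : c ^+ 2 / 4 < omega -> beta * c <= 0)
    (hbeta0 : omega = c ^+ 2 / 4 -> 0 < c -> beta < 0) :
  minimizers sigma omega c alpha beta = critical_points sigma omega c /\
  critical_points sigma omega c = solitary_wave_orbit sigma omega c.
Proof.
have hbc : beta * c <= 0.
  case: homega => [/hbeta//|[oE c0]].
  by rewrite mulr_le0_ge0 ?(ltW c0)// ltW// hbeta0.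
split; apply/seteqP; split=> phi.
- by move=> /(minimizersE hsigma homega hab1 hab2 hbc) /(critical_pointsE hsigma homega).
- by move=> /(critical_pointsE hsigma homega) /(minimizersE hsigma homega hab1 hab2 hbc).
- by move=> /(critical_pointsE hsigma homega) /(orbitE hsigma homega).
- by move=> /(orbitE hsigma homega) /(critical_pointsE hsigma homega).
Qed.
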